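(* Let $k$ be an algebraically closed field of any characteristic. For all integers $g\geq 1$ and $N\geq 2g+1$, and for all hyperelliptic curves $X$ of genus $g$ over $k$ embedded in their jacobian $J$ using a Weierstrass point $\infty$ as base point, we have $$\sharp (X\cap\tilde J[N])\leq\begin{cases} g(N^2-(2g)^2) & \text{if } N \text{ is even},\\ g(N^2-(2g-1)^2) & \text{if } N \text{ is odd}.\end{cases}$$
   Context: $X$ is the smooth projective completion, by one point $\infty$, of a smooth affine curve $y^2+Q(x)y=P(x)$ with $P\in k[x]$ monic of degree $2g+1$ and $Q\in k[x]$ of degree at most $g$ (for $g=1$ it is an elliptic curve with origin $\infty$). $X$ is viewed as a subset of $J$ via $\xi\mapsto$ class of $[\xi]-[\infty]$. $J[N]$ is the subgroup of $J(k)$ of points of order dividing $N$, and $\tilde J[N]=J[N]\setminus J[2]$. *)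

(* Defs.v *)
From HB Require Import structures.
From mathcomp Require Import all_boot all_order all_algebra.
From mathcomp Require Import generic_quotient ring_quotient ring zify.
From mathcomp Require Import boolp classical_sets functions cardinality.
From mathcomp.multinomials Require Import freeg.

Set Implicit Arguments.
Unset Strict Implicit.
Unset Printing Implicit Defensive.

Import Order.TTheory GRing.Theory Num.Theory.
Local Open Scope ring_scope.
Local Open Scope quotient_scope.

(* The affine curve y^2 + Q(x) y = P(x).  Its partial derivatives are
   d/dx = Q'(x) y - P'(x) and d/dy = 2 y + Q(x); smoothness is the Jacobian
   criterion, which over an algebraically closed field need only be tested at
   the k-points.  The genus of the smooth completion is then g. *)
Record hyperelliptic (k : closedFieldType) (g : nat) := Hyperelliptic {
  hypP : {poly k};
  hypQ : {poly k};
  hypP_monic : hypP \is monic;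
  size_hypP : size hypP = (2 * g + 2)%N;
  size_hypQ : (size hypQ <= g.+1)%N;
  hyp_smooth : forall a b : k, b ^+ 2 + hypQ.[a] * b = hypP.[a] ->
    hypQ^`().[a] * b - hypP^`().[a] != 0 \/ 2 * b + hypQ.[a] != 0
}.

Section Curve.
Variables (k : closedFieldType) (g : nat) (X : hyperelliptic k g).

Local Notation P := (hypP X).
Local Notation Q := (hypQ X).

Definition on_curve (p : k * k) : bool := p.2 ^+ 2 + Q.[p.1] * p.2 == P.[p.1].

Definition affine_point := {p : k * k | on_curve p}.

HB.instance Definition _ := Choice.on affine_point.

Definition point := option affine_point.

HB.instance Definition _ := Choice.on point.

Definition infty : point := None.

(* Polynomials in x and y are read as polynomials in y over k[x]. *)
Definition curve_eqn : {poly {poly k}} := 'X^2 + Q%:P * 'X - P%:P.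

Definition coord_ring := {poly %/ curve_eqn}.

HB.instance Definition _ := GRing.ComNzRing.on coord_ring.

Definition regular (p : {poly {poly k}}) : coord_ring := in_qpoly curve_eqn p.

HB.instance Definition _ := GRing.isZmodMorphism.Build _ coord_ring regular
  (raddfB (in_qpoly curve_eqn)).
HB.instance Definition _ := GRing.isMonoidMorphism.Build _ coord_ring regular
  (in_qpoly_monoid_morphism curve_eqn).

(* Membership in the n-th power of the maximal ideal (x - a, y - b). *)
Fixpoint max_ideal_exp (xi : affine_point) (n : nat) (f : coord_ring) : Prop :=
  if n is m.+1 then
    exists f1 f2, [/\ max_ideal_exp xi m f1, max_ideal_exp xi m f2 &
      f = regular ('X - (val xi).1%:P)%:P * f1
          + regular ('X - ((val xi).2%:P)%:P) * f2]
  else True.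

Definition affine_ord (xi : affine_point) (f : coord_ring) : nat :=
  xget 0%N [set n | max_ideal_exp xi n f /\ ~ max_ideal_exp xi n.+1 f].

(* At infinity x has a pole of order 2 and y a pole of order 2 g + 1, so the
   pole orders 2 deg a and 2 deg b + 2 g + 1 of the two terms of a(x) + b(x) y
   never coincide. *)
Definition pole_ord (f : coord_ring) : nat :=
  let a := (f : {poly {poly k}})`_0 in let b := (f : {poly {poly k}})`_1 in
  maxn (2 * (size a).-1)%N
    (if b == 0 then 0%N else (2 * (size b).-1 + (2 * g + 1))%N).

(* Meaningful for f != 0 only. *)
Definition ord (xi : point) (f : coord_ring) : int :=
  if xi is Some p then (affine_ord p f)%:Z else - (pole_ord f)%:Z.

Lemma size_curve_eqn : size curve_eqn = 3.
Proof.
rewrite /curve_eqn -addrA size_polyDl size_polyXn //.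
rewrite -polyCN size_MXaddC; case: ifP => // _.
by rewrite ltnS size_polyC; case: (_ != _).
Qed.

Lemma curve_eqn_monic : curve_eqn \is monic.
Proof.
rewrite monicE lead_coefE size_curve_eqn /= /curve_eqn.
by rewrite !(coefD, coefN, coefXn, coefCM, coefX, coefC) /= mulr0 subr0 addr0.
Qed.

Lemma mk_monic_curve_eqn : mk_monic curve_eqn = curve_eqn.
Proof. by rewrite /mk_monic size_curve_eqn curve_eqn_monic. Qed.

Lemma regular_eqn : regular curve_eqn = 0.
Proof.
apply: val_inj; rewrite /= mk_monic_curve_eqn.
by rewrite Pdiv.RingMonic.rmodpp ?curve_eqn_monic.
Qed.

Definition regC (p : {poly k}) : coord_ring := regular p%:P.
Definition regY : coord_ring := regular 'X.
Definition coefY0 (f : coord_ring) := (f : {poly {poly k}})`_0.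
Definition coefY1 (f : coord_ring) := (f : {poly {poly k}})`_1.

Lemma regCD p q : regC (p + q) = regC p + regC q.
Proof. by rewrite /regC polyCD rmorphD. Qed.
Lemma regCN p : regC (- p) = - regC p.
Proof. by rewrite /regC polyCN rmorphN. Qed.
Lemma regCM p q : regC (p * q) = regC p * regC q.
Proof. by rewrite /regC polyCM rmorphM. Qed.
Lemma regC0 : regC 0 = 0.
Proof. by rewrite /regC polyC0 rmorph0. Qed.
Lemma regC1 : regC 1 = 1.
Proof. by rewrite /regC polyC1 rmorph1. Qed.
Lemma regCX (p : {poly k}) (n : nat) : regC (p ^+ n) = regC p ^+ n.
Proof. by rewrite /regC polyC_exp; exact: rmorphXn. Qed.

Lemma regY2 : regY ^+ 2 = regC P - regC Q * regY.
Proof.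
have := regular_eqn; rewrite /curve_eqn rmorphB rmorphD !rmorphM /= -expr2.
rewrite -/(regC Q) -/(regC P) -/regY => /eqP; rewrite subr_eq0 => /eqP <-.
by rewrite addrK.
Qed.

Lemma regularE (f : coord_ring) : f = regC (coefY0 f) + regC (coefY1 f) * regY.
Proof.
have fE : f = regular (f : {poly {poly k}}).
  by apply/esym/val_inj/in_qpoly_small/size_mk_monic.
have sf : (size (f : {poly {poly k}}) < 3)%N.
  apply: leq_trans (size_mk_monic f) _.
  by rewrite mk_monic_curve_eqn size_curve_eqn.
rewrite {1}fE /regC /regY -rmorphM -rmorphD; congr regular.
apply/polyP => i; rewrite !(coefD, coefC, coefCM, coefX).
case: i => [|[|i]] //=; rewrite ?mulr0 ?addr0 ?mulr1 ?add0r //.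
by rewrite nth_default // -ltnS (leq_trans sf).
Qed.

Lemma coefYK p q : (coefY0 (regC p + regC q * regY) = p) * (coefY1 (regC p + regC q * regY) = q).
Proof.
have E : (regC p + regC q * regY : {poly {poly k}}) = p%:P + q%:P * 'X.
  rewrite /regC /regY -rmorphM -rmorphD; apply: in_qpoly_small.
  rewrite mk_monic_curve_eqn size_curve_eqn addrC size_MXaddC.
  case: ifP => // _; rewrite ltnS size_polyC; by case: (_ != _).
rewrite /coefY0 /coefY1 E !(coefD, coefC, coefCM, coefX) /=.
by rewrite mulr0 mulr1 addr0 add0r.
Qed.

Lemma regular_inj p q p' q' :
  regC p + regC q * regY = regC p' + regC q' * regY -> p = p' /\ q = q'.
Proof.
by move=> e; rewrite -(coefYK p q).1 -{2}(coefYK p q).2 e !coefYK.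
Qed.

Lemma coefY_regC p : (coefY0 (regC p) = p) * (coefY1 (regC p) = 0).
Proof.
have -> : regC p = regC p + regC 0 * regY by rewrite regC0 mul0r addr0.
by rewrite !coefYK.
Qed.

Lemma coefYD f h : (coefY0 (f + h) = coefY0 f + coefY0 h) * (coefY1 (f + h) = coefY1 f + coefY1 h).
Proof. by rewrite /coefY0 /coefY1 /= !coefD. Qed.

Lemma coefYM f h : (coefY0 (f * h) = coefY0 f * coefY0 h + coefY1 f * coefY1 h * P) *
             (coefY1 (f * h) = coefY0 f * coefY1 h + coefY1 f * coefY0 h - coefY1 f * coefY1 h * Q).
Proof.
have -> : f * h = regC (coefY0 f * coefY0 h + coefY1 f * coefY1 h * P) +
    regC (coefY0 f * coefY1 h + coefY1 f * coefY0 h - coefY1 f * coefY1 h * Q) * regY.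
  rewrite {1}(regularE f) {1}(regularE h) !(regCD, regCN, regCM).
  set A := regC (coefY0 f); set B := regC (coefY1 f).
  set C := regC (coefY0 h); set D := regC (coefY1 h).
  transitivity (A * C + (A * D + B * C) * regY + B * D * regY ^+ 2); first by ring.
  by rewrite regY2; ring.
by rewrite !coefYK.
Qed.

Definition reg_conj (f : coord_ring) : coord_ring := regC (coefY0 f - coefY1 f * Q) - regC (coefY1 f) * regY.

Lemma reg_conjD f h : reg_conj (f + h) = reg_conj f + reg_conj h.
Proof. rewrite /reg_conj !coefYD !(regCD, regCN, regCM); ring. Qed.

Lemma reg_conjM f h : reg_conj (f * h) = reg_conj f * reg_conj h.
Proof.
rewrite /reg_conj !coefYM !(regCD, regCN, regCM).
set A := regC (coefY0 f); set B := regC (coefY1 f).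
set C := regC (coefY0 h); set D := regC (coefY1 h).
set q := regC Q; set p := regC P.
transitivity ((A - B * q) * (C - D * q) - ((A - B * q) * D + B * (C - D * q)) * regY
   + B * D * (p - q * regY)); first by ring.
rewrite -regY2; ring.
Qed.

Definition reg_norm (f : coord_ring) : {poly k} := coefY0 f ^+ 2 - coefY0 f * coefY1 f * Q - coefY1 f ^+ 2 * P.

Lemma reg_normE f : regC (reg_norm f) = f * reg_conj f.
Proof.
transitivity ((regC (coefY0 f) + regC (coefY1 f) * regY) * reg_conj f); last by rewrite -regularE.
rewrite /reg_norm /reg_conj !(regCD, regCN, regCM, regCX).
set A := regC (coefY0 f); set B := regC (coefY1 f).
transitivity (A ^+ 2 - A * B * regC Q - B ^+ 2 * regC Q * regY - B ^+ 2 * regY ^+ 2).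
  rewrite regY2; ring.
ring.
Qed.

Lemma reg_normM f h : reg_norm (f * h) = reg_norm f * reg_norm h.
Proof. by rewrite /reg_norm !coefYM; ring. Qed.

Lemma coefY_neq0 f : f != 0 -> (coefY0 f != 0) || (coefY1 f != 0).
Proof.
apply: contraNT; rewrite negb_or !negbK => /andP[/eqP a0 /eqP b0].
by rewrite (regularE f) a0 b0 regC0 mul0r addr0.
Qed.

Let size_sqr (p : {poly k}) : p != 0 -> size (p ^+ 2) = ((2 * (size p).-1).+1)%N.
Proof.
move=> p0; rewrite mulnC -size_exp prednK // size_poly_gt0 expf_neq0 //.
Qed.

Lemma size_reg_norm_aux (a b : {poly k}) : (a != 0) || (b != 0) ->
  size (a ^+ 2 - a * b * Q - b ^+ 2 * P) =
  (maxn (2 * (size a).-1)%N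
        (if b == 0 then 0%N else (2 * (size b).-1 + (2 * g + 1))%N)).+1.
Proof.
have P0 : P != 0 by rewrite monic_neq0 ?hypP_monic.
have [-> /=|b0 _] := eqVneq b 0.
  rewrite orbF => a0; rewrite mulr0 mul0r expr0n mul0r !subr0 maxn0.
  exact: size_sqr.
have sbP : size (b ^+ 2 * P) = ((2 * (size b).-1 + (2 * g + 1)).+1)%N.
  by rewrite size_mul ?expf_neq0 // size_hypP size_sqr //; move: (size b).-1 => n; lia.
have sQ := size_hypQ X.
have [-> |a0] := eqVneq a 0.
  by rewrite expr0n /= !mul0r subr0 sub0r size_polyN sbP size_poly0 muln0 max0n.
have sa := size_sqr a0.
have sabQ : (size (a * b * Q)%R <= ((size a).-1 + (size b).-1 + g).+1)%N.
  have [->|Q0] := eqVneq Q 0; first by rewrite mulr0 size_poly0.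
  rewrite size_mul ?mulf_neq0 // size_mul //.
  move: a0 b0 Q0 sQ; rewrite -!size_poly_gt0.
  move: (size a) (size b) (size Q) => [|n] [|m] [|q] //= _ _ _.
  by rewrite ltnS addnS /= addnS /= ltnS leq_add2l.
move: sabQ sa sbP; move: (size a).-1 (size b).-1 => n m sabQ sa sbP.
have [lt|le] := ltnP (m + g)%N n.
  rewrite -addrA size_polyDl sa.
    by congr _.+1; apply/esym/maxn_idPl; lia.
  apply: leq_ltn_trans (size_polyD _ _) _; rewrite !size_polyN sbP gtn_max.
  by rewrite (leq_ltn_trans sabQ) /=; lia.
rewrite addrC size_polyDl size_polyN sbP.
  by congr _.+1; apply/esym/maxn_idPr; lia.
apply: leq_ltn_trans (size_polyD _ _) _; rewrite !size_polyN sa gtn_max.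
by rewrite (leq_ltn_trans sabQ) ?andbT /=; lia.
Qed.

Lemma size_reg_norm (f : coord_ring) : f != 0 -> size (reg_norm f) = (pole_ord f).+1.
Proof. by move=> /coefY_neq0; apply: size_reg_norm_aux. Qed.

Lemma reg_norm_neq0 f : f != 0 -> reg_norm f != 0.
Proof. by move=> f0; rewrite -size_poly_gt0 size_reg_norm. Qed.

Lemma coord_ring_mulf_neq0 (f h : coord_ring) : f != 0 -> h != 0 -> f * h != 0.
Proof.
move=> /reg_norm_neq0 f0 /reg_norm_neq0 h0; apply: contraTneq (mulf_neq0 f0 h0).
move=> fh0; rewrite -reg_normM fh0 /reg_norm /coefY0 /coefY1 /= !coef0.
by rewrite expr0n /= !mul0r !subr0 eqxx.
Qed.

Lemma pole_ordM (f h : coord_ring) :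
  f != 0 -> h != 0 -> pole_ord (f * h) = (pole_ord f + pole_ord h)%N.
Proof.
move=> f0 h0; have := size_reg_norm (coord_ring_mulf_neq0 f0 h0).
rewrite reg_normM size_mul ?reg_norm_neq0 // !size_reg_norm //.
by rewrite addSn /= addnS => -[].
Qed.

Section Local.
Variable xi : affine_point.
Let a := (val xi).1.
Let b := (val xi).2.
Let u1 : coord_ring := regular ('X - a%:P)%:P.
Let u2 : coord_ring := regular ('X - (b%:P)%:P).
Let M := max_ideal_exp xi.
Let s (c : k) : coord_ring := regC c%:P.

Let u2E : u2 = regY - s b.
Proof. by rewrite /u2 rmorphB. Qed.

Let MSE n f : M n.+1 f <->
  exists f1 f2, [/\ M n f1, M n f2 & f = u1 * f1 + u2 * f2].
Proof. by []. Qed.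

Let MD n f h : M n f -> M n h -> M n (f + h).
Proof.
elim: n f h => // n IH f h [f1 [f2 [m1 m2 ->]]] [h1 [h2 [n1 n2 ->]]].
by exists (f1 + h1), (f2 + h2); split; [exact: IH..|rewrite -/u1 -/u2; ring].
Qed.

Let MMl n f h : M n h -> M n (f * h).
Proof.
elim: n h => // n IH h [h1 [h2 [n1 n2 ->]]].
by exists (f * h1), (f * h2); split; [exact: IH..|rewrite -/u1 -/u2; ring].
Qed.

Let MB n f h : M n f -> M n h -> M n (f - h).
Proof. by move=> mf mh; apply: MD => //; rewrite -mulN1r; apply: MMl. Qed.

Let MS n f : M n.+1 f -> M n f.
Proof.
elim: n f => // n IH f [f1 [f2 [m1 m2 ->]]].
by exists f1, f2; split=> //; apply: IH.
Qed.

Let Mle m n f : (m <= n)%N -> M n f -> M m f.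
Proof.
elim: n => [|n IH]; first by rewrite leqn0 => /eqP ->.
by rewrite leq_eqVlt => /orP[/eqP->//|le] /MS; apply: IH.
Qed.

Let MM n m f h : M n f -> M m h -> M (n + m) (f * h).
Proof.
elim: n f => [|n IH] f; first by move=> _; apply: MMl.
move=> [f1 [f2 [m1 m2 ->]]] mh.
exists (f1 * h), (f2 * h); split; [exact: IH..|rewrite -/u1 -/u2; ring].
Qed.

Let Mu1 : M 1 u1.
Proof. by exists 1, 0; split=> //; rewrite mulr0 mulr1 addr0. Qed.
Let Mu2 : M 1 u2.
Proof. by exists 0, 1; split=> //; rewrite mulr0 mulr1 add0r. Qed.

Let taylor (p : {poly k}) : {q | p = p.[a]%:P + ('X - a%:P) * q}.
Proof.
have : root (p - p.[a]%:P) a by rewrite /root !hornerE subrr.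
move/factor_theorem/sig_eqW => [q e]; exists q.
by rewrite mulrC -e addrC subrK.
Qed.

Let M_eval f : exists c, M 1 (f - s c).
Proof.
have [q0 e0] := taylor (coefY0 f); have [q1 e1] := taylor (coefY1 f).
exists ((coefY0 f).[a] + (coefY1 f).[a] * b).
exists (regC q0 + regC q1 * regY), (s (coefY1 f).[a]); split=> //.
rewrite -/u1 -/u2 u2E {1}(regularE f) {1}e0 {1}e1 /s polyCD polyCM.
rewrite !(regCD, regCM) -!/(s _) /u1 -/(regC _); ring.
Qed.

Let on_xi : b ^+ 2 + Q.[a] * b = P.[a].
Proof. by apply/eqP; case: xi @a @b. Qed.

Let G : {poly k} := (b ^+ 2)%:P + b%:P * Q - P.

Let Ga0 : G.[a] = 0.
Proof. by rewrite /G !hornerE -on_xi; ring. Qed.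

Let GE : exists h, G = ('X - a%:P) * h /\ h.[a] = Q^`().[a] * b - P^`().[a].
Proof.
have [h eh] := taylor G; move: eh; rewrite Ga0 add0r => eh; exists h; split=> //.
have : G^`().[a] = h.[a].
  by rewrite eh derivM !derivE !hornerE subrr; ring.
by move=> <-; rewrite /G !derivE !hornerE; ring.
Qed.

Let rel : M 2 (s (Q^`().[a] * b - P^`().[a]) * u1 + s (2 * b + Q.[a]) * u2).
Proof.
have [h [eG eh]] := GE.
have [q eq] := taylor Q; have [h' eh'] := taylor h.
have E : s (Q^`().[a] * b - P^`().[a]) * u1 + s (2 * b + Q.[a]) * u2 =
   - (u1 * (u1 * regC h') + u1 * regC q * u2 + u2 * u2).
  have : regC G + (s (2 * b) + regC Q) * u2 + u2 ^+ 2 = 0.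
    rewrite u2E /G !(regCD, regCN, regCM) -!/(s _).
    have -> : s (b ^+ 2) = s b ^+ 2 by rewrite /s polyC_exp regCX.
    have -> : s (2 * b) = 2 * s b by rewrite -[2]/(1 + 1) /s mulrDl mul1r polyCD regCD -/(s b); ring.
    transitivity (regY ^+ 2 + regC Q * regY - regC P); first by ring.
    by rewrite regY2; ring.
  rewrite eG {1}eq {1}eh' eh /s polyCD !(regCD, regCM) -!/(s _) -/u1.
  by move=> /eqP; rewrite -subr_eq0 subr0 => /eqP z; rewrite -[RHS]addr0 -z; ring.
rewrite E -sub0r; apply: MB.
  by rewrite -(mul0r u1); apply: (MM (n:=1) (m:=1)) => //; exists 0, 0; split=> //; rewrite !mulr0 addr0.
apply: MD; first apply: MD; apply: (MM (n:=1) (m:=1)) => //.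
  by rewrite mulrC; apply: MMl.
by rewrite mulrC; apply: MMl.
Qed.

Let sM c d : s (c * d) = s c * s d.
Proof. by rewrite /s polyCM regCM. Qed.

Let s1 : s 1 = 1.
Proof. by rewrite /s polyC1 regC1. Qed.

Let unif : exists u, [/\ u != 0, M 1 u & forall f, M 1 f -> exists c, M 2 (f - s c * u)].
Proof.
have lin f : M 1 f -> exists c d, M 2 (f - (s c * u1 + s d * u2)).
  move=> [f1 [f2 [_ _ ->]]]; have [c mc] := M_eval f1; have [d md] := M_eval f2.
  exists c, d; exists (f1 - s c), (f2 - s d); split=> //; rewrite -/u1 -/u2; ring.
have u1_neq0 : u1 != 0.
  apply/eqP => /(congr1 coefY0); rewrite /u1 -/(regC _) coefY_regC /coefY0 /= coef0.
  by apply/eqP; rewrite polyXsubC_eq0.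
have u2_neq0 : u2 != 0.
  apply/eqP => /(congr1 coefY1); rewrite u2E.
  have -> : regY - s b = regC (- b%:P) + regC 1 * regY by rewrite regCN regC1; ring.
  by rewrite coefYK /coefY1 /= coef0; apply/eqP; rewrite oner_eq0.
have := rel; set A := _ - P^`().[a]; set B := 2 * b + _ => rAB.
have [nA|nB] := hyp_smooth on_xi.
  exists u2; split=> // f /lin[c [d m]]; exists (d - c * (A^-1 * B)).
  have := MD m (MMl (s (c * A^-1)) rAB).
  congr (M 2 _).
  have sA : s A^-1 * s A = 1 by rewrite -sM mulVf // s1.
  have -> : s (d - c * (A^-1 * B)) = s d - s c * (s A^-1 * s B).
    by rewrite -!sM {1}/s polyCB regCD regCN.
  rewrite !sM -[in RHS](addr0 f).
  transitivity (f - s c * u1 * (1 - s A^-1 * s A) - (s d - s c * (s A^-1 * s B)) * u2).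
    ring.
  by rewrite sA subrr mulr0 subr0 addr0.
exists u1; split=> // f /lin[c [d m]]; exists (c - d * (B^-1 * A)).
have := MD m (MMl (s (d * B^-1)) rAB).
congr (M 2 _).
have sB : s B^-1 * s B = 1 by rewrite -sM mulVf // s1.
have -> : s (c - d * (B^-1 * A)) = s c - s d * (s B^-1 * s A).
  by rewrite -!sM {1}/s polyCB regCD regCN.
rewrite !sM -[in RHS](addr0 f).
transitivity (f - s d * u2 * (1 - s B^-1 * s B) - (s c - s d * (s B^-1 * s A)) * u1).
  ring.
by rewrite sB subrr mulr0 subr0 addr0.
Qed.

Let M_conj n f h : M n f -> M n h -> exists r, f * reg_conj h = u1 ^+ n * r.
Proof.
elim: n f h => [|n IH] f h; first by exists (f * reg_conj h); rewrite expr0 mul1r.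
move=> [f1 [f2 [m1 m2 ->]]] [h1 [h2 [n1 n2 ->]]].
rewrite -/u1 -/u2 reg_conjD !reg_conjM.
have [r11 e11] := IH _ _ m1 n1; have [r12 e12] := IH _ _ m1 n2.
have [r21 e21] := IH _ _ m2 n1; have [r22 e22] := IH _ _ m2 n2.
have cu1 : reg_conj u1 = u1.
  by rewrite /reg_conj /u1 -/(regC _) !coefY_regC regC0 !mul0r !subr0.
have [t [eG _]] := GE.
have cu2 : u2 * reg_conj u2 = u1 * regC t.
  rewrite -reg_normE /u1 -/(regC _) -regCM -eG /reg_norm u2E.
  have -> : regY - s b = regC (- b%:P) + regC 1 * regY by rewrite regCN regC1; ring.
  by rewrite !coefYK /G polyC_exp; congr regC; ring.
exists (u1 * r11 + reg_conj u2 * r12 + u2 * r21 + regC t * r22).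
transitivity (u1 * reg_conj u1 * (f1 * reg_conj h1) + u1 * reg_conj u2 * (f1 * reg_conj h2)
  + u2 * reg_conj u1 * (f2 * reg_conj h1) + (u2 * reg_conj u2) * (f2 * reg_conj h2)); first by ring.
by rewrite e11 e12 e21 e22 cu1 cu2 exprS; ring.
Qed.

Let M_bound n f : f != 0 -> M n f -> (n < size (reg_norm f))%N.
Proof.
move=> f0 m; have [r] := M_conj m m; rewrite -reg_normE.
rewrite (regularE r) mulrDr mulrA /u1 -/(regC _) -regCX -!regCM.
rewrite -[LHS]addr0 -(mul0r regY) -regC0 => /regular_inj[e _].
have N0 := reg_norm_neq0 f0; have := N0; rewrite e mulf_eq0 negb_or => /andP[_ r0].
rewrite size_mul // ?size_exp_XsubC ?expf_neq0 ?polyXsubC_eq0 //.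
by move: r0; rewrite -size_poly_gt0; lia.
Qed.

Let uX_notin u : u != 0 -> M 1 u ->
  (forall f, M 1 f -> exists c, M 2 (f - s c * u)) ->
  (forall n f, M n f -> exists c, M n.+1 (f - s c * u ^+ n)) /\
  (forall n, ~ M n.+1 (u ^+ n)).
Proof.
move=> u0 mu mf.
have uX n : M n (u ^+ n).
  by elim: n => // n IH; rewrite exprS; apply: (MM (n := 1)).
have exp n f : M n f -> exists c, M n.+1 (f - s c * u ^+ n).
  elim: n f => [|n IH] f.
    by move=> _; have [c mc] := M_eval f; exists c; rewrite expr0 mulr1.
  move=> [f1 [f2 [/IH[c mc] /IH[d md] ->]]]; rewrite -/u1 -/u2.
  have : M 1 (s c * u1 + s d * u2) by apply: MD; apply: MMl.
  move=> /mf[e me]; exists e.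
  have -> : u1 * f1 + u2 * f2 - s e * u ^+ n.+1 =
     (u1 * (f1 - s c * u ^+ n) + u2 * (f2 - s d * u ^+ n)) +
     (s c * u1 + s d * u2 - s e * u) * u ^+ n.
    by rewrite exprS; ring.
  by apply: MD; [exists (f1 - s c * u ^+ n), (f2 - s d * u ^+ n)
                |apply: (MM (n := 2))].
split=> // n mn.
have stab m f : M n f -> M (n + m) f.
  elim: m f => [|m IH] f; first by rewrite addn0.
  move=> nf; have step h : M n h -> M n.+1 h.
    move=> /exp[c mc]; rewrite -(subrK (s c * u ^+ n) h).
    by apply: MD => //; apply: MMl.
  rewrite addnS; have [f1 [f2 [m1 m2 ->]]] := step _ nf.
  by exists f1, f2; split=> //; apply: IH.
have un0 : u ^+ n != 0.
  elim: (n) => [|m IH]; first by rewrite expr0 oner_eq0.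
  by rewrite exprS coord_ring_mulf_neq0.
have := M_bound un0 (stab (size (reg_norm (u ^+ n))) _ (uX n)).
by rewrite ltnNge leq_addl.
Qed.

Lemma affine_ordP (f : coord_ring) : f != 0 ->
  max_ideal_exp xi (affine_ord xi f) f /\
  ~ max_ideal_exp xi (affine_ord xi f).+1 f.
Proof.
move=> f0; rewrite /affine_ord; set S := (X in xget _ X).
suff [n Sn] : exists n, S n by exact: (xgetI 0%N Sn).
have ex : exists n, `[< M n f >] by exists 0%N; apply/asboolP.
have ub n : `[< M n f >] -> (n <= size (reg_norm f))%N.
  by move/asboolP/(M_bound f0)/ltnW.
case: (ex_maxnP ex ub) => n /asboolP mn max; exists n; split=> //.
by move=> /asboolP/max; rewrite ltnn.
Qed.

Lemma affine_ord_unique (f : coord_ring) n : f != 0 ->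
  max_ideal_exp xi n f -> ~ max_ideal_exp xi n.+1 f -> affine_ord xi f = n.
Proof.
move=> f0 m1 m2; have [o1 o2] := affine_ordP f0.
by case: (ltngtP (affine_ord xi f) n) => // lt;
  [case: o2; apply: Mle lt m1|case: m2; apply: Mle lt o1].
Qed.

Lemma affine_ordM (f h : coord_ring) : f != 0 -> h != 0 ->
  affine_ord xi (f * h) = (affine_ord xi f + affine_ord xi h)%N.
Proof.
move=> f0 h0; have [f1 f2] := affine_ordP f0; have [h1 h2] := affine_ordP h0.
set n := affine_ord xi f in f1 f2 *; set m := affine_ord xi h in h1 h2 *.
apply: affine_ord_unique; [exact: coord_ring_mulf_neq0|exact: MM|].
have [u [u0 mu /(uX_notin u0 mu)[exp notin]]] := unif.
have [c mc] := exp _ _ f1; have [d md] := exp _ _ h1 => mfh.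
have c_neq0 : c != 0.
  apply: contra_notN f2 => /eqP cz; move: mc.
  by rewrite cz /s polyC0 regC0 mul0r subr0.
have d_neq0 : d != 0.
  apply: contra_notN h2 => /eqP d0; move: md.
  by rewrite d0 /s polyC0 regC0 mul0r subr0.
apply: (notin (n + m)%N).
have -> : u ^+ (n + m) = s (c * d)^-1 * (f * h -
   ((f - s c * u ^+ n) * h + (s c * u ^+ n) * (h - s d * u ^+ m))).
  have scd : s (c * d)^-1 * (s c * s d) = 1.
    by rewrite -!sM mulVf ?s1 // mulf_neq0.
  transitivity (s (c * d)^-1 * (s c * s d) * (u ^+ n * u ^+ m)).
    by rewrite scd mul1r exprD.
  move: (s (c * d)^-1) (s c) (s d) (u ^+ n) (u ^+ m) => v v1 v2 v3 v4; ring.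
apply: MMl; apply: MB => //; apply: MD; first exact: (MM mc h1).
rewrite -addnS; apply: MM md; apply: MMl.
by elim: (n) => // i IH; rewrite exprS; apply: (MM (n := 1)).
Qed.

End Local.

Lemma ordM (xi : point) (f h : coord_ring) : f != 0 -> h != 0 ->
  ord xi (f * h) = ord xi f + ord xi h.
Proof.
case: xi => [p|] f0 h0 /=; first by rewrite affine_ordM.
by rewrite pole_ordM // PoszD opprD.
Qed.

Definition divisor := {freeg point}.

HB.instance Definition _ := GRing.Zmodule.on divisor.

Definition deg0 : {pred divisor} := fun D => deg D == 0.

Lemma deg0_closed : zmod_closed deg0.
Proof.
split=> [|D E]; rewrite !unfold_in ?deg0 //; last first.
  by move=> /eqP D0 /eqP E0; rewrite degB D0 E0 subrr.
by rewrite raddf0.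
Qed.

HB.instance Definition _ := GRing.isZmodClosed.Build divisor deg0 deg0_closed.

Record divisor0 := Divisor0 { divisor0_val :> divisor; _ : divisor0_val \in deg0 }.

HB.instance Definition _ := [isSub for divisor0_val].
HB.instance Definition _ := [Choice of divisor0 by <:].
HB.instance Definition _ := [SubChoice_isSubZmodule of divisor0 by <:].

(* D is the divisor of the rational function f / h. *)
Definition principal : {pred divisor0} := fun D =>
  `[< exists f h : coord_ring, [/\ f != 0, h != 0 &
        forall xi : point, coeff xi (D : divisor) = ord xi f - ord xi h] >].

Lemma principal_closed : zmod_closed principal.
Proof.
split=> [|D E]; rewrite !unfold_in.
  apply/asboolP; exists 1, 1; split; rewrite ?oner_eq0 // => xi.
  by rewrite subrr; exact: coeff0.
move=> /asboolP[f [h [f0 h0 fh]]] /asboolP[f' [h' [f0' h0' fh']]].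
apply/asboolP; exists (f * h'), (h * f').
split; rewrite ?coord_ring_mulf_neq0 // => xi.
rewrite !ordM // coeffB fh fh'; ring.
Qed.

HB.instance Definition _ :=
  GRing.isZmodClosed.Build divisor0 principal principal_closed.

(* The group J(k), as the group of degree 0 divisor classes of the curve. *)
Definition jacobian := {ideal_quot principal}.

HB.instance Definition _ := GRing.Zmodule.on jacobian.

Lemma deg0_point (xi : point) : (<< xi >> - << infty >> : divisor) \in deg0.
Proof. by rewrite unfold_in degB !degU subrr. Qed.

Definition embed (xi : point) : jacobian :=
  \pi_{ideal_quot principal} (Divisor0 (deg0_point xi)).

Lemma embed_mulrn_eq0 (xi : point) (n : nat) :
  embed xi *+ n = 0 <->
  exists f h : coord_ring, [/\ f != 0, h != 0 & forall zeta : point,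
    ((zeta == xi)%:R - (zeta == infty)%:R) *+ n = ord zeta f - ord zeta h].
Proof.
have coefE zeta : coeff zeta (Divisor0 (deg0_point xi) *+ n : divisor) =
    ((zeta == xi)%:R - (zeta == infty)%:R) *+ n.
  rewrite (_ : divisor0_val _ = (<< xi >> - << infty >>) *+ n); last exact: (raddfMn val).
  rewrite coeffMn coeffB !coeffU !mul1r.
  by rewrite ![_ == zeta]eq_sym.
have -> : embed xi *+ n =
    \pi_{ideal_quot principal} (Divisor0 (deg0_point xi) *+ n).
  by rewrite /embed; exact/esym/raddfMn.
have -> : (0 : jacobian) = \pi_{ideal_quot principal} 0 by exact/esym/raddf0.
split.
  move/eqP; rewrite -Quotient.idealrBE subr0 unfold_in => /asboolP[f [h [f0 h0 E]]].
  by exists f, h; split=> // zeta; rewrite -E -coefE.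
move=> [f [h [f0 h0 E]]]; apply/eqP.
rewrite -Quotient.idealrBE subr0 unfold_in; apply/asboolP.
by exists f, h; split=> // zeta; rewrite -E -coefE.
Qed.

End Curve.

Arguments embed {k g} X xi.

Local Open Scope classical_set_scope.

Definition torsion (V : zmodType) (n : nat) : set V := [set z | z *+ n = 0].

Arguments torsion : clear implicits.

(* Main.v *)
Require Import Defs.
From HB Require Import structures.
From mathcomp Require Import all_boot all_order all_algebra.
From mathcomp Require Import perm generic_quotient ring zify.
From mathcomp Require Import boolp classical_sets functions cardinality.

(* If N xi - N infty is the divisor of a function, that function is a(x) + b(x) y
   with deg a, deg b bounded in terms of N, and it vanishes to order N at xi.
   Expanding y at a non-Weierstrass point xi in powers of x - x(xi), this says that
   b lies in the kernel of a Hankel matrix whose entries are Taylor coefficients of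
   y, regular functions of xi once multiplied by powers of w = 2 y + Q.  The pole
   order at infinity of a maximal minor, hence its number of zeros, is at most
   g (N^2 - (2g)^2), resp. g (N^2 - (2g-1)^2).

   It remains to see that the maximal minors do not all vanish, i.e. that the generic
   point is not N-torsion (the classical Wronskian may vanish in characteristic p).
   Otherwise there is a family F(xi, eta) = A + B y(eta) over the coordinate ring
   with norm A^2 - A B Q - B^2 P = c (x(eta) - x(xi))^N.  Comparing leading forms of
   both sides for each valuation (P has odd degree, so A^2 and B^2 P cannot cancel)
   bounds the order of phi(xi) = F(xi, conj xi): it is at least ord(c)/2 at every
   affine point and ord(c)/2 + N at the Weierstrass ones, while its pole order at
   infinity is at most deg(c)/2 + N, where deg is the pole order, and strictly less
   in characteristic 2.  This is absurd when there are two affine Weierstrass points,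
   or one in characteristic 2.  The only curves left are y^2 + q y = P with q constant
   in characteristic 2; there J has no 2-torsion, which reduces the problem to odd N,
   where the norm equation would make x + p a square for some constant p. *)

Set Implicit Arguments.
Unset Strict Implicit.
Unset Printing Implicit Defensive.

Import Order.TTheory GRing.Theory Num.Theory.
Local Open Scope ring_scope.

(** * Leading forms of norms *)

(** The norm of a + b y when y^2 + q y = p. The ring is left free because the form is used over [k],
    over the coordinate ring, and on polynomials over either of them and over the fraction field. *)
Definition nform (S : comNzRingType) (q p a b : S) : S :=
  a ^+ 2 - a * b * q - b ^+ 2 * p.

Lemma rmorph_nform (S S' : comNzRingType) (f : {rmorphism S -> S'}) q p a b :
  f (nform q p a b) = nform (f q) (f p) (f a) (f b).
Proof. by rewrite /nform !(rmorphB, rmorphM, rmorphXn). Qed.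

Lemma nformZ (S : comNzRingType) (q p a b c : S) :
  nform q p (c * a) (c * b) = c ^+ 2 * nform q p a b.
Proof. by rewrite /nform; ring. Qed.

(** Translation of the ordinate: y - c satisfies the equation with the new coefficients, and a + b y
    = (a + c b) + b (y - c). *)
Lemma nform_shift (S : comNzRingType) (q p a b c : S) :
  nform (q + 2 * c) (p - q * c - c ^+ 2) (a + c * b) b = nform q p a b.
Proof. by rewrite /nform; ring. Qed.

(** Here [y] is not assumed to be a root. The last term is the error when [y] solves the equation
    only approximately, as a truncated Taylor expansion does. *)
Lemma nform_factor (S : comNzRingType) (q p a b y : S) :
  nform q p a b = (a + b * y) * (a - b * q - b * y) + b ^+ 2 * (y ^+ 2 + q * y - p).
Proof. by rewrite /nform; ring. Qed.

Section SizeNform.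
Variables (D : idomainType) (e : nat) (p q : {poly D}).
Hypotheses (sp : size p = (2 * e + 2)%N) (sq : (size q <= e.+1)%N).

(** The degrees of a^2 and b^2 p have opposite parities, so their leading terms cannot cancel, and a
    b q has degree below the larger of the two. *)
Lemma size_nform (a b : {poly D}) :
  (a != 0 -> ((2 * size a).-1 <= size (nform q p a b))%N) /\
  (b != 0 -> (2 * size b + 2 * e <= size (nform q p a b))%N).
Proof.
have p0 : p != 0 by rewrite -size_poly_gt0 sp addn2.
have sbp : b != 0 -> size (b ^+ 2 * p) = (2 * size b + 2 * e)%N.
  move=> b0; rewrite expr2 !size_mul ?mulf_neq0 // sp.
  by move: b0; rewrite -size_poly_gt0; lia.
have saa : a != 0 -> size (a ^+ 2) = (2 * size a).-1.
  by move=> a0; rewrite expr2 size_mul // mul2n -addnn.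
have sabq : (size (a * b * q)%R <= size a + size b + e - 1)%N.
  have [->|a0] := eqVneq a 0; first by rewrite !mul0r size_poly0.
  have [->|b0] := eqVneq b 0; first by rewrite mulr0 mul0r size_poly0.
  have [->|q0] := eqVneq q 0; first by rewrite mulr0 size_poly0.
  rewrite !size_mul ?mulf_neq0 //.
  by move: a0 b0 q0; rewrite -!size_poly_gt0; lia.
have [a0|a0] := eqVneq a 0.
  split=> // b0; rewrite /nform a0 expr0n /= !mul0r subrr sub0r size_polyN.
  by rewrite sbp.
have [b0|b0] := eqVneq b 0.
  by split=> // _; rewrite /nform b0 expr0n /= !(mulr0, mul0r, subr0) saa.
have a1 := a0; have b1 := b0; rewrite -!size_poly_gt0 in a1 b1.
suff -> : size (nform q p a b) = maxn (2 * size a).-1 (2 * size b + 2 * e).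
  by split=> _; rewrite leq_max leqnn ?orbT.
rewrite /nform; have [lt|le] := ltnP (size b + e) (size a).
  rewrite -addrA size_polyDl saa //; first by apply/esym/maxn_idPl; lia.
  apply: leq_ltn_trans (size_polyD _ _) _; rewrite !size_polyN sbp //.
  by rewrite gtn_max; apply/andP; split; [apply: leq_ltn_trans sabq _|]; lia.
rewrite addrC size_polyDl size_polyN sbp //; first by apply/esym/maxn_idPr; lia.
apply: leq_ltn_trans (size_polyD _ _) _; rewrite !size_polyN saa //.
by rewrite gtn_max; apply/andP; split; [|apply: leq_ltn_trans sabq _]; lia.
Qed.

Lemma nform_eq0 (a b : {poly D}) : nform q p a b = 0 -> a = 0 /\ b = 0.
Proof.
move=> n0; have [sa sb] := size_nform a b; rewrite n0 size_poly0 in sa sb.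
split; apply/eqP; apply: contraT => h.
  by have := sa h; move: h; rewrite -size_poly_gt0; lia.
by have := sb h; move: h; rewrite -size_poly_gt0; lia.
Qed.

End SizeNform.

(* A decreasing filtration of R indexed by int, with a multiplicative
   "leading coefficient" that identifies each nonzero quotient V d / V (d+1)
   with a subspace of k: this is the graded structure of a discrete valuation
   with residue field k. *)
Record filtration (k : fieldType) (R : comNzRingType) (sc : {rmorphism k -> R}) :=
Filtration {
  fil : int -> R -> Prop;
  lc : int -> R -> k;
  fil0 : forall d, fil d 0;
  filD : forall d f h, fil d f -> fil d h -> fil d (f + h);
  filM : forall d e f h, fil d f -> fil e h -> fil (d + e) (f * h);
  filS : forall d f, fil (d + 1) f <-> fil d f /\ lc d f = 0;
  filex : forall f, exists d, fil d f;
  fil_sc : forall c, fil 0 (sc c);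
  lcD : forall d f h, fil d f -> fil d h -> lc d (f + h) = lc d f + lc d h;
  lcM : forall d e f h, fil d f -> fil e h ->
    lc (d + e) (f * h) = lc d f * lc e h;
  lc_sc : forall c, lc 0 (sc c) = c
}.

Section Filtration.
Variables (k : fieldType) (R : comNzRingType) (sc : {rmorphism k -> R}).
Variable v : filtration sc.
Local Notation V := (fil v).
Local Notation L := (lc v).

Lemma fil_le d e f : d <= e -> V e f -> V d f.
Proof.
move=> de; have -> : e = d + `|e - d|%N%:Z by lia.
elim: `|e - d|%N => [|n IH]; first by rewrite addr0.
by rewrite -addn1 PoszD addrA => /filS[/IH].
Qed.

Lemma lc_lt d e f : d < e -> V e f -> L d f = 0.
Proof. by move=> de Vf; have /filS[] : V (d + 1) f by apply: fil_le Vf; lia. Qed.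

Lemma fil1 : V 0 1.
Proof. by rewrite -(rmorph1 sc); apply: fil_sc. Qed.

Lemma lc1 : L 0 1 = 1.
Proof. by rewrite -(rmorph1 sc) lc_sc. Qed.

Lemma lc0 d : L d 0 = 0.
Proof.
have := lcD (fil0 v d) (fil0 v d).
by rewrite addr0 => /eqP; rewrite addrC -subr_eq subrr => /eqP.
Qed.

Lemma filNm d f : V d f -> V d (- f).
Proof.
move=> Vf; rewrite -mulN1r -(rmorph1 sc) -rmorphN -[d]add0r.
exact: filM (fil_sc _ _) Vf.
Qed.

Lemma lcN d f : V d f -> L d (- f) = - L d f.
Proof.
move=> Vf; apply/eqP; rewrite -subr_eq0 opprK -lcD ?addNr ?lc0 //.
exact: filNm.
Qed.

Lemma filB d f h : V d f -> V d h -> V d (f - h).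
Proof. by move=> Vf Vh; apply: filD => //; apply: filNm. Qed.

Lemma lcB d f h : V d f -> V d h -> L d (f - h) = L d f - L d h.
Proof. by move=> Vf Vh; rewrite lcD ?lcN //; apply: filNm. Qed.

Lemma fil_lin d c f : V d f -> V d (sc c * f).
Proof. by move=> Vf; rewrite -[d]add0r; apply: filM (fil_sc _ _) Vf. Qed.

Lemma filX d n f : V d f -> V (d * n%:Z) (f ^+ n).
Proof.
move=> Vf; elim: n => [|n IH]; first by rewrite mulr0 expr0; apply: fil1.
have -> : d * n.+1%:Z = d + d * n%:Z by lia.
by rewrite exprS; apply: filM.
Qed.

Lemma lcX d n f : V d f -> L (d * n%:Z) (f ^+ n) = L d f ^+ n.
Proof.
move=> Vf; elim: n => [|n IH]; first by rewrite mulr0 !expr0 lc1.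
have -> : d * n.+1%:Z = d + d * n%:Z by lia.
by rewrite !exprS lcM ?IH //; apply: filX.
Qed.

Lemma fil_sum d I (r : seq I) (P : pred I) (F : I -> R) :
  (forall i, P i -> V d (F i)) -> V d (\sum_(i <- r | P i) F i).
Proof. by move=> h; apply: big_ind => //; [exact: fil0|exact: filD]. Qed.

Lemma lc_sum d I (r : seq I) (P : pred I) (F : I -> R) :
  (forall i, P i -> V d (F i)) ->
  L d (\sum_(i <- r | P i) F i) = \sum_(i <- r | P i) L d (F i).
Proof.
move=> h; elim: r => [|i r IH]; first by rewrite !big_nil lc0.
rewrite !big_cons; case: ifP => // Pi; rewrite lcD ?IH //; first exact: h.
exact: fil_sum.
Qed.

Section Poly.
(* The variable of the polynomials has weight s. *)
Variable s : int.

Definition pfil d (A : {poly R}) := forall j : nat, V (d - s * j%:Z) A`_j.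
(** The weighted leading form: the j-th coefficient is read in weight d - s j, since the j-th power
    of the variable accounts for s j. *)
Definition gr d (A : {poly R}) : {poly k} :=
  \poly_(j < size A) L (d - s * j%:Z) A`_j.

Lemma coef_gr d A j : (gr d A)`_j = L (d - s * j%:Z) A`_j.
Proof. by rewrite coef_poly; case: ltnP => // h; rewrite nth_default // lc0. Qed.

Lemma pfil0 d : pfil d 0.
Proof. by move=> j; rewrite coef0; apply: fil0. Qed.

Lemma pfilD d A B : pfil d A -> pfil d B -> pfil d (A + B).
Proof. by move=> a b j; rewrite coefD; apply: filD. Qed.

Lemma pfilN d A : pfil d A -> pfil d (- A).
Proof. by move=> a j; rewrite coefN; apply: filNm. Qed.

Lemma pfilB d A B : pfil d A -> pfil d B -> pfil d (A - B).
Proof. by move=> a b; apply: pfilD => //; apply: pfilN. Qed.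

Lemma grB d A B : pfil d A -> pfil d B -> gr d (A - B) = gr d A - gr d B.
Proof. by move=> a b; apply/polyP => j; rewrite coefB !coef_gr coefB lcB. Qed.

Lemma pfilM d e A B : pfil d A -> pfil e B -> pfil (d + e) (A * B).
Proof.
move=> a b j; rewrite coefM; apply: fil_sum => i _.
have -> : d + e - s * j%:Z = (d - s * i%:Z) + (e - s * (j - i)%N%:Z).
  by have := ltn_ord i; rewrite ltnS => h; rewrite -subzn //; ring.
exact: filM.
Qed.

Lemma grM d e A B : pfil d A -> pfil e B -> gr (d + e) (A * B) = gr d A * gr e B.
Proof.
move=> a b; apply/polyP => j; rewrite coefM coef_gr coefM.
have E (i : 'I_j.+1) : d + e - s * j%:Z = (d - s * i%:Z) + (e - s * (j - i)%N%:Z).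
  by have := ltn_ord i; rewrite ltnS => h; rewrite -subzn //; ring.
rewrite lc_sum => [|i _]; last by rewrite (E i); apply: filM.
by apply: eq_bigr => i _; rewrite !coef_gr (E i) lcM.
Qed.

Lemma pfilX d n A : pfil d A -> pfil (d * n%:Z) (A ^+ n).
Proof.
move=> a; elim: n => [|n IH].
  move=> j; rewrite mulr0 expr0 coef1; case: j => [|j] /=; last exact: fil0.
  by rewrite mulr0 subr0; apply: fil1.
have -> : d * n.+1%:Z = d + d * n%:Z by lia.
by rewrite exprS; apply: pfilM.
Qed.

Lemma pfilC d f : V d f -> pfil d f%:P.
Proof.
move=> Vf j; rewrite coefC; case: j => [|j] /=; last exact: fil0.
by rewrite mulr0 subr0.
Qed.

Lemma grC d f : gr d f%:P = (L d f)%:P.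
Proof.
apply/polyP => j; rewrite coef_gr !coefC; case: j => [|j] /=; last by rewrite lc0.
by rewrite mulr0 subr0.
Qed.

Lemma pfil_polyX : pfil s 'X.
Proof.
move=> j; rewrite coefX; case: eqP => [->|_]; last exact: fil0.
by rewrite mulr1 subrr; apply: fil1.
Qed.

Lemma gr_polyX : gr s 'X = 'X.
Proof.
apply/polyP => j; rewrite coef_gr !coefX; case: eqP => [->|_]; last by rewrite lc0.
by rewrite mulr1 subrr lc1.
Qed.

Lemma pfil_le d e A : d <= e -> pfil e A -> pfil d A.
Proof. by move=> de a j; apply: fil_le (a j); rewrite lerD2r. Qed.

Lemma pfilS d A : pfil d A -> gr d A = 0 -> pfil (d + 1) A.
Proof.
move=> a g0 j; rewrite addrAC; apply/filS; split=> //.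
by have := coef_gr d A j; rewrite g0 coef0 => <-.
Qed.

Lemma gr_lt d e A : d < e -> pfil e A -> gr d A = 0.
Proof.
move=> de a; apply/polyP => j; rewrite coef_gr coef0.
by apply: lc_lt (a j); rewrite ltrD2r.
Qed.

Lemma pfilex A : exists d, pfil d A.
Proof.
elim/poly_ind: A => [|A c [d a]]; first by exists 0; apply: pfil0.
have [e Vc] := filex v c; exists (Order.min (d + s) e).
apply: pfilD; last by apply: pfil_le (pfilC Vc); lia.
by apply: pfil_le (pfilM a pfil_polyX); lia.
Qed.

Lemma fil_horner d A x : pfil d A -> V s x -> V d A.[x].
Proof.
move=> a Vx; rewrite horner_coef; apply: fil_sum => i _.
by rewrite -[d](subrK (s * i%:Z)); apply: filM => //; apply: filX.
Qed.

Lemma lc_horner d A x : pfil d A -> V s x -> L d A.[x] = (gr d A).[L s x].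
Proof.
move=> a Vx.
have E (i : nat) : d = (d - s * i%:Z) + s * i%:Z by rewrite subrK.
rewrite horner_coef lc_sum => [|i _]; last first.
  by rewrite (E i); apply: filM => //; apply: filX.
rewrite horner_poly; apply: eq_bigr => i _.
by rewrite {1}(E i) lcM ?lcX //; apply: filX.
Qed.

Section Nform.
Variables (h : int) (q p : {poly R}).
Hypotheses (fq : pfil h q) (fp : pfil (2 * h) p).

Lemma gr_nform d A B : pfil d A -> pfil (d - h) B ->
  gr (2 * d) (nform q p A B) =
  nform (gr h q) (gr (2 * h) p) (gr d A) (gr (d - h) B).
Proof.
move=> a b.
have E1 : 2 * d = d + (d - h) + h by lia.
have E2 : 2 * d = ((d - h) + (d - h)) + 2 * h by lia.
have f1 : pfil (2 * d) (A ^+ 2) by rewrite mulrC; apply: pfilX.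
have f2 : pfil (2 * d) (A * B * q) by rewrite E1; do ?apply: pfilM.
have f3 : pfil (2 * d) (B ^+ 2 * p) by rewrite E2 expr2; do ?apply: pfilM.
rewrite /nform !grB //; last exact: pfilB.
congr (_ - _ - _).
- by rewrite !expr2 -grM //; congr gr; lia.
- by rewrite E1 !grM //; apply: pfilM.
- by rewrite E2 !expr2 !grM //; apply: pfilM.
Qed.

Hypothesis aniso : forall a b, nform (gr h q) (gr (2 * h) p) a b = 0 -> a = 0 /\ b = 0.

(* The leading forms of A and B cannot cancel in the norm. *)
Lemma pfil_nformP e d A B : 2 * d <= e + 1 -> pfil e (nform q p A B) ->
  pfil d A /\ pfil (d - h) B.
Proof.
move=> de ne; have [d1 a1] := pfilex A; have [d2 b2] := pfilex B.
(* Start from a weight [d0] that certainly holds and raise it by one at a time. Below [d] the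
   doubled weight is less than [e], so the leading form of the norm is zero and anisotropy kills the
   leading forms of [A] and [B]. *)
pose d0 := Order.min (Order.min d1 (d2 + h)) d.
have a0 : pfil d0 A by apply: pfil_le a1; rewrite /d0; lia.
have b0 : pfil (d0 - h) B by apply: pfil_le b2; rewrite /d0; lia.
have -> : d = d0 + `|d - d0|%N%:Z by rewrite /d0; lia.
have : `|d - d0|%N%:Z <= d - d0 by rewrite /d0; lia.
elim: `|d - d0|%N => [|n IH] le; first by rewrite addr0.
have [|a b] := IH; first lia.
have := gr_nform a b; rewrite (gr_lt _ ne); last lia.
move=> /esym/aniso[/(pfilS a) a' /(pfilS b) b'].
by split; [apply: pfil_le a'|apply: pfil_le b']; lia.
Qed.

Variables (N : nat) (g : int) (A B : {poly R}) (c x yb : R).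
Hypotheses (nAB : nform q p A B = c%:P * ('X - x%:P) ^+ N).
Hypotheses (fc : V g c) (fx : V s x) (fy : V h yb).

Let f_norm : pfil (g + s * N%:Z) (nform q p A B).
Proof.
rewrite nAB; apply: pfilM; first exact: pfilC.
by apply: pfilX; apply: pfilB (pfil_polyX) (pfilC fx).
Qed.

(** With e the weight of the norm, both summands have weight at least e/2 rounded up. The square is
    stated so that no halves occur. *)
Lemma fil_conj_diag : V (g + s * N%:Z) ((A.[x] + B.[x] * yb) ^+ 2).
Proof.
set e := g + s * N%:Z; have [d [de ed]] : exists d, 2 * d <= e + 1 /\ e <= 2 * d.
  exists ((e + 1) %/ 2)%Z; split; lia.
have [a b] := pfil_nformP de f_norm.
have : V d (A.[x] + B.[x] * yb).
  apply: filD; first exact: fil_horner.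
  by rewrite -(subrK h d); apply: filM => //; apply: fil_horner.
by move=> /(filX 2); apply: fil_le; lia.
Qed.

(** If e is odd, rounding up already gains one. If e is even, evaluate the leading form of the norm
    equation at the leading coefficient of [x]: the right side vanishes, so the leading coefficients
    of A(x) and B(x) yb have equal squares, and in characteristic 2 the square of their sum is
    zero. *)
Lemma fil_conj_diag_strict : (0 < N)%N -> (2 : k) = 0 -> gr h q = 0 ->
  L h yb ^+ 2 = (gr (2 * h) p).[L s x] ->
  V (g + s * N%:Z + 1) ((A.[x] + B.[x] * yb) ^+ 2).
Proof.
move=> N0 k2 q0 ly; set e := g + s * N%:Z.
pose d := ((e + 1) %/ 2)%Z.
have de : 2 * d <= e + 1 by rewrite /d; lia.
have [a b] := pfil_nformP de f_norm.
have fA : V d A.[x] by apply: fil_horner.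
have fB : V (d - h) B.[x] by apply: fil_horner.
have fBy : V d (B.[x] * yb) by rewrite -(subrK h d); apply: filM.
have fF : V d (A.[x] + B.[x] * yb) by apply: filD.
have [ed|/eqP ed] := eqVneq (2 * d) e; last first.
  by have := filX 2 fF; apply: fil_le; lia.
suff : V (d + 1) (A.[x] + B.[x] * yb).
  by move=> /(filX 2); apply: fil_le; lia.
apply/filS; split=> //; apply/eqP; rewrite -sqrf_eq0 lcD //.
have -> : L d (B.[x] * yb) = L (d - h) B.[x] * L h yb.
  by rewrite -{1}(subrK h d) lcM.
rewrite !lc_horner //; set a' := gr d A; set b' := gr _ B.
have := gr_nform a b; rewrite q0 ed nAB grM; last 2 first.
- exact: pfilC.
- by apply: pfilX; apply: pfilB (pfil_polyX) (pfilC fx).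
have -> : gr (s * N%:Z) (('X - x%:P) ^+ N) = ('X - (L s x)%:P) ^+ N.
  have fX : pfil s ('X - x%:P) by apply: pfilB (pfil_polyX) (pfilC fx).
  elim: (N) => [|n IH].
    by rewrite mulr0 !expr0 -[1]/(1%:P) grC lc1.
  have -> : s * n.+1%:Z = s + s * n%:Z by lia.
  rewrite !exprS grM ?IH //; last exact: pfilX.
  by rewrite grB ?gr_polyX ?grC //; [exact: pfil_polyX|exact: pfilC].
move=> /(congr1 (fun r => r.[L s x])); rewrite /nform !hornerE.
rewrite subrr expr0n eqn0Ngt N0 /= mulr0 subr0 -ly => /eqP.
rewrite eq_sym subr_eq0 => /eqP E; apply/eqP.
have z2 (t : k) : t + t = 0 by rewrite -mulr2n -mulr_natr k2 mulr0.
by rewrite sqrrD exprMn E mulr2n addrAC !z2.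
Qed.

End Nform.
End Poly.
End Filtration.

(** * The coordinate ring at an affine point *)

Section CoordRing.
Variables (k : closedFieldType) (g : nat) (X : hyperelliptic k g).
Local Notation P := (hypP X).
Local Notation Q := (hypQ X).
Local Notation R := (coord_ring X).

Lemma regC_is_zmod : zmod_morphism (regC X).
Proof. by move=> p q; rewrite regCD regCN. Qed.
Lemma regC_is_monoid : monoid_morphism (regC X).
Proof. by split; [exact: regC1|move=> p q; exact: regCM]. Qed.
HB.instance Definition _ := GRing.isZmodMorphism.Build {poly k} R (regC X) regC_is_zmod.
HB.instance Definition _ := GRing.isMonoidMorphism.Build {poly k} R (regC X) regC_is_monoid.

Definition scal (c : k) : R := regC X c%:P.
Lemma scal_is_zmod : zmod_morphism scal.
Proof. by move=> a b; rewrite /scal polyCB rmorphB. Qed.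
Lemma scal_is_monoid : monoid_morphism scal.
Proof. by split=> [|a b]; rewrite /scal ?polyC1 ?rmorph1 // polyCM rmorphM. Qed.
HB.instance Definition _ := GRing.isZmodMorphism.Build k R scal scal_is_zmod.
HB.instance Definition _ := GRing.isMonoidMorphism.Build k R scal scal_is_monoid.

Definition regX : R := regC X 'X.
Local Notation x := regX.
Local Notation y := (regY X).

Definition ev (p : k * k) (f : R) : k := (coefY0 f).[p.1] + (coefY1 f).[p.1] * p.2.

Lemma ev_is_zmod p : zmod_morphism (ev p).
Proof.
move=> f h; rewrite /ev -[f - h]/(f + - h).
have E : - h = regC X (- coefY0 h) + regC X (- coefY1 h) * y.
  by rewrite {1}(regularE h) !rmorphN; ring.
by rewrite !coefYD E !coefYK !hornerE; ring.
Qed.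

Lemma evC p q : ev p (regC X q) = q.[p.1].
Proof. by rewrite /ev !coefY_regC !hornerE. Qed.

Section Local.
Variable xi : affine_point X.
Local Notation a := (val xi).1.
Local Notation b := (val xi).2.
Local Notation M := (max_ideal_exp xi).

Lemma on_curve_val : b ^+ 2 + Q.[a] * b = P.[a].
Proof. by apply/eqP; case: xi. Qed.

Lemma ev_is_monoid : monoid_morphism (ev (val xi)).
Proof.
split=> [|f h]; first by rewrite -(rmorph1 (regC X)) evC hornerE.
rewrite /ev !coefYM !hornerE -on_curve_val; ring.
Qed.
End Local.

Definition evp (xi : affine_point X) (f : R) : k := ev (val xi) f.
HB.instance Definition _ xi := GRing.isZmodMorphism.Build R k (evp xi) (ev_is_zmod (val xi)).
HB.instance Definition _ xi := GRing.isMonoidMorphism.Build R k (evp xi) (ev_is_monoid xi).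

Lemma evpC xi q : evp xi (regC X q) = q.[(val xi).1].
Proof. exact: evC. Qed.

Lemma evp_scal xi c : evp xi (scal c) = c.
Proof. by rewrite /scal evpC hornerC. Qed.

Lemma evpY xi : evp xi y = (val xi).2.
Proof.
have -> : y = regC X 0 + regC X 1 * y by rewrite rmorph0 rmorph1; ring.
by rewrite /evp /ev !coefYK !hornerE.
Qed.

Lemma evpX xi : evp xi x = (val xi).1.
Proof. by rewrite evpC hornerX. Qed.

Lemma regC_inj : injective (regC X).
Proof. by move=> p q e; rewrite -(coefY_regC X p).1 e coefY_regC. Qed.

Lemma coord_eq0 (f : R) : coefY0 f = 0 -> coefY1 f = 0 -> f = 0.
Proof. by move=> f0 f1; rewrite (regularE f) f0 f1 rmorph0 mul0r addr0. Qed.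

Lemma regC_eq0 p : (regC X p == 0) = (p == 0).
Proof. by rewrite -(rmorph0 (regC X)) (inj_eq regC_inj). Qed.

Lemma coord_domain (f h : R) : f * h = 0 -> f = 0 \/ h = 0.
Proof.
move=> fh; have [->|f0] := eqVneq f 0; first by left.
have [->|h0] := eqVneq h 0; first by right.
by have := coord_ring_mulf_neq0 f0 h0; rewrite fh eqxx.
Qed.

(** * Powers of the maximal ideal at an affine point *)

Section AffinePoint.
Variable xi : affine_point X.
Local Notation a := (val xi).1.
Local Notation b := (val xi).2.
Local Notation M := (max_ideal_exp xi).
Local Notation u1 := (x - scal a).
Local Notation u2 := (y - scal b).

Lemma max_ideal_expS n f : M n.+1 f <->
  exists f1 f2, [/\ M n f1, M n f2 & f = u1 * f1 + u2 * f2].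
Proof.
have e1 : regular X ('X - a%:P)%:P = u1 by rewrite polyCB (raddfB (regular X)).
have e2 : regular X ('X - (b%:P)%:P) = u2 by rewrite (raddfB (regular X)).
by split=> -[f1 [f2 [? ? ->]]]; exists f1, f2; split=> //; rewrite ?e1 ?e2.
Qed.

Lemma max_ideal_expD n f h : M n f -> M n h -> M n (f + h).
Proof.
elim: n f h => // n IH f h /max_ideal_expS[f1 [f2 [m1 m2 ->]]].
move=> /max_ideal_expS[h1 [h2 [n1 n2 ->]]]; apply/max_ideal_expS.
by exists (f1 + h1), (f2 + h2); split; [exact: IH..|ring].
Qed.

Lemma max_ideal_expMl n f h : M n h -> M n (f * h).
Proof.
elim: n h => // n IH h /max_ideal_expS[h1 [h2 [n1 n2 ->]]].
apply/max_ideal_expS.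
by exists (f * h1), (f * h2); split; [exact: IH..|ring].
Qed.

Lemma max_ideal_expB n f h : M n f -> M n h -> M n (f - h).
Proof.
by move=> mf mh; apply: max_ideal_expD => //; rewrite -mulN1r; apply: max_ideal_expMl.
Qed.

Lemma max_ideal_exp0 n : M n 0.
Proof.
elim: n => // n IH; apply/max_ideal_expS.
by exists 0, 0; split=> //; rewrite !mulr0 addr0.
Qed.

Lemma max_ideal_expSW n f : M n.+1 f -> M n f.
Proof.
elim: n f => // n IH f /max_ideal_expS[f1 [f2 [m1 m2 ->]]].
by apply/max_ideal_expS; exists f1, f2; split=> //; apply: IH.
Qed.

Lemma max_ideal_exp_le m n f : (m <= n)%N -> M n f -> M m f.
Proof.
elim: n => [|n IH]; first by rewrite leqn0 => /eqP ->.
by rewrite leq_eqVlt => /orP[/eqP->//|le] /max_ideal_expSW; apply: IH.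
Qed.

Lemma max_ideal_expM n m f h : M n f -> M m h -> M (n + m) (f * h).
Proof.
elim: n f => [|n IH] f; first by move=> _; apply: max_ideal_expMl.
move=> /max_ideal_expS[f1 [f2 [m1 m2 ->]]] mh; apply/max_ideal_expS.
by exists (f1 * h), (f2 * h); split; [exact: IH..|ring].
Qed.

Lemma max_ideal_u1 : M 1 u1.
Proof. by apply/max_ideal_expS; exists 1, 0; split=> //; ring. Qed.
Lemma max_ideal_u2 : M 1 u2.
Proof. by apply/max_ideal_expS; exists 0, 1; split=> //; ring. Qed.

Lemma taylor1 (p : {poly k}) : exists q, regC X p = scal p.[a] + u1 * regC X q.
Proof.
have : root (p - p.[a]%:P) a by rewrite /root !hornerE subrr.
move=> /factor_theorem[q e]; exists q; rewrite -[p in LHS](subrK p.[a]%:P) e.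
by rewrite rmorphD rmorphM rmorphB -/(scal _) -/(scal _) -/x; ring.
Qed.

Lemma max_ideal1 f : M 1 f <-> evp xi f = 0.
Proof.
split.
  move=> /max_ideal_expS[f1 [f2 [_ _ ->]]].
  by rewrite rmorphD !rmorphM !rmorphB /= evpX evpY !evp_scal !subrr !mul0r addr0.
move=> f0; apply/max_ideal_expS.
have [q0 e0] := taylor1 (coefY0 f); have [q1 e1] := taylor1 (coefY1 f).
exists (regC X q0 + regC X q1 * y), (scal (coefY1 f).[a]); split=> //.
rewrite {1}(regularE f) e0 e1.
have : scal (coefY0 f).[a] + scal (coefY1 f).[a] * scal b = 0.
  transitivity (scal (evp xi f)); last by rewrite f0 rmorph0.
  by rewrite /evp /ev rmorphD rmorphM.
move=> /eqP; rewrite addr_eq0 => /eqP ->; ring.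
Qed.

Lemma affine_ord_ge n f : f != 0 -> M n f <-> (n <= affine_ord xi f)%N.
Proof.
move=> f0; have [m1 m2] := affine_ordP xi f0; split.
  by move=> mn; rewrite leqNgt; apply: contra_notN m2 => /max_ideal_exp_le; apply.
by move=> le; apply: max_ideal_exp_le m1.
Qed.

Lemma affine_ord_eq0 f : f != 0 -> affine_ord xi f = 0%N <-> evp xi f <> 0.
Proof.
move=> f0; split=> [o /max_ideal1/(affine_ord_ge 1 f0)|h]; first by rewrite o.
by apply/eqP; rewrite -leqn0 leqNgt; apply/negP => /(affine_ord_ge 1 f0)/max_ideal1.
Qed.

Local Notation al := (Q^`().[a] * b - P^`().[a]).
Local Notation be := (2 * b + Q.[a]).

(** The linear part of the equation of the curve at the point: expand [P] and [Q] to second order at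
    the abscissa and collect the quadratic terms. *)
Lemma max_ideal_tangent : M 2 (scal al * u1 + scal be * u2).
Proof.
have taylor2 (p : {poly k}) :
    exists q, regC X p = scal p.[a] + u1 * (scal p^`().[a] + u1 * regC X q).
  have [q e] := taylor1 p; have [q' e'] := taylor1 q; exists q'.
  have -> : p^`().[a] = q.[a].
    have -> : p = p.[a]%:P + ('X - a%:P) * q.
      by apply: regC_inj; rewrite rmorphD rmorphM rmorphB.
    by rewrite !derivE !hornerE; ring.
  by rewrite e e'.
have [p eP] := taylor2 P; have [q eQ] := taylor2 Q.
have := regY2 X; rewrite eP eQ -on_curve_val => E.
set s := scal; have m1 := max_ideal_u1; have m2 := max_ideal_u2.
have -> : s al * u1 + s be * u2 =
   u1 * (u1 * regC X p - u1 * regC X q * y - s Q^`().[a] * u2) - u2 * u2.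
  move: E; rewrite !(rmorphD, rmorphB, rmorphM, rmorph_nat) /= expr2 -/s => E.
  apply/eqP; rewrite -subr_eq0; apply/eqP.
  transitivity (y * y - (s b * s b + s Q.[a] * s b + u1 * (s P^`().[a] + u1 * regC X p)
     - (s Q.[a] + u1 * (s Q^`().[a] + u1 * regC X q)) * y)); first by ring.
  by rewrite -E subrr.
apply: max_ideal_expB; last exact: (max_ideal_expM (n := 1) (m := 1)).
apply: (max_ideal_expM (n := 1) (m := 1)) => //.
apply: max_ideal_expB; last exact: max_ideal_expMl.
by apply: max_ideal_expB; rewrite -?mulrA mulrC; apply: max_ideal_expMl.
Qed.

Lemma max_ideal_lin f : M 1 f -> exists c d, M 2 (f - (scal c * u1 + scal d * u2)).
Proof.
move=> /max_ideal_expS[f1 [f2 [_ _ ->]]].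
exists (evp xi f1), (evp xi f2); apply/max_ideal_expS.
exists (f1 - scal (evp xi f1)), (f2 - scal (evp xi f2)); split; last by ring.
  by apply/max_ideal1; rewrite rmorphB /= evp_scal subrr.
by apply/max_ideal1; rewrite rmorphB /= evp_scal subrr.
Qed.

(** By smoothness one coefficient of the tangent relation is invertible, which eliminates [u1] or
    [u2] modulo the square of the maximal ideal. *)
Lemma cotangent_dim1 : exists u, M 1 u /\ forall f, M 1 f -> exists c, M 2 (f - scal c * u).
Proof.
have T := max_ideal_tangent.
have sm := hyp_smooth (on_curve_val xi).
move: T sm; move: al be => A B T [nA|nB].
  exists u2; split=> [|f /max_ideal_lin[c [d m]]]; first exact: max_ideal_u2.
  exists (d - c / A * B).
  have := max_ideal_expD m (max_ideal_expMl (scal (c / A)) T); congr (M 2 _).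
  rewrite rmorphB /= !rmorphM /=.
  have sA : scal A^-1 * scal A = 1 by rewrite -rmorphM mulVf // rmorph1.
  transitivity (f - scal c * u1 * (1 - scal A^-1 * scal A) -
    (scal d - scal c * scal A^-1 * scal B) * u2); first by ring.
  by rewrite sA subrr mulr0 subr0.
exists u1; split=> [|f /max_ideal_lin[c [d m]]]; first exact: max_ideal_u1.
exists (c - d / B * A).
have := max_ideal_expD m (max_ideal_expMl (scal (d / B)) T); congr (M 2 _).
rewrite rmorphB /= !rmorphM /=.
have sB : scal B^-1 * scal B = 1 by rewrite -rmorphM mulVf // rmorph1.
transitivity (f - scal d * u2 * (1 - scal B^-1 * scal B) -
  (scal c - scal d * scal B^-1 * scal A) * u1); first by ring.
by rewrite sB subrr mulr0 subr0.
Qed.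

End AffinePoint.
End CoordRing.

(** * The filtration by order of vanishing at an affine point *)

Section AffineFiltration.
Variables (k : closedFieldType) (g : nat) (X : hyperelliptic k g).
Local Notation P := (hypP X).
Local Notation Q := (hypQ X).
Local Notation R := (coord_ring X).
Variable xi : affine_point X.
Local Notation a := (val xi).1.
Local Notation b := (val xi).2.
Local Notation M := (max_ideal_exp xi).
Local Notation x := (regX X).
Local Notation y := (regY X).
Local Notation u1 := (x - scal X a).
Local Notation u2 := (y - scal X b).

Lemma regC_XsubC c : regC X ('X - c%:P) = x - scal X c.
Proof. by rewrite rmorphB. Qed.

Lemma sub_scal_neq0 c : x - scal X c != 0.
Proof. by rewrite -regC_XsubC regC_eq0 polyXsubC_eq0. Qed.

Lemma exists_uniformizer : exists u, [/\ M 1 u, (forall n, ~ M n.+1 (u ^+ n)) &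
  forall n f, M n f -> exists c, M n.+1 (f - scal X c * u ^+ n)].
Proof.
have [u [mu hu]] := cotangent_dim1 xi.
(* Otherwise the maximal ideal equals its square, hence all its powers, and the nonzero function x -
   a would have infinite order. *)
have n2 : ~ M 2 u.
  move=> m2; have m12 f : M 1 f -> M 2 f.
    move=> /hu[c mc]; rewrite -(subrK (scal X c * u) f).
    by apply: max_ideal_expD => //; apply: max_ideal_expMl.
  have step n f : M n.+1 f -> M n.+2 f.
    elim: n f => [|n IH] f; first exact: m12.
    move=> /max_ideal_expS[f1 [f2 [m1 m2' ->]]]; apply/max_ideal_expS.
    by exists f1, f2; split=> //; apply: IH.
  have all n : M n.+1 u1.
    by elim: n => [|n IH]; [exact: max_ideal_u1|exact: step].
  by have [_] := affine_ordP xi (sub_scal_neq0 a); apply.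
have u0 : u != 0 by apply: contra_notN n2 => /eqP ->; apply: max_ideal_exp0.
have ou : affine_ord xi u = 1%N by apply: affine_ord_unique.
have un0 n : u ^+ n != 0.
  elim: n => [|n IH]; first by rewrite expr0 oner_eq0.
  by rewrite exprS coord_ring_mulf_neq0.
have oun n : affine_ord xi (u ^+ n) = n.
  elim: n => [|n IH]; last by rewrite exprS affine_ordM // ou IH.
  apply/affine_ord_eq0; first exact: un0.
  by rewrite expr0 rmorph1; apply/eqP/oner_neq0.
exists u; split=> // [n /(affine_ord_ge xi n.+1 (un0 n))|]; first by rewrite oun ltnn.
elim=> [|n IH] f.
  move=> _; exists (evp xi f); apply/max_ideal1.
  by rewrite expr0 mulr1 rmorphB /= evp_scal subrr.
move=> /max_ideal_expS[f1 [f2 [/IH[c mc] /IH[d md] ->]]].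
have [|e me] := hu (scal X c * u1 + scal X d * u2).
  apply: max_ideal_expD; apply: max_ideal_expMl.
    exact: max_ideal_u1.
  exact: max_ideal_u2.
exists e.
have -> : u1 * f1 + u2 * f2 - scal X e * u ^+ n.+1 =
     (u1 * (f1 - scal X c * u ^+ n) + u2 * (f2 - scal X d * u ^+ n)) +
     (scal X c * u1 + scal X d * u2 - scal X e * u) * u ^+ n.
  by rewrite exprS; ring.
apply: max_ideal_expD.
  by apply/max_ideal_expS; eexists; eexists; split; last reflexivity.
apply: (max_ideal_expM (n := 2)) => //.
by apply/(affine_ord_ge xi n (un0 n)); rewrite oun.
Qed.

(** No condition is left when d is negative, as befits functions without affine poles. *)
Definition aff_fil (d : int) (f : R) := forall n : nat, n%:Z <= d -> M n f.

Section Uniformizer.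
Variable u : R.
Hypothesis mu : M 1 u.
Hypothesis nu : forall n, ~ M n.+1 (u ^+ n).
Hypothesis hu : forall n f, M n f -> exists c, M n.+1 (f - scal X c * u ^+ n).

(** The coefficient of u^n modulo the next power of the ideal. In negative weights consecutive steps
    of the filtration coincide, so the value there must be 0. *)
Definition aff_lc (d : int) (f : R) : k :=
  if d is Posz n then xget 0 [set c | M n.+1 (f - scal X c * u ^+ n)]%classic else 0.

Lemma aff_lcP (n : nat) f : M n f -> M n.+1 (f - scal X (aff_lc n f) * u ^+ n).
Proof.
by move=> /hu[c mc]; rewrite /aff_lc; case: xgetP => [d _ //|/(_ c)].
Qed.

Lemma aff_lc_unique (n : nat) f c :
  M n f -> M n.+1 (f - scal X c * u ^+ n) -> aff_lc n f = c.
Proof.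
move=> /aff_lcP m1 m2; apply/eqP; rewrite -subr_eq0; apply/negP => /negP nz.
apply: (@nu n).
have := max_ideal_expMl (scal X (aff_lc n f - c)^-1) (max_ideal_expB m2 m1).
congr (M n.+1 _).
have -> : f - scal X c * u ^+ n - (f - scal X (aff_lc n f) * u ^+ n) =
   scal X (aff_lc n f - c) * u ^+ n by rewrite rmorphB /=; ring.
by rewrite mulrA -rmorphM mulVf // rmorph1 mul1r.
Qed.

Lemma aff_fil_posz (n : nat) f : aff_fil n f <-> M n f.
Proof.
split=> [|m i le]; first by apply.
by apply: max_ideal_exp_le m; rewrite -lez_nat.
Qed.

Lemma aff_fil0 d : aff_fil d 0.
Proof. by move=> n _; apply: max_ideal_exp0. Qed.

Lemma aff_filD d f h : aff_fil d f -> aff_fil d h -> aff_fil d (f + h).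
Proof. by move=> mf mh n le; apply: max_ideal_expD; [exact: mf|exact: mh]. Qed.

Lemma aff_filM d e f h : aff_fil d f -> aff_fil e h -> aff_fil (d + e) (f * h).
Proof.
move=> mf mh n le; case: d e => d [] e in mf mh le *.
- apply: max_ideal_exp_le (max_ideal_expM (mf d _) (mh e _)) => //.
- by rewrite mulrC; apply: max_ideal_expMl; apply: mf; lia.
- by apply: max_ideal_expMl; apply: mh; lia.
- lia.
Qed.

Lemma aff_filS d f : aff_fil (d + 1) f <-> aff_fil d f /\ aff_lc d f = 0.
Proof.
case: d => n; last by split=> [m|[_ _]] => [|i le]; [split=> // i le; lia|have -> : i = 0%N by lia].
split=> [m|[/aff_fil_posz/aff_lcP m l0]]; last first.
  move: m; rewrite l0 rmorph0 mul0r subr0 => m i le.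
  by apply: max_ideal_exp_le m; lia.
have mn : M n.+1 f by apply: m; lia.
split=> [i le|]; first by apply: m; lia.
apply: aff_lc_unique; first exact: max_ideal_expSW.
by rewrite rmorph0 mul0r subr0.
Qed.

Lemma aff_filex f : exists d, aff_fil d f.
Proof. by exists 0; apply/aff_fil_posz. Qed.

Lemma aff_fil_sc c : aff_fil 0 (scal X c).
Proof. exact/aff_fil_posz. Qed.

Lemma aff_lcD d f h : aff_fil d f -> aff_fil d h ->
  aff_lc d (f + h) = aff_lc d f + aff_lc d h.
Proof.
case: d => n; last by rewrite /= addr0.
move=> /aff_fil_posz mf /aff_fil_posz mh; apply: aff_lc_unique.
  exact: max_ideal_expD.
have := max_ideal_expD (aff_lcP mf) (aff_lcP mh); congr (M _ _).
rewrite rmorphD /=; ring.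
Qed.

Lemma aff_lcM d e f h : aff_fil d f -> aff_fil e h ->
  aff_lc (d + e) (f * h) = aff_lc d f * aff_lc e h.
Proof.
have neg (i : nat) (j : int) p q : j < 0 -> aff_fil i p -> aff_fil j q ->
    aff_lc (i%:Z + j) (p * q) = 0.
  move=> j0 /aff_fil_posz mi _; case E : (i%:Z + j) => [n|//].
  have mpq : M n.+1 (p * q).
    rewrite mulrC; apply: max_ideal_expMl; apply: max_ideal_exp_le mi; lia.
  apply: aff_lc_unique; first exact: max_ideal_expSW.
  by rewrite rmorph0 mul0r subr0.
case: d e => n [] m mf mh.
- move/aff_fil_posz: mf => mf; move/aff_fil_posz: mh => mh.
  rewrite -PoszD; apply: aff_lc_unique; first exact: max_ideal_expM.
  have mun : M n (u ^+ n).
    elim: (n) => // i IH; rewrite exprS; exact: (max_ideal_expM (n := 1)).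
  have m1 : M (n + m).+1 ((f - scal X (aff_lc n f) * u ^+ n) * h).
    exact: max_ideal_expM (aff_lcP mf) mh.
  have m2 : M (n + m).+1
      (scal X (aff_lc n f) * u ^+ n * (h - scal X (aff_lc m h) * u ^+ m)).
    rewrite -addnS; apply: max_ideal_expM (aff_lcP mh).
    exact: max_ideal_expMl.
  have := max_ideal_expD m1 m2; congr (M _ _).
  rewrite rmorphM exprD /=; ring.
- by rewrite neg // mulr0.
- by rewrite addrC mulrC neg // mul0r.
- by rewrite mul0r.
Qed.

Lemma aff_lc_sc c : aff_lc 0 (scal X c) = c.
Proof.
apply: aff_lc_unique => //; rewrite expr0 mulr1 subrr; exact: max_ideal_exp0.
Qed.

Definition affine_filtration_of : filtration (scal X) :=
  Filtration aff_fil0 aff_filD aff_filM aff_filS aff_filex aff_fil_sc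
    aff_lcD aff_lcM aff_lc_sc.
End Uniformizer.

Lemma affine_filtration : exists v : filtration (scal X),
  forall (n : nat) f, fil v n f <-> M n f.
Proof.
have [u [mu nu hu]] := exists_uniformizer.
by exists (affine_filtration_of mu nu hu) => n f; apply: aff_fil_posz.
Qed.

(** The equation of the curve recentred at the point. At a Weierstrass point it makes (y - b)^2 a
    multiple of x - a. *)
Lemma curve_local : exists r,
  u2 ^+ 2 + scal X (2 * b + Q.[a]) * u2 = u1 * r.
Proof.
have [p eP] := taylor1 xi P; have [q eQ] := taylor1 xi Q.
exists (regC X p - regC X q * y).
have := regY2 X; rewrite eP eQ -on_curve_val => E.
move: E; rewrite !(rmorphD, rmorphM, rmorph_nat) /= !expr2.
set s := scal X => E.
apply/eqP; rewrite -subr_eq0; apply/eqP.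
transitivity (y * y - (s b * s b + s Q.[a] * s b + u1 * regC X p
   - (s Q.[a] + u1 * regC X q) * y)); first by ring.
by rewrite -E subrr.
Qed.

Lemma weierstrass_sub_scal : 2 * b + Q.[a] = 0 -> M 2 u1.
Proof.
move=> w0; have := max_ideal_tangent xi; rewrite w0 rmorph0 mul0r addr0.
have [nA|] := hyp_smooth (on_curve_val xi); last by rewrite w0 eqxx.
move: nA; set A := _ - _ => nA /(max_ideal_expMl (scal X A^-1)).
by rewrite mulrA -rmorphM mulVf // rmorph1 mul1r.
Qed.

End AffineFiltration.

(** * The filtration by pole order at infinity *)

Lemma coef_top (S : comNzRingType) (p q : {poly S}) n m :
  (size p <= n.+1)%N -> (size q <= m.+1)%N -> (p * q)`_(n + m) = p`_n * q`_m.
Proof.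
move=> sp sq; have ln : (n < (n + m).+1)%N by rewrite ltnS leq_addr.
rewrite coefM (bigD1 (Ordinal ln)) //= addKn big1 ?addr0 // => i ni.
have [lt|le] := ltnP n i.
  by rewrite nth_default ?mul0r // (leq_trans sp).
rewrite [q`_ _]nth_default ?mulr0 // (leq_trans sq) //.
have : nat_of_ord i != n by apply: contraNneq ni => e; apply/eqP/val_inj.
by lia.
Qed.

Section InfinityFiltration.
Variables (k : closedFieldType) (g : nat) (X : hyperelliptic k g).
Local Notation P := (hypP X).
Local Notation Q := (hypQ X).
Local Notation R := (coord_ring X).
Local Notation x := (regX X).
Local Notation y := (regY X).

(* The substitution x = u^2, y = u^(2g+1): the degree of the result in u is the
   pole order, and it is multiplicative on terms of top degree. *)
Definition wpoly (f : R) : {poly k} :=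
  (coefY0 f \Po 'X^2) + (coefY1 f \Po 'X^2) * 'X^(2 * g + 1).

Lemma wpoly_is_zmod : zmod_morphism wpoly.
Proof.
move=> f h; rewrite /wpoly -[f - h]/(f + - h).
have E : - h = regC X (- coefY0 h) + regC X (- coefY1 h) * y.
  by rewrite {1}(regularE h) !rmorphN; ring.
by rewrite !coefYD E !coefYK !(rmorphD, rmorphN) /=; ring.
Qed.
HB.instance Definition _ := GRing.isZmodMorphism.Build R {poly k} wpoly wpoly_is_zmod.

Lemma coef_wpoly_even f i : (wpoly f)`_(2 * i) = (coefY0 f)`_i.
Proof.
rewrite /wpoly coefD coefMXn !coef_comp_poly_Xn // dvdn_mulr // mulKn //.
case: ltnP => le; first by rewrite addr0.
rewrite ifF ?addr0 //; apply/negbTE; rewrite dvdn2; lia.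
Qed.

Lemma coef_wpoly_odd f i : (wpoly f)`_(2 * i + (2 * g + 1)) = (coefY1 f)`_i.
Proof.
rewrite /wpoly coefD coefMXn !coef_comp_poly_Xn // ltnNge leq_addl /= addnK.
rewrite dvdn_mulr // mulKn // ifF ?add0r //; apply/negbTE; rewrite dvdn2; lia.
Qed.

Lemma size_comp_sqr (p : {poly k}) n : (2 * (size p).-1 < n)%N -> (size (p \Po 'X^2) <= n)%N.
Proof.
have [->|p0] := eqVneq p 0; first by rewrite comp_poly0 size_poly0.
apply: leq_trans.
by have := size_comp_poly_leq p 'X^2; rewrite size_polyXn mulnC.
Qed.

Lemma size_wpoly f : f != 0 -> size (wpoly f) = (pole_ord f).+1.
Proof.
move=> f0; apply/eqP; rewrite eqn_leq; apply/andP; split.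
  apply: leq_trans (size_polyD _ _) _; rewrite geq_max; apply/andP; split.
    by apply: size_comp_sqr; rewrite /pole_ord ltnS leq_maxl.
  have [->|b0] := eqVneq (coefY1 f) 0; first by rewrite comp_poly0 mul0r size_poly0.
  have := size_polyMleq (coefY1 f \Po 'X^2) ('X^(2 * g + 1) : {poly k}).
  rewrite size_polyXn => /leq_trans; apply.
  have : (size (coefY1 f \Po 'X^2) <= (2 * (size (coefY1 f)).-1).+1)%N.
    exact: size_comp_sqr.
  have : (2 * (size (coefY1 f)).-1 + (2 * g + 1) <= pole_ord f)%N.
    by rewrite /pole_ord -/(coefY1 f) (negbTE b0) leq_maxr.
  by lia.
rewrite ltnNge; apply/negP => le.
have [b0|b0] := eqVneq (coefY1 f) 0.
  have a0 : coefY0 f != 0 by have := coefY_neq0 f0; rewrite b0 eqxx orbF.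
  have : lead_coef (coefY0 f) != 0 by rewrite lead_coef_eq0.
  rewrite lead_coefE -coef_wpoly_even nth_default ?eqxx //.
  by apply: leq_trans le _; rewrite /pole_ord -/(coefY1 f) b0 eqxx maxn0.
have nb : (2 * (size (coefY1 f)).-1 + (2 * g + 1) < pole_ord f)%N.
  rewrite ltnNge; apply/negP => h; move: (b0); rewrite -lead_coef_eq0 lead_coefE.
  by rewrite -coef_wpoly_odd nth_default ?eqxx // (leq_trans le).
have pe : pole_ord f = (2 * (size (coefY0 f)).-1)%N.
  by move: nb; rewrite /pole_ord -/(coefY1 f) (negbTE b0) -/(coefY0 f); lia.
have a0 : coefY0 f != 0.
  by apply: contraTneq nb => z; rewrite pe z size_poly0 muln0.
by move: a0; rewrite -lead_coef_eq0 lead_coefE -coef_wpoly_even nth_default ?eqxx // -pe.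
Qed.

Lemma wpoly_eq0 f : wpoly f = 0 -> f = 0.
Proof.
move=> w0; apply/eqP; apply: contraT => /size_wpoly.
by rewrite w0 size_poly0.
Qed.

(* The product of the y-parts contributes only below the top degree. *)
Lemma wpolyM f h n m : (size (wpoly f) <= n.+1)%N -> (size (wpoly h) <= m.+1)%N ->
  (size (wpoly (f * h) - wpoly f * wpoly h)%R <= n + m)%N.
Proof.
move=> sf sh; set E : {poly k} := (P \Po 'X^2) - (Q \Po 'X^2) * 'X^(2 * g + 1)
  - 'X^(2 * g + 1) * 'X^(2 * g + 1).
have -> : wpoly (f * h) - wpoly f * wpoly h =
    (coefY1 f \Po 'X^2) * (coefY1 h \Po 'X^2) * E.
  rewrite /wpoly !coefYM !(comp_polyB, comp_polyD, comp_polyM) /E.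
  move: (_ \Po _) (coefY0 h \Po _) (coefY1 f \Po _) (coefY1 h \Po _) => a b c d.
  move: (P \Po _) (Q \Po _) => p q; ring.
(* P(u^2) and u^(4g+2) are both monic of degree 4g+2 and cancel at the top, while Q(u^2) u^(2g+1)
   has degree at most 4g+1. *)
have sE : (size E <= 4 * g + 2)%N.
  apply/leq_sizeP => j lej; rewrite /E -exprD !coefB coefMXn coefXn.
  rewrite !coef_comp_poly_Xn //.
  have Q0 i : (g < i)%N -> Q`_i = 0.
    by move=> lt; rewrite nth_default // (leq_trans (size_hypQ X)).
  rewrite [(if (j < _)%N then _ else _)](_ : _ = 0) ?subr0; last first.
    by case: ifP => // _; case: ifP => // /dvdnP[i e]; rewrite Q0 // e mulnK //; lia.
  case: ifP => [/dvdnP[i e]|/negP nd]; last first.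
    rewrite sub0r; case: eqP => [e|_]; last by rewrite oppr0.
    by case: nd; rewrite dvdn2 e; lia.
  rewrite e mulnK //.
  have [->|ne] := eqVneq i (2 * g + 1)%N.
    have := monicP (hypP_monic X); rewrite lead_coefE size_hypP addn2 /=.
    rewrite -addn1 => ->; rewrite (_ : (_ == _) = true) ?subrr //; lia.
  rewrite nth_default ?sub0r; last by rewrite size_hypP; lia.
  by rewrite (_ : (_ == _) = false) ?oppr0 //; lia.
have [->|f1] := eqVneq (coefY1 f) 0; first by rewrite comp_poly0 !mul0r size_poly0.
have [->|h1] := eqVneq (coefY1 h) 0; first by rewrite comp_poly0 mulr0 mul0r size_poly0.
have bound (r : R) i : coefY1 r != 0 -> (size (wpoly r) <= i.+1)%N ->
    (0 < size (coefY1 r \Po 'X^2) <= i.+1 - (2 * g + 1))%N.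
  move=> r1 sr; rewrite size_poly_gt0 comp_poly_eq0 ?size_polyXn // r1 /=.
  have r0 : r != 0.
    by apply: contra_neq r1 => ->; rewrite -(rmorph0 (regC X)) coefY_regC.
  move: sr; rewrite size_wpoly // /pole_ord -/(coefY1 r) (negbTE r1) => sr.
  have : (size (coefY1 r \Po 'X^2) <= (2 * (size (coefY1 r)).-1).+1)%N.
    exact: size_comp_sqr.
  by move: sr; rewrite !ltnS geq_max => /andP[_]; move: (size (coefY1 r)).-1 (size (_ \Po _)) => s t; lia.
have := size_polyMleq ((coefY1 f \Po 'X^2) * (coefY1 h \Po 'X^2)) E.
have := size_polyMleq (coefY1 f \Po 'X^2) (coefY1 h \Po 'X^2).
have := bound _ _ h1 sh; have := bound _ _ f1 sf; move: sE.
move: (coefY1 f \Po 'X^2) (coefY1 h \Po 'X^2) => c d.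
move: (size E) (size (c * d * E)) (size (c * d)) (size c) (size d).
by move=> *; lia.
Qed.

(** The weight is minus the pole order: for d <= 0 this bounds the degree of [wpoly f] by -d, and
    the [Num.max] leaves only 0 in positive weights. *)
Definition inf_fil (d : int) (f : R) := (size (wpoly f))%:Z <= Num.max 0 (1 - d).
Definition inf_lc (d : int) (f : R) : k := if d <= 0 then (wpoly f)`_`|d|%N else 0.

Lemma inf_fil_gt d f : 0 < d -> inf_fil d f -> f = 0.
Proof.
rewrite /inf_fil => d0 h; apply: wpoly_eq0; apply/eqP; rewrite -size_poly_eq0; lia.
Qed.

Lemma inf_filP d f : d <= 0 -> inf_fil d f <-> (size (wpoly f) <= `|d|%N.+1)%N.
Proof. by rewrite /inf_fil => d0; split; lia. Qed.

Lemma inf_fil0 d : inf_fil d 0.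
Proof. by rewrite /inf_fil raddf0 size_poly0; lia. Qed.

Lemma inf_filD d f h : inf_fil d f -> inf_fil d h -> inf_fil d (f + h).
Proof.
rewrite /inf_fil raddfD /= => sf sh.
have := size_polyD (wpoly f) (wpoly h); move: sf sh.
move: (size (wpoly f + wpoly h)%R) (size (wpoly f)) (size (wpoly h)) => s t u.
by rewrite leq_max; lia.
Qed.

Lemma inf_lc_top d e f h : d <= 0 -> e <= 0 -> inf_fil d f -> inf_fil e h ->
  inf_fil (d + e) (f * h) /\ inf_lc (d + e) (f * h) = inf_lc d f * inf_lc e h.
Proof.
move=> d0 e0 /(inf_filP _ d0) sf /(inf_filP _ e0) sh.
have de0 : d + e <= 0 by lia.
have sE := wpolyM sf sh.
have Ede : absz (d + e) = (absz d + absz e)%N by lia.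
have : inf_fil (d + e) (f * h).
  apply/inf_filP => //; rewrite Ede.
  have -> : wpoly (f * h) = (wpoly (f * h) - wpoly f * wpoly h) + wpoly f * wpoly h.
    by rewrite subrK.
  apply: leq_trans (size_polyD _ _) _; rewrite geq_max (leq_trans sE) //=.
  apply: leq_trans (size_polyMleq _ _) _; move: sf sh.
  by move: (size (wpoly f)) (size (wpoly h)) => s t; lia.
split=> //; rewrite /inf_lc d0 e0 de0 Ede -(coef_top sf sh).
rewrite -[wpoly (f * h)](subrK (wpoly f * wpoly h)) coefD.
by rewrite [X in X + _]nth_default // add0r.
Qed.

Lemma inf_filM d e f h : inf_fil d f -> inf_fil e h -> inf_fil (d + e) (f * h).
Proof.
have [d0|d0] := lerP d 0; last first.
  by move=> /(inf_fil_gt d0) -> _; rewrite mul0r; apply: inf_fil0.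
have [e0|e0] := lerP e 0; last first.
  by move=> _ /(inf_fil_gt e0) ->; rewrite mulr0; apply: inf_fil0.
by move=> sf sh; have [] := inf_lc_top d0 e0 sf sh.
Qed.

Lemma inf_lc0 d : inf_lc d 0 = 0.
Proof. by rewrite /inf_lc raddf0 coef0 if_same. Qed.

Lemma inf_lcM d e f h : inf_fil d f -> inf_fil e h ->
  inf_lc (d + e) (f * h) = inf_lc d f * inf_lc e h.
Proof.
have [d0|d0] := lerP d 0; last first.
  by move=> /(inf_fil_gt d0) -> _; rewrite mul0r !inf_lc0 mul0r.
have [e0|e0] := lerP e 0; last first.
  by move=> _ /(inf_fil_gt e0) ->; rewrite mulr0 !inf_lc0 mulr0.
by move=> sf sh; have [] := inf_lc_top d0 e0 sf sh.
Qed.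

Lemma inf_filS d f : inf_fil (d + 1) f <-> inf_fil d f /\ inf_lc d f = 0.
Proof.
have [d0|d0] := lerP d 0; last first.
  split=> [|[/(inf_fil_gt d0) -> _]]; last exact: inf_fil0.
  move=> /inf_fil_gt -> //; last by lia.
  by split; [exact: inf_fil0|exact: inf_lc0].
have -> : inf_fil (d + 1) f <-> (size (wpoly f) <= `|d|)%N.
  by rewrite /inf_fil; move: (size (wpoly f)) => s; split; lia.
rewrite (inf_filP _ d0) /inf_lc d0; split=> [h|[h c]].
  by split; [exact: leqW|rewrite nth_default].
apply/leq_sizeP => j; rewrite leq_eqVlt => /orP[/eqP<-//|lt].
by rewrite nth_default // (leq_trans h).
Qed.

Lemma inf_filex f : exists d, inf_fil d f.
Proof. by exists (- (size (wpoly f))%:Z); rewrite /inf_fil; lia. Qed.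

Lemma wpoly_scal c : wpoly (scal X c) = c%:P.
Proof. by rewrite /wpoly /scal !coefY_regC comp_poly0 mul0r addr0 comp_polyC. Qed.

Lemma inf_fil_sc c : inf_fil 0 (scal X c).
Proof. by apply/inf_filP => //; rewrite wpoly_scal size_polyC; case: eqP. Qed.

Lemma inf_lc_sc c : inf_lc 0 (scal X c) = c.
Proof. by rewrite /inf_lc lexx wpoly_scal coefC. Qed.

Lemma inf_lcD d f h : inf_fil d f -> inf_fil d h ->
  inf_lc d (f + h) = inf_lc d f + inf_lc d h.
Proof. by rewrite /inf_lc raddfD coefD; case: ifP => //; rewrite addr0. Qed.

Definition infinity_filtration : filtration (scal X) :=
  Filtration inf_fil0 inf_filD inf_filM inf_filS inf_filex inf_fil_sc
    inf_lcD inf_lcM inf_lc_sc.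

Lemma infinity_filP (n : nat) f : f != 0 ->
  fil infinity_filtration (- n%:Z) f <-> (pole_ord f <= n)%N.
Proof.
move=> f0; rewrite /= inf_filP ?size_wpoly // ?ltnS; last by lia.
by rewrite abszN absz_nat.
Qed.
End InfinityFiltration.

(** * Divisibility and zeros of functions *)

Section Divisibility.
Variables (k : closedFieldType) (g : nat) (X : hyperelliptic k g).
Local Notation P := (hypP X).
Local Notation Q := (hypQ X).
Local Notation R := (coord_ring X).
Local Notation x := (regX X).
Local Notation y := (regY X).

Lemma exists_point (a : k) : exists b, on_curve X (a, b).
Proof.
have [|b] := @closed_rootP k ('X^2 + Q.[a]%:P * 'X - P.[a]%:P) _.
  rewrite -addrA size_polyDl size_polyXn // -polyCN size_MXaddC.
  by case: ifP => // _; rewrite ltnS size_polyC; case: (_ != _).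
rewrite /root !hornerE subr_eq0 => h; exists b.
by rewrite /on_curve /=.
Qed.

Lemma on_curve_conj (xi : affine_point X) :
  on_curve X ((val xi).1, - Q.[(val xi).1] - (val xi).2).
Proof. by apply/eqP; rewrite /= -on_curve_val; ring. Qed.

Definition pconj (xi : affine_point X) : affine_point X := Sub _ (on_curve_conj xi).

Lemma point_over (xi zeta : affine_point X) : (val zeta).1 = (val xi).1 ->
  zeta = xi \/ zeta = pconj xi.
Proof.
move=> e; have := on_curve_val zeta; rewrite e -on_curve_val => E.
have : ((val zeta).2 - (val xi).2) *
    ((val zeta).2 - (- Q.[(val xi).1] - (val xi).2)) = 0.
  transitivity ((val zeta).2 ^+ 2 + Q.[(val xi).1] * (val zeta).2
    - ((val xi).2 ^+ 2 + Q.[(val xi).1] * (val xi).2)); first by ring.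
  by rewrite E subrr.
move/eqP; rewrite mulf_eq0 !subr_eq0 => /orP[] /eqP e2; [left|right];
  by apply: val_inj; rewrite [LHS]surjective_pairing e e2 -?surjective_pairing.
Qed.

(** At a Weierstrass point the square of the ideal is generated by multiples of x - a and by (y -
    b)^2, itself a multiple of x - a by [curve_local]. Otherwise vanishing at two conjugate points
    with distinct ordinates forces both coordinates of [f] to vanish at [a]. *)
Lemma dvd_sub_scal (a : k) (f : R) :
  (forall zeta : affine_point X, (val zeta).1 = a ->
     max_ideal_exp zeta 1 f /\ (2 * (val zeta).2 + Q.[a] = 0 -> max_ideal_exp zeta 2 f)) ->
  exists r, f = (x - scal X a) * r.
Proof.
have [b ab] := exists_point a; pose xi : affine_point X := Sub _ ab.
move=> h; have [m1 m2] := h xi erefl; rewrite /= in m2.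
have [w0|w0] := eqVneq (2 * b + Q.[a]) 0.
  have [f1 [f2 [_ mf2 ->]]] := (max_ideal_expS xi 1 f).1 (m2 w0).
  have [h1 [h2 [_ _ ->]]] := (max_ideal_expS xi 0 f2).1 mf2.
  have [r] := curve_local xi.
  rewrite [Z in scal X Z * (y - _)](_ : _ = 0) // rmorph0 mul0r addr0 => er.
  exists (f1 + (y - scal X b) * h1 + r * h2).
  rewrite -[val xi]/(a, b) /= in er *.
  transitivity ((x - scal X a) * (f1 + (y - scal X b) * h1) + (y - scal X b) ^+ 2 * h2).
    by ring.
  by rewrite er; ring.
have [m1' _] := h (pconj xi) erefl.
move/max_ideal1: m1; move/max_ideal1: m1'; rewrite /evp /ev /=.
move=> e1 e2; have : (coefY1 f).[a] * (2 * b + Q.[a]) = 0.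
  transitivity ((coefY0 f).[a] + (coefY1 f).[a] * b
    - ((coefY0 f).[a] + (coefY1 f).[a] * (- Q.[a] - b))); first by ring.
  by rewrite e1 e2 subrr.
move=> /eqP; rewrite mulf_eq0 (negbTE w0) orbF => q0.
move: e2; rewrite (eqP q0) mul0r addr0 => /eqP p0.
have /factor_theorem[p' ep] := p0; have /factor_theorem[q' eq] := q0.
exists (regC X p' + regC X q' * y).
by rewrite {1}(regularE f) ep eq !rmorphM /= !regC_XsubC; ring.
Qed.

Lemma affine_ord_sub_scal_neq (zeta : affine_point X) a : (val zeta).1 != a ->
  affine_ord zeta (x - scal X a) = 0%N.
Proof.
move=> ne; apply/affine_ord_eq0; first exact: sub_scal_neq0.
by rewrite rmorphB /= evpX evp_scal => /eqP; rewrite subr_eq0; apply/negP.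
Qed.

(** Roots of [p] are divided out one at a time, each by [dvd_sub_scal]. *)
Lemma dvd_regC (p : {poly k}) (f : R) : p != 0 -> f != 0 ->
  (forall zeta, (affine_ord zeta (regC X p) <= affine_ord zeta f)%N) ->
  exists r, f = regC X p * r.
Proof.
move: f; have [n] := ubnP (size p); elim: n p => // n IH p sp f p0 f0 le.
have [s1|/closed_rootP[a /factor_theorem[q e]]] := eqVneq (size p) 1%N.
  have /size_poly1P[c c0 ->] : size p == 1%N by rewrite s1.
  exists (scal X c^-1 * f); rewrite mulrA -[regC X c%:P]/(scal X c).
  by rewrite -rmorphM mulfV // rmorph1 mul1r.
have q0 : q != 0 by apply: contraNneq p0 => q0; rewrite e q0 mul0r.
have R0 : regC X q != 0 by rewrite regC_eq0.
have leu (zeta : affine_point X) : (affine_ord zeta (x - scal X a)%R <= affine_ord zeta f)%N.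
  apply: leq_trans (le zeta); rewrite e rmorphM /= regC_XsubC affine_ordM ?leq_addl //.
  exact: sub_scal_neq0.
have [zeta ea|r er] := @dvd_sub_scal a f.
  split; first by apply/affine_ord_ge=> //; apply: leq_trans (leu zeta);
     apply/affine_ord_ge; [exact: sub_scal_neq0|rewrite -ea; exact: max_ideal_u1].
  rewrite -ea => w0; apply/affine_ord_ge=> //; apply: leq_trans (leu zeta).
  apply/affine_ord_ge; [exact: sub_scal_neq0|].
  by rewrite -ea; exact: weierstrass_sub_scal.
have r0 : r != 0 by apply: contraNneq f0 => r0; rewrite er r0 mulr0.
have [||//|zeta|s es] := IH q _ r.
- by move: sp; rewrite e size_Mmonic ?monicXsubC // size_XsubC addn2.
- by [].
- have := le zeta; rewrite e er rmorphM /= regC_XsubC !affine_ordM ?sub_scal_neq0 //.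
  by rewrite addnC leq_add2l.
by exists s; rewrite er es e rmorphM /= regC_XsubC; ring.
Qed.

Lemma reg_conj_neq0 (f : R) : f != 0 -> reg_conj f != 0.
Proof.
move=> f0; apply: contra_neq (reg_norm_neq0 f0) => c0.
by apply: (@regC_inj _ _ X); rewrite reg_normE c0 mulr0 rmorph0.
Qed.

(** Multiplying both functions by the conjugate of [h] turns the divisor into the norm of [h], a
    polynomial in x. *)
Lemma dvd_affine_ord (f h : R) : f != 0 -> h != 0 ->
  (forall zeta, (affine_ord zeta h <= affine_ord zeta f)%N) ->
  exists r, f = h * r.
Proof.
move=> f0 h0 le; have c0 := reg_conj_neq0 h0.
have [||zeta|r er] := @dvd_regC (reg_norm h) (f * reg_conj h).
- exact: reg_norm_neq0.
- exact: coord_ring_mulf_neq0.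
- by rewrite reg_normE !affine_ordM // leq_add2r.
exists r; apply/eqP; rewrite -subr_eq0; apply/eqP.
have [] // := @coord_domain _ _ X (f - h * r) (reg_conj h).
  by rewrite mulrBl er reg_normE; ring.
by move=> e; move: c0; rewrite e eqxx.
Qed.

(** The order of y - b is at most 1, for otherwise both generators of the maximal ideal would lie in
    its square; then (y - b)^2 = (x - a) r bounds the order of x - a by 2. *)
Lemma weierstrass_ord (xi : affine_point X) :
  2 * (val xi).2 + Q.[(val xi).1] = 0 ->
  affine_ord xi (x - scal X (val xi).1) = 2%N.
Proof.
set a := (val xi).1; set b := (val xi).2 => w0.
have m2 := weierstrass_sub_scal w0.
have u0 := sub_scal_neq0 X a.
apply/eqP; rewrite eqn_leq (affine_ord_ge _ _ u0).1 // andbT.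
have [r] := curve_local xi; rewrite w0 rmorph0 mul0r addr0 -/a -/b => er.
have n2 : ~ max_ideal_exp xi 2 (y - scal X b).
  move=> m2'; have [u [mu nu _]] := exists_uniformizer xi.
  apply: (nu 1%N); rewrite expr1; move: mu => /(max_ideal_expS xi 0 u)[f1 [f2 [_ _ ->]]].
  by apply: max_ideal_expD; rewrite mulrC; apply: max_ideal_expMl.
have v0 : y - scal X b != 0 by apply: contra_notN n2 => /eqP ->; apply: max_ideal_exp0.
have r0 : r != 0.
  apply: contraTneq (coord_ring_mulf_neq0 v0 v0) => r0.
  by rewrite -expr2 er r0 mulr0 eqxx.
have : (affine_ord xi (y - scal X b)%R < 2)%N.
  by rewrite ltnNge; apply/negP => /(affine_ord_ge xi 2 v0).
have := congr1 (affine_ord xi) er; rewrite expr2 !affine_ordM //; lia.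
Qed.

Lemma reg_norm_regC p : reg_norm (regC X p) = p ^+ 2.
Proof. by rewrite /reg_norm !coefY_regC expr0n mulr0 !mul0r !subr0. Qed.

Lemma reg_norm_root (xi : affine_point X) f : evp xi f = 0 ->
  root (reg_norm f) (val xi).1.
Proof. by move=> f0; rewrite /root -(evpC xi) reg_normE rmorphM /= f0 mul0r. Qed.

(** A zero contributes its abscissa as a root of the norm. If two conjugate zeros share the abscissa
    a, then x - a divides [f] and has norm (X - a)^2, which accounts for both. *)
Lemma zeros_dvd_norm (f : R) (s : seq (affine_point X)) : f != 0 -> uniq s ->
  (forall p, p \in s -> evp p f = 0) ->
  \prod_(p <- s) ('X - ((val p).1)%:P) %| reg_norm f.
Proof.
have [n] := ubnP (size s); elim: n f s => // n IH f [|p s] sn f0; first by rewrite big_nil dvd1p.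
rewrite [uniq _]/= => /andP[ps us] hs.
have fp : evp p f = 0 by apply: hs; rewrite mem_head.
set a := (val p).1.
have [/hasP[q qs /eqP qa]|/hasPn nos] := boolP (has (fun q => (val q).1 == a) s); last first.
  have hs' r : r \in s -> evp r f = 0 by move=> rs; apply: hs; rewrite inE rs orbT.
  rewrite big_cons Gauss_dvdp; last first.
    rewrite coprimep_sym coprimep_XsubC -/a /root horner_prod.
    rewrite big_seq; apply: (big_ind (fun c => c != 0)); first exact: oner_neq0.
      by move=> c d; apply: mulf_neq0.
    by move=> r rs; rewrite hornerXsubC subr_eq0 eq_sym; apply: nos.
  rewrite dvdp_XsubCl reg_norm_root //=; apply: IH => //.
have fq : evp q f = 0 by apply: hs; rewrite inE qs orbT.
have qp : q <> p by move=> e; rewrite -e qs in ps.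
have qe : q = pconj p by case: (point_over qa).
have over r : (val r).1 = a -> r = p \/ r = q by rewrite qe; apply: point_over.
have w0 : 2 * (val p).2 + Q.[a] != 0.
  apply/eqP => w0; apply: qp; apply: val_inj; rewrite qe /= -/a.
  rewrite [RHS]surjective_pairing -/a; congr pair.
  by apply/eqP; rewrite -subr_eq0 -oppr_eq0 -w0; apply/eqP; ring.
have [r ra|h eh] := @dvd_sub_scal a f.
  split; first by case: (over r ra) => ->; apply/max_ideal1.
  move=> wr; exfalso; move: w0; case: (over r ra) wr => -> wr; first by rewrite wr eqxx.
  by move: wr; rewrite qe /= -/a => wr; rewrite -oppr_eq0 -wr => /eqP; apply; ring.
have h0 : h != 0 by apply: contraNneq f0 => h0; rewrite eh h0 mulr0.
rewrite eh reg_normM -regC_XsubC reg_norm_regC.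
rewrite (bigID (fun r => (val r).1 == a)) /=; apply: dvdp_mul; last first.
  rewrite -big_filter; apply: IH => //.
  - rewrite /= eqxx /=; apply: leq_ltn_trans (_ : size s < n)%N; last exact: sn.
    by rewrite size_filter count_size.
  - by rewrite filter_uniq //= ps.
  move=> r; rewrite mem_filter => /andP[ra rs]; have := hs _ rs.
  rewrite eh rmorphM rmorphB /= evpX evp_scal => /eqP.
  by rewrite mulf_eq0 subr_eq0 (negbTE ra) => /eqP.
rewrite -big_filter; set t := filter _ _.
have st : (size t <= 2)%N.
  rewrite -[2%N]/(size [:: p; q]); apply: uniq_leq_size; first by rewrite filter_uniq //= ps.
  move=> r; rewrite mem_filter => /andP[/eqP/over[->|->] _]; by rewrite !inE eqxx ?orbT.
rewrite big_seq (eq_bigr (fun=> 'X - a%:P)); last first.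
  by move=> r; rewrite mem_filter => /andP[/eqP-> _].
by rewrite -big_seq big_const_seq count_predT iter_mulr_1 dvdp_exp2l.
Qed.

Lemma uniq_zeros (f : R) (s : seq (affine_point X)) : f != 0 -> uniq s ->
  (forall p, p \in s -> evp p f = 0) -> (size s <= pole_ord f)%N.
Proof.
move=> f0 us hs; have /dvdp_leq := zeros_dvd_norm f0 us hs.
by rewrite size_prod_XsubC size_reg_norm // ltnS; apply; apply: reg_norm_neq0.
Qed.

Local Open Scope classical_set_scope.
Local Open Scope card_scope.

Lemma card_zeros (f : R) : f != 0 -> [set p | evp p f = 0] #<= `I_(pole_ord f).
Proof.
move=> f0; set A := (X in X #<= _).
have fA : finite_set A.
  apply: contrapT => /(infinite_set_fset (pole_ord f).+1)[B BA].
  by rewrite ltnNge uniq_zeros ?finmap.fset_uniq // => p pB; apply: (BA p).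
have := fA; rewrite finite_setP => -[n An].
rewrite (card_le_eql An) card_le_II -(card_fset_set An) uniq_zeros ?finmap.fset_uniq // => p.
by rewrite in_fset_set // inE.
Qed.

End Divisibility.

(** * Families of functions with divisor N xi - N infty *)

Section Domain.
Variables (k : closedFieldType) (g : nat) (X : hyperelliptic k g).
Local Notation R := (coord_ring X).

(** Units and inverses are supplied classically to give the coordinate ring its structure of
    integral domain, on which the fraction field is built. *)
Definition coord_unit : {pred R} := fun f => `[< exists h, h * f = 1 >].
Definition coord_inv (f : R) : R := if pselect (exists h, h * f = 1) is left e
  then projT1 (cid e) else f.

Lemma coord_mulVr : {in coord_unit, left_inverse 1 coord_inv *%R}.
Proof.
move=> f /asboolP uf; rewrite /coord_inv; case: pselect => // e.
by case: cid.
Qed.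

Lemma coord_unitP (f h : R) : h * f = 1 -> coord_unit f.
Proof. by move=> e; apply/asboolP; exists h. Qed.

Lemma coord_inv_out : {in [predC coord_unit], coord_inv =1 id}.
Proof.
by move=> f /asboolP nf; rewrite /coord_inv; case: pselect.
Qed.

HB.instance Definition _ :=
  GRing.ComNzRing_hasMulInverse.Build R coord_mulVr coord_unitP coord_inv_out.

Lemma coord_integral : GRing.integral_domain_axiom R.
Proof.
by move=> f h /coord_domain[]->; rewrite eqxx ?orbT.
Qed.

HB.instance Definition _ := GRing.ComUnitRing_isIntegral.Build R coord_integral.
End Domain.

(** * Orders of a family at the conjugate point *)

Section Nontorsion.
Variables (k : closedFieldType) (g : nat) (X : hyperelliptic k g).
Local Notation P := (hypP X).
Local Notation Q := (hypQ X).
Local Notation R := (coord_ring X).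
Local Notation x := (regX X).
Local Notation y := (regY X).
Local Notation yb := (- regC X Q - y).
Local Notation "p ^s" := (map_poly (scal X) p) (at level 2, format "p ^s").

Lemma scal_inj : injective (scal X).
Proof. by move=> c d /regC_inj/polyC_inj. Qed.

Section Const.
Variables (v : filtration (scal X)) (s d : int) (p : {poly k}).
Hypothesis hp : forall j : nat, p`_j != 0 -> d - s * j%:Z <= 0.

Lemma pfil_const : pfil v s d p^s.
Proof.
move=> j; rewrite coef_map /=; have [->|/hp le] := eqVneq p`_j 0.
  by rewrite rmorph0; apply: fil0.
exact: fil_le le (fil_sc _ _).
Qed.

(** Constants have weight exactly 0, so the leading form keeps only the monomials of exact weight
    [d]. *)
Lemma coef_gr_const (j : nat) : (gr v s d p^s)`_j = if d - s * j%:Z == 0 then p`_j else 0.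
Proof.
rewrite coef_gr coef_map /=; have [->|/hp le] := eqVneq p`_j 0.
  by rewrite rmorph0 lc0 if_same.
case: eqP => [->|ne]; first exact: lc_sc.
by apply: lc_lt (fil_sc _ _); lia.
Qed.
End Const.

Variables (A B : {poly R}) (c : R) (N : nat).
Hypothesis nAB : nform Q^s P^s A B = c%:P * ('X - x%:P) ^+ N.

(** The coefficients of [A] and [B] are functions of xi and their variable is the abscissa of eta;
    here eta is the conjugate of xi. *)
Definition conj_diag : R := A.[x] + B.[x] * yb.
Local Notation phi := conj_diag.

(** All weights are 0, so the leading forms of [P] and [Q] are [P] and [Q] themselves and anisotropy
    is the parity argument of [nform_eq0]. *)
Lemma affine_conj_diag (xi : affine_point X) n :
  max_ideal_exp xi n c -> max_ideal_exp xi n (phi ^+ 2).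
Proof.
have [v vP] := affine_filtration xi => /vP mc; apply/vP.
have cst (d : int) (p : {poly k}) j : p`_j != 0 -> (0 : int) - 0 * j%:Z <= 0 by lia.
have fc r : fil v 0 r by apply/(vP 0%N).
have grE p : gr v 0 0 p^s = p.
  by apply/polyP => j; rewrite coef_gr_const; [rewrite mul0r subr0 eqxx|move=> i _; lia].
have := @fil_conj_diag _ _ _ v 0 0 Q^s P^s _ _ _ N n A B c x yb nAB mc (fc _) (fc _).
rewrite mul0r addr0 mulr0 !grE; apply.
- by apply: pfil_const => j _; lia.
- by apply: pfil_const => j _; lia.
exact: nform_eq0 (size_hypP X) (size_hypQ X).
Qed.

(** After recentring at the point (a, b), x - a gets weight 2 and y - b weight 1. The leading form
    of the equation is y^2 = lambda X, with lambda nonzero by smoothness, hence anisotropic. The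
    factor (X - x)^N now has weight 2 N, which is the gain. *)
Lemma weierstrass_conj_diag (xi : affine_point X) (n : nat) :
  2 * (val xi).2 + Q.[(val xi).1] = 0 -> max_ideal_exp xi n c ->
  max_ideal_exp xi (n + 2 * N) (phi ^+ 2).
Proof.
have [v vP] := affine_filtration xi => w0 /vP mc; apply/vP.
have sm := hyp_smooth (on_curve_val xi); have oc := on_curve_val xi.
have : max_ideal_exp xi 1 (regC X (Q + (2 * (val xi).2)%:P)).
  by apply/max_ideal1; rewrite evpC !hornerE addrC.
have := weierstrass_sub_scal w0; have := max_ideal_u2 xi.
move: (val xi).1 (val xi).2 w0 sm oc => a b w0 sm oc m2 m1 mQ.
pose Q2 := (Q + (2 * b)%:P) \Po ('X + a%:P).
pose P2 := (P - Q * b%:P - (b ^+ 2)%:P) \Po ('X + a%:P).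
pose T : {poly R} := 'X + (scal X a)%:P.
have mapT (p : {poly k}) : (p \Po ('X + a%:P))^s = p^s \Po T.
  by rewrite map_comp_poly rmorphD /= map_polyX map_polyC.
have Q20 : Q2`_0 = 0.
  by rewrite -horner_coef0 /Q2 horner_comp !hornerE addrC.
have P20 : P2`_0 = 0.
  by rewrite -horner_coef0 /P2 horner_comp !hornerE -oc; ring.
have P21 : P2`_1 != 0.
  have -> : P2`_1 = P2^`().[0] by rewrite horner_coef0 coef_deriv.
  rewrite /P2 deriv_comp !derivE !hornerE horner_comp !hornerE.
  case: sm; last by rewrite w0 eqxx.
  by rewrite subr0 -oppr_eq0 opprB mulrC.
have hQ2 (j : nat) : Q2`_j != 0 -> 1 - 2 * j%:Z <= 0.
  by case: j => [|j]; [rewrite Q20 eqxx|lia].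
have hP2 (j : nat) : P2`_j != 0 -> 2 * 1 - 2 * j%:Z <= 0.
  by case: j => [|j]; [rewrite P20 eqxx|lia].
have grQ : gr v 2 1 Q2^s = 0.
  by apply/polyP => j; rewrite coef_gr_const // coef0; case: eqP => //; lia.
have grP : gr v 2 (2 * 1) P2^s = P2`_1 *: 'X.
  apply/polyP => j; rewrite coef_gr_const // coefZ coefX.
  case: j => [|[|j]]; rewrite ?P20 ?mulr1 ?mulr0 //=; last by case: eqP => //; lia.
have n2 : nform Q2^s P2^s ((A + (scal X b)%:P * B) \Po T) (B \Po T) =
    c%:P * ('X - (x - scal X a)%:P) ^+ N.
  have E : 'X - (x - scal X a)%:P = ('X - x%:P) \Po T.
    by rewrite comp_polyB comp_polyX comp_polyC /T polyCB; ring.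
  have -> : c%:P * ('X - (x - scal X a)%:P) ^+ N = (c%:P * ('X - x%:P) ^+ N) \Po T.
    by rewrite E -[RHS]/(comp_poly T _) rmorphM rmorphXn /= comp_polyC.
  rewrite -nAB -[nform Q^s _ _ _](nform_shift _ _ _ _ (scal X b)%:P).
  rewrite -[_ \Po T in RHS]/(comp_poly T _) rmorph_nform /=; congr nform.
  - rewrite /Q2 mapT; congr (_ \Po T).
    by rewrite rmorphD /= map_polyC /= !mulr_natl !rmorphMn.
  - rewrite /P2 mapT; congr (_ \Po T); rewrite !rmorphB !rmorphM /= !map_polyC /=.
    by rewrite expr2.
have ani p q : nform (gr v 2 1 Q2^s) (gr v 2 (2 * 1) P2^s) p q = 0 -> p = 0 /\ q = 0.
  rewrite grQ grP; apply: (@nform_eq0 _ 0); rewrite ?size_poly0 //.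
  by rewrite size_scale // size_polyX.
have fx : fil v 2 (x - scal X a) by apply/(vP 2%N).
have fy : fil v 1 (yb - scal X b).
  apply/(vP 1%N).
  have -> : yb - scal X b = - (y - scal X b) - (regC X (Q + (2 * b)%:P)).
    rewrite rmorphD /= -[regC X (2 * b)%:P]/(scal X (2 * b)) rmorphM rmorph_nat; ring.
  by apply: max_ideal_expB => //; rewrite -mulN1r; apply: max_ideal_expMl.
have := fil_conj_diag (pfil_const v hQ2) (pfil_const v hP2) ani n2 mc fx fy.
rewrite !horner_comp.
have -> : T.[x - scal X a] = x by rewrite /T !hornerE subrK.
have -> : (A + (scal X b)%:P * B).[x] + B.[x] * (yb - scal X b) = phi.
  by rewrite /phi !hornerE; ring.
by apply: fil_le; lia.
Qed.

Lemma wpolyX : wpoly x = 'X^2.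
Proof. by rewrite /wpoly !coefY_regC comp_poly0 mul0r addr0 comp_polyX. Qed.

Lemma wpolyY : wpoly y = 'X^(2 * g + 1).
Proof.
have -> : y = regC X 0 + regC X 1 * y by rewrite rmorph0 rmorph1; ring.
by rewrite /wpoly !coefYK comp_poly0 add0r comp_polyC mul1r.
Qed.

Local Notation vinf := (infinity_filtration X).
Local Notation hinf := (- (2 * g + 1)%:Z).

Lemma fil_infX : fil vinf (-2) x.
Proof. by apply/inf_filP => //; rewrite wpolyX size_polyXn. Qed.

Lemma fil_infY : fil vinf hinf y.
Proof. by apply/inf_filP; [lia|rewrite wpolyY size_polyXn; lia]. Qed.

Lemma fil_inf_regC (p : {poly k}) : (size p <= g.+1)%N -> fil vinf (hinf + 1) (regC X p).
Proof.
move=> sp; apply/inf_filP; first lia.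
rewrite /wpoly !coefY_regC comp_poly0 mul0r addr0; apply: size_comp_sqr.
by move: sp; move: (size p) => s; lia.
Qed.

Lemma fil_infYb : fil vinf hinf yb.
Proof.
apply: filB fil_infY; apply: filNm; have [] := (filS vinf hinf (regC X Q)).1 _ => //.
exact: fil_inf_regC (size_hypQ X).
Qed.

Lemma lc_infYb : lc vinf hinf yb = -1.
Proof.
have fQ : fil vinf (hinf + 1) (regC X Q) by apply: fil_inf_regC (size_hypQ X).
have fQ' := ((filS vinf _ _).1 fQ).1; have lQ := ((filS vinf _ _).1 fQ).2.
rewrite lcB ?lcN ?lQ ?oppr0 ?sub0r //; [|exact: filNm|exact: fil_infY].
rewrite /= /inf_lc wpolyY ifT; last by lia.
by rewrite abszN absz_nat coefXn eqxx.
Qed.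

Lemma lc_infX : lc vinf (-2) x = 1.
Proof. by rewrite /= /inf_lc /= wpolyX coefXn. Qed.

Let hQ (j : nat) : Q`_j != 0 -> hinf - (-2) * j%:Z <= 0.
Proof.
move=> nz; have : (j < size Q)%N by rewrite ltnNge; apply: contra nz => h; rewrite nth_default.
by have := size_hypQ X; move: (size Q) => s; lia.
Qed.

Let hP (j : nat) : P`_j != 0 -> 2 * hinf - (-2) * j%:Z <= 0.
Proof.
move=> nz; have : (j < size P)%N by rewrite ltnNge; apply: contra nz => h; rewrite nth_default.
by rewrite size_hypP; lia.
Qed.

Let grQ : gr vinf (-2) hinf Q^s = 0.
Proof. by apply/polyP => j; rewrite coef_gr_const // coef0; case: eqP => //; lia. Qed.

Let grP : gr vinf (-2) (2 * hinf) P^s = 'X^(2 * g + 1).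
Proof.
apply/polyP => j; rewrite coef_gr_const // coefXn.
case: (eqVneq j (2 * g + 1)%N) => [->|ne]; last by case: eqP => // e; move/eqP: ne; lia.
rewrite ifT; last by apply/eqP; lia.
by have := monicP (hypP_monic X); rewrite lead_coefE size_hypP addn2 addn1.
Qed.

Let anisoinf (p q : {poly k}) : nform (gr vinf (-2) hinf Q^s) (gr vinf (-2) (2 * hinf) P^s) p q = 0 ->
  p = 0 /\ q = 0.
Proof.
rewrite grQ grP; apply: (@nform_eq0 _ g); rewrite ?size_poly0 //.
by rewrite size_polyXn; lia.
Qed.

Hypotheses (c0 : c != 0) (phi0 : phi != 0).

Let fil_c : fil vinf (- (pole_ord c)%:Z) c.
Proof. exact/infinity_filP. Qed.

Lemma pole_ord_sqr (f : R) : f != 0 -> pole_ord (f ^+ 2) = (2 * pole_ord f)%N.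
Proof. by move=> f0; rewrite expr2 pole_ordM // addnn mul2n. Qed.

(** At infinity x has weight -2 and y weight -(2g+1); [Q] is too small to appear and the leading
    form of the equation is y^2 = X^(2g+1). *)
Lemma pole_ord_conj_diag : (2 * pole_ord phi <= pole_ord c + 2 * N)%N.
Proof.
have := fil_conj_diag (pfil_const vinf hQ) (pfil_const vinf hP) anisoinf nAB
  fil_c fil_infX fil_infYb.
have -> : - (pole_ord c)%:Z + -2 * N%:Z = - (pole_ord c + 2 * N)%N%:Z by lia.
by move/infinity_filP; rewrite pole_ord_sqr //; apply; rewrite expf_neq0.
Qed.

Lemma pole_ord_conj_diag_strict : (0 < N)%N -> (2 : k) = 0 ->
  (2 * pole_ord phi < pole_ord c + 2 * N)%N.
Proof.
move=> N0 k2.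
have := fil_conj_diag_strict (pfil_const vinf hQ) (pfil_const vinf hP) anisoinf nAB
  fil_c fil_infX fil_infYb N0 k2 grQ.
rewrite lc_infYb lc_infX grP hornerXn expr1n sqrrN expr1n => /(_ erefl).
have -> : - (pole_ord c)%:Z + -2 * N%:Z + 1 = - (pole_ord c + 2 * N - 1)%N%:Z by lia.
move/infinity_filP => /(_ (expf_neq0 2 phi0)); rewrite pole_ord_sqr //.
by move: (pole_ord c) (pole_ord _) N0 => s t; lia.
Qed.

End Nontorsion.

Section TorsionFamily.
Variables (k : closedFieldType) (g : nat) (X : hyperelliptic k g).
Local Notation P := (hypP X).
Local Notation Q := (hypQ X).
Local Notation R := (coord_ring X).
Local Notation x := (regX X).
Local Notation y := (regY X).
Local Notation yb := (- regC X Q - y).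
Local Notation "p ^s" := (map_poly (scal X) p) (at level 2, format "p ^s").

Lemma pole_ord_regC (p : {poly k}) : pole_ord (regC X p) = (2 * (size p).-1)%N.
Proof.
by rewrite /pole_ord -/(coefY0 _) -/(coefY1 _) !coefY_regC eqxx maxn0.
Qed.

Lemma affine_ordX (xi : affine_point X) (f : R) n : f != 0 ->
  affine_ord xi (f ^+ n) = (n * affine_ord xi f)%N.
Proof.
move=> f0; elim: n => [|n IH].
  apply/affine_ord_eq0; first by rewrite expr0 oner_neq0.
  by rewrite expr0 rmorph1; apply/eqP/oner_neq0.
by rewrite exprS affine_ordM ?expf_neq0 // IH mulSn.
Qed.

Lemma affine_ord_regC_root (xi : affine_point X) (W : {poly k}) :
  W != 0 -> root W (val xi).1 -> W^`().[(val xi).1] != 0 ->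
  2 * (val xi).2 + Q.[(val xi).1] = 0 -> affine_ord xi (regC X W) = 2%N.
Proof.
move=> W0 /factor_theorem[q e] W1 w0.
have q1 : q.[(val xi).1] != 0.
  by move: W1; rewrite e !derivE !hornerE subrr mulr0 add0r.
have q0 : q != 0 by apply: contraNneq q1 => ->; rewrite horner0.
rewrite e rmorphM /= regC_XsubC affine_ordM ?sub_scal_neq0 ?regC_eq0 //.
rewrite weierstrass_ord //.
rewrite [affine_ord xi (regC X q)](_ : _ = 0%N) //.
by apply/affine_ord_eq0; rewrite ?regC_eq0 // evpC; apply/eqP.
Qed.

Section Family.
Variables (A B : {poly R}) (c : R) (N : nat).
Hypothesis nAB : nform Q^s P^s A B = c%:P * ('X - x%:P) ^+ N.
Hypotheses (c0 : c != 0) (phi0 : conj_diag A B != 0).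
Local Notation phi := (conj_diag A B).

(** The roots of [W] are simple and are abscissae of Weierstrass points, so [W] has order 2 there
    and c W^N divides the square of [phi]. Pole orders are then compared. *)
Lemma weierstrass_pole_bound (W : {poly k}) : W != 0 ->
  (forall xi : affine_point X, root W (val xi).1 ->
     2 * (val xi).2 + Q.[(val xi).1] = 0 /\ W^`().[(val xi).1] != 0) ->
  (pole_ord c + 2 * N * (size W).-1 <= 2 * pole_ord phi)%N.
Proof.
move=> W0 hW; have rW : regC X W != 0 by rewrite regC_eq0.
have D0 : c * regC X W ^+ N != 0 by rewrite mulf_neq0 // expf_neq0.
have phi2 : phi ^+ 2 != 0 by rewrite expf_neq0.
have [zeta|r er] := dvd_affine_ord phi2 D0.
  rewrite affine_ordM ?expf_neq0 // affine_ordX //.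
  apply/affine_ord_ge => //.
  have mc := (affine_ordP zeta c0).1.
  have [Wz|Wz] := boolP (root W (val zeta).1).
    have [w0 W1] := hW _ Wz.
    rewrite affine_ord_regC_root // [(N * 2)%N]mulnC.
    exact: (weierstrass_conj_diag nAB w0 mc).
  rewrite [affine_ord zeta (regC X W)](_ : _ = 0%N) ?muln0 ?addn0.
    exact: (affine_conj_diag nAB mc).
  by apply/affine_ord_eq0 => //; rewrite evpC; apply/eqP.
have r0 : r != 0 by apply: contraNneq phi2 => r0; rewrite er r0 mulr0.
have poleX n : pole_ord (regC X W ^+ n) = (2 * n * (size W).-1)%N.
  by rewrite -rmorphXn /= pole_ord_regC size_exp -mulnA [(n * _)%N]mulnC.
by rewrite -pole_ord_sqr // er !pole_ordM // ?expf_neq0 // poleX leq_addr.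
Qed.

Lemma no_torsion_family : (0 < g)%N -> (0 < N)%N ->
  (2 : k) != 0 \/ (1 < size Q)%N -> False.
Proof.
move=> g0 N0 hk.
have [k2|k2] := eqVneq (2 : k) 0.
  case: hk => [|sQ]; first by rewrite k2 eqxx.
  have [a ra] : exists a, root Q a by apply/closed_rootP; lia.
  have aW (xi : affine_point X) : root ('X - a%:P) (val xi).1 ->
     2 * (val xi).2 + Q.[(val xi).1] = 0 /\ ('X - a%:P)^`().[(val xi).1] != 0.
    rewrite root_XsubC => /eqP ->; rewrite k2 mul0r add0r (rootP ra).
    by split=> //; rewrite derivXsubC hornerE oner_neq0.
  have := weierstrass_pole_bound (negbT (polyXsubC_eq0 a)) aW.
  have := pole_ord_conj_diag_strict nAB c0 phi0 N0 k2.
  rewrite size_XsubC; lia.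
(* The discriminant of the equation in y: its 2g+1 roots are the affine Weierstrass abscissae,
   simple by smoothness. One factor of degree 1 would only match the bound at infinity, but here the
   degree is at least 3. *)
pose W := Q ^+ 2 + 4%:R *: P.
have k4 : (4%:R : k) != 0 by rewrite -[4%N]/(2 * 2)%N natrM mulf_neq0.
have sW : size W = (2 * g + 2)%N.
  rewrite /W addrC size_polyDl size_scale // size_hypP //.
  apply: leq_ltn_trans (size_poly_exp_leq _ _) _.
  have := size_hypQ X; move: (size Q) => s; lia.
have W0 : W != 0 by rewrite -size_poly_gt0 sW addn2.
have hW (xi : affine_point X) : root W (val xi).1 ->
     2 * (val xi).2 + Q.[(val xi).1] = 0 /\ W^`().[(val xi).1] != 0.
  move=> rW; have w0 : 2 * (val xi).2 + Q.[(val xi).1] = 0.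
    apply/eqP; rewrite -sqrf_eq0; move: rW; rewrite /root /W !hornerE -on_curve_val.
    by move=> /eqP <-; apply/eqP; ring.
  split=> //; case: (hyp_smooth (on_curve_val xi)); last by rewrite w0 eqxx.
  move=> nz; rewrite /W !derivE !hornerE.
  have -> : Q.[(val xi).1] = - (2 * (val xi).2) by apply/eqP; rewrite -addr_eq0 addrC w0.
  have : - 4%:R * (Q^`().[(val xi).1] * (val xi).2 - P^`().[(val xi).1]) != 0.
    by rewrite mulf_neq0 // oppr_eq0.
  by congr (_ != 0); ring.
have := weierstrass_pole_bound W0 hW; have := pole_ord_conj_diag nAB c0 phi0.
rewrite sW; move: (pole_ord c) (pole_ord phi) => s t; nia.
Qed.

End Family.
End TorsionFamily.

(** * Characteristic 2 with constant Q *)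

Lemma coef_exp_XsubC (S : comNzRingType) (a : S) n :
  (('X - a%:P) ^+ n.+1)`_n = - a *+ n.+1.
Proof.
elim: n => [|n IH]; first by rewrite expr1 coefB coefX coefC sub0r.
have top : (('X - a%:P) ^+ n.+1)`_n.+1 = 1.
  have := monicP (monic_exp n.+1 (monicXsubC a)).
  by rewrite lead_coefE size_exp_XsubC.
rewrite exprS mulrBl coefB coefXM /= coefCM IH top mulr1.
by rewrite -[n.+2]addn1 mulrnDr.
Qed.

Section CharTwo.
Variables (S : comNzRingType).
Hypothesis S2 : (2 : S) = 0.

Lemma addrr_two0 (a : S) : a + a = 0.
Proof. by rewrite -mulr2n -mulr_natr S2 mulr0. Qed.

Lemma oppr_two0 (a : S) : - a = a.
Proof. by apply/eqP; rewrite -subr_eq0 -opprD addrr_two0 oppr0. Qed.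

Lemma mulrn_odd_two0 (a : S) n : odd n -> a *+ n = a.
Proof.
move=> on; rewrite -(odd_double_half n) on -mul2n mulrnDr mulrnA mulr2n.
by rewrite addrr_two0 mul0rn addr0.
Qed.

Lemma coef_sqr_two0 (p : {poly S}) i : odd i -> (p ^+ 2)`_i = 0.
Proof.
case: i => // i oi; rewrite -(mulrn_odd_two0 (p ^+ 2)`_i.+1 oi) -coef_deriv.
by rewrite deriv_exp /= expr1 coefMn mulr2n addrr_two0.
Qed.

End CharTwo.

Section Special.
Variables (k : closedFieldType) (g : nat) (X : hyperelliptic k g).
Local Notation P := (hypP X).
Local Notation Q := (hypQ X).
Local Notation R := (coord_ring X).
Local Notation x := (regX X).
Local Notation y := (regY X).
Local Notation "p ^s" := (map_poly (scal X) p) (at level 2, format "p ^s").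
Hypotheses (g0 : (0 < g)%N) (k2 : (2 : k) = 0) (sQ : (size Q <= 1)%N).

Let R2 : (2 : R) = 0.
Proof. by rewrite -(rmorph_nat (scal X)) k2 rmorph0. Qed.

(** If [Q] were 0, then P' would have degree 2g > 0, and the point over one of its roots would be
    singular. *)
Lemma Q_char2 : exists2 q : k, q != 0 & Q = q%:P.
Proof.
exists Q`_0; last exact: size1_polyC.
apply/eqP => q0.
have Q0 : Q = 0 by rewrite (size1_polyC sQ) q0.
have sP : size P^`() != 1%N.
  have : P^`()`_(2 * g) != 0.
    rewrite coef_deriv mulrn_odd_two0 //; last by rewrite /= mul2n odd_double.
    have := monicP (hypP_monic X); rewrite lead_coefE size_hypP addn2 /= => ->.
    exact: oner_neq0.
  by apply: contraNneq => s1; rewrite nth_default // s1; lia.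
have [a /rootP ra] := closed_rootP _ sP.
have [b ab] := exists_point X a; pose xi : affine_point X := Sub _ ab.
have := hyp_smooth (on_curve_val xi).
by rewrite Q0 deriv0 !horner0 /= ra mul0r subrr k2 mul0r addr0 eqxx; case.
Qed.

(** In characteristic 2 the coordinates of a square involve only the squares of the two coordinates,
    so the equation splits into equations a^2 = b^2 (X + p) over [k], impossible by parity of
    degrees unless a = b = 0. *)
Lemma sqr_XaddC_char2 (f h : R) p : f ^+ 2 = h ^+ 2 * (x + scal X p) -> h = 0.
Proof.
have [q q0 Qq] := Q_char2.
have key (a b : {poly k}) : a ^+ 2 = b ^+ 2 * ('X + p%:P) -> a = 0 /\ b = 0.
  move=> e; apply: (@nform_eq0 k 0 ('X + p%:P) 0); rewrite ?size_poly0 ?size_XaddC //.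
  by rewrite /nform e mulr0 subr0 subrr.
have -> : x + scal X p = regC X ('X + p%:P) by rewrite rmorphD.
move=> e.
have e0 := congr1 (@coefY0 _ _ X) e; have e1 := congr1 (@coefY1 _ _ X) e.
move: e0 e1; rewrite !expr2 !coefYM !coefY_regC !(mulr0, mul0r, addr0, add0r, subr0).
set f0 := coefY0 f; set f1 := coefY1 f; set h0 := coefY0 h; set h1 := coefY1 h.
have pk2 : (2 : {poly k}) = 0 by rewrite -polyC_natr k2 polyC0.
have z (a b : {poly k}) : a * b + b * a = 0 by rewrite mulrC addrr_two0.
rewrite !z !sub0r mulNr => e0 /oppr_inj e1.
have [f10 h10] : f1 = 0 /\ h1 = 0.
  apply: key; apply: (mulIf (_ : Q != 0)); first by rewrite Qq polyC_eq0.
  by rewrite !expr2 e1; ring.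
move: e0; rewrite f10 h10 !mul0r !addr0 -!expr2 => /key[_ h00].
by apply: coord_eq0.
Qed.

(** With N = 2M+1 and m = M - g, the two top coefficients of the norm equation read c = - B_m^2 and
    c x = A_M^2 - B_m^2 P_(2g). Together they make x + P_(2g) the square of A_M / B_m. *)
Lemma no_odd_torsion_family (A B : {poly R}) (c : R) (N : nat) :
  odd N -> c != 0 -> nform Q^s P^s A B = c%:P * ('X - x%:P) ^+ N -> False.
Proof.
move=> oN c0 nAB; have [M eN] : exists M, N = (2 * M + 1)%N by exists N./2; lia.
have [q q0 Qq] := Q_char2.
have inj := @scal_inj _ _ X.
have sP : size P^s = (2 * g + 2)%N by rewrite size_map_inj_poly ?size_hypP // rmorph0.
have sQs : (size Q^s <= g.+1)%N by rewrite size_map_inj_poly ?rmorph0 // size_hypQ.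
have [sA sB] := size_nform sP sQs A B.
have sN : size (nform Q^s P^s A B) = (2 * M + 2)%N.
  by rewrite nAB mul_polyC size_scale // size_exp_XsubC eN; lia.
have top : c = (nform Q^s P^s A B)`_(2 * M + 1).
  have := monicP (monic_exp N (monicXsubC x)).
  by rewrite lead_coefE size_exp_XsubC nAB coefCM eN => ->; rewrite mulr1.
have next : (nform Q^s P^s A B)`_(2 * M) = c * x.
  rewrite nAB coefCM eN addn1 coef_exp_XsubC mulNrn oppr_two0 //.
  by rewrite mulrn_odd_two0 // /= mul2n odd_double.
have {}sA : (size A <= M.+1)%N.
  have [->|A0] := eqVneq A 0; first by rewrite size_poly0.
  by have := sA A0; rewrite sN; move: (size A) => s; lia.
have A2 : (A ^+ 2)`_(2 * M) = A`_M ^+ 2 by rewrite mul2n -addnn expr2 coef_top.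
have A2' : (A ^+ 2)`_(2 * M + 1) = 0.
  by rewrite nth_default // (leq_trans (size_poly_exp_leq _ _)) //; move: (size A) sA => s; lia.
have [B0|B0] := eqVneq B 0.
  move: c0; rewrite top /nform B0 expr0n !(mulr0, mul0r, subr0) A2' eqxx //.
have {}sB : (size B + g <= M.+1)%N.
  by have := sB B0; rewrite sN; move: (size B) => s; lia.
have gM : (g <= M)%N.
  by move: B0 sB; rewrite -size_poly_gt0; move: (size B) => s; lia.
pose m := (M - g)%N.
have sBm : (size B <= m.+1)%N by rewrite /m; move: (size B) sB => s; lia.
have sAB : (size (A * B)%R <= 2 * M)%N.
  apply: leq_trans (size_polyMleq _ _) _; move: sA sB gM g0.
  by move: (size A) (size B) => s t; lia.
have ABQ i : (2 * M <= i)%N -> (A * B * Q^s)`_i = 0.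
  move=> le; rewrite Qq map_polyC /= coefMC nth_default ?mul0r //.
  exact: leq_trans le.
have sB2 : (size (B ^+ 2)%R <= (2 * m).+1)%N.
  apply: leq_trans (size_poly_exp_leq _ _) _.
  by move: (size B) sBm => s; lia.
have B2 : (B ^+ 2)`_(2 * m) = B`_m ^+ 2 by rewrite mul2n -addnn expr2 coef_top.
have lP : P`_(2 * g + 1) = 1.
  by have := monicP (hypP_monic X); rewrite lead_coefE size_hypP addn2 addn1.
have top' : c = - B`_m ^+ 2.
  rewrite top /nform !coefB A2' ABQ ?leq_addr // subr0 sub0r.
  have -> : (2 * M + 1 = 2 * m + (2 * g + 1))%N by rewrite /m; lia.
  rewrite coef_top //; last by rewrite sP addn1 addn2.
  by rewrite B2 coef_map /= lP rmorph1 mulr1.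
have next' : c * x = A`_M ^+ 2 - B`_m ^+ 2 * scal X P`_(2 * g).
  rewrite -next /nform !coefB A2 ABQ // subr0; congr (_ - _).
  (* Only the index 2m survives in the product of B^2 and [P]: larger indices exceed the degree of
     B^2, odd ones vanish in a square, and smaller even ones call for a coefficient of [P] above
     2g+1. *)
  have lt : (2 * m < (2 * M).+1)%N by rewrite /m; lia.
  rewrite coefM (bigD1 (Ordinal lt)) //= big1 ?addr0; last first.
    move=> [i /= li]; rewrite -val_eqE /= => ne.
    have [lt'|le] := ltnP (2 * m) i; first by rewrite nth_default ?mul0r // (leq_trans sB2).
    have [oi|ei] := boolP (odd i); first by rewrite coef_sqr_two0 // mul0r.
    rewrite [P^s`__]nth_default ?mulr0 // sP.
    by move: ne le ei; rewrite /m -dvdn2; lia.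
  rewrite B2 coef_map; congr (_ * scal X P`_ _); rewrite /m; lia.
have Bm : B`_m != 0 by apply: contraNneq c0 => z; rewrite top' z expr0n oppr0.
have : A`_M ^+ 2 = B`_m ^+ 2 * (x + scal X P`_(2 * g)).
  have -> : A`_M ^+ 2 = c * x + B`_m ^+ 2 * scal X P`_(2 * g) by rewrite next' subrK.
  by rewrite top' mulNr (oppr_two0 R2) mulrDr.
by move/sqr_XaddC_char2 => z; rewrite z eqxx in Bm.
Qed.
End Special.

(** * Taylor expansion of the curve *)

Section PfilComp.
Variables (k : fieldType) (R : comNzRingType) (sc : {rmorphism k -> R}).
Variable v : filtration sc.

Lemma pfil_sum s d I (r : seq I) (p : pred I) (F : I -> {poly R}) :
  (forall i, p i -> pfil v s d (F i)) -> pfil v s d (\sum_(i <- r | p i) F i).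
Proof. by move=> h; apply: big_ind => //; [exact: pfil0|exact: pfilD]. Qed.

Lemma pfil_comp s s' d A T : pfil v s d A -> pfil v s' s T -> pfil v s' d (A \Po T).
Proof.
move=> a t; rewrite comp_polyE; apply: pfil_sum => i _.
rewrite -mul_polyC -[d](subrK (s * i%:Z)); apply: pfilM (pfilX _ t).
exact: pfilC (a i).
Qed.

Lemma pfil_drop1 s d A : pfil v s d A -> pfil v s (d - s) (drop_poly 1 A).
Proof.
move=> a j; rewrite coef_drop_poly.
have -> : d - s - s * j%:Z = d - s * (j + 1)%N%:Z by rewrite PoszD; ring.
exact: a.
Qed.
End PfilComp.

Section StepIteration.
Variables (S : comNzRingType) (t p q y w : S).

(** Put y + w Z for the ordinate and x + w^2 t for the abscissa in the equation, with w = 2 y +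
    Q(x). The result is w^2 (Z - [step Z]), [p] and [q] being the first-order remainders of P and
    Q. *)
Definition step (Z : S) : S := t * (p - q * y) - t * w * q * Z - Z ^+ 2.

Lemma iter_step_dvd n : exists r, iter n step 0 = t * r.
Proof.
elim: n => [|n [r er]]; first by exists 0; rewrite mulr0.
rewrite iterS er; exists (p - q * y - w * q * (t * r) - r * (t * r)).
by rewrite /step; ring.
Qed.

(** [step] is a t-adic contraction on multiples of t: one application multiplies the defect by t w q
    + Z + Z', itself a multiple of t. *)
Lemma iter_stepP n : exists r, iter n step 0 - step (iter n step 0) = t ^+ n.+1 * r.
Proof.
elim: n => [|n [r er]].
  by exists (- (p - q * y)); rewrite /= /step; ring.
have [r1 e1] := iter_step_dvd n; have [r2] := iter_step_dvd n.+1.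
rewrite iterS; move: (iter n step 0) er e1 => Z er e1; set Z' := step Z => e2.
exists (- r * (w * q + r1 + r2)).
have -> : Z' - step Z' = - (Z - Z') * (t * w * q + Z + Z').
  by rewrite {1}/Z' /step; ring.
by rewrite er e1 e2 [in RHS]exprS; ring.
Qed.
End StepIteration.

Section Taylor.
Variables (k : closedFieldType) (g : nat) (X : hyperelliptic k g).
Local Notation P := (hypP X).
Local Notation Q := (hypQ X).
Local Notation R := (coord_ring X).
Local Notation x := (regX X).
Local Notation y := (regY X).
Local Notation "p ^s" := (map_poly (scal X) p) (at level 2, format "p ^s").
Local Notation vinf := (infinity_filtration X).

(* w is the derivative of the equation with respect to y; it vanishes exactly at
   the Weierstrass points. *)
Definition regW : R := 2 * y + regC X Q.
Local Notation w := regW.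

Definition xpoly : {poly R} := x%:P + (w ^+ 2)%:P * 'X.
Definition tail (p : {poly k}) : {poly R} :=
  drop_poly 1 (p^s \Po ('X + x%:P)) \Po ((w ^+ 2)%:P * 'X).

Lemma horner_scal (p : {poly k}) : p^s.[x] = regC X p.
Proof.
elim/poly_ind: p => [|p c IH]; first by rewrite !rmorph0 horner0.
rewrite !rmorphD !rmorphM /= map_polyX map_polyC !hornerE IH.
by rewrite /= mulrC.
Qed.

Lemma comp_xpoly (p : {poly k}) :
  p^s \Po xpoly = (regC X p)%:P + (w ^+ 2)%:P * 'X * tail p.
Proof.
set T : {poly R} := (w ^+ 2)%:P * 'X.
have -> : xpoly = ('X + x%:P) \Po T.
  by rewrite comp_polyD comp_polyX comp_polyC addrC.
rewrite comp_polyA -[X in X \Po T](poly_take_drop 1) /tail -/T.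
rewrite comp_polyD comp_polyM comp_polyX addrC [X in _ = X]addrC [T * _]mulrC addrC.
rewrite addrC; congr (_ + _).
have -> : take_poly 1 (p^s \Po ('X + x%:P)) = (regC X p)%:P.
  apply/polyP => i; rewrite coef_take_poly coefC ltnS leqn0.
  by case: eqP => // ->; rewrite -horner_coef0 horner_comp !hornerE horner_scal.
by rewrite comp_polyC.
Qed.

Lemma fil_infW : fil vinf (- (2 * g + 1)%:Z) w.
Proof.
apply: filD.
  rewrite -[2](rmorph_nat (scal X)); apply: fil_lin; exact: fil_infY X.
by apply: fil_le (fil_inf_regC X (size_hypQ X)); lia.
Qed.

(** Giving t the weight 4 g makes w^2 t weigh -2, like x. Thus p(x + w^2 t) has weight -2 n, and
    removing one factor w^2 t adds 2. *)
Lemma pfil_tail (p : {poly k}) n : (size p <= n.+1)%N ->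
  pfil vinf (4 * g)%:Z (2 - (2 * n)%:Z) (tail p).
Proof.
move=> sp; rewrite /tail; have -> : 2 - (2 * n)%:Z = - (2 * n)%:Z - -2 by lia.
apply: (@pfil_comp _ _ _ _ (-2)).
  apply: pfil_drop1; apply: (@pfil_comp _ _ _ _ (-2)).
    apply: pfil_const => j nz.
    have : (j < size p)%N by rewrite ltnNge; apply: contra nz => h; rewrite nth_default.
    by move: (size p) sp => s; lia.
  by apply: pfilD; [exact: pfil_polyX|exact: (pfilC _ (fil_infX X))].
have -> : -2 = - (2 * g + 1)%:Z * 2%:Z + (4 * g)%:Z by lia.
by apply: pfilM; [apply: pfilC; apply: filX; exact: fil_infW|exact: pfil_polyX].
Qed.

(* y + w Z solves the equation of the curve at the abscissa x + w^2 t iff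
   Z = step Z; the weights make the coefficient of t^j in the solution have
   pole order at most 4 g j. *)
Definition taylor (n : nat) : {poly R} :=
  iter n (step 'X (tail P) (tail Q) y%:P w%:P) 0.

Lemma pfil_taylor n : pfil vinf (4 * g)%:Z 0 (taylor n).
Proof.
have fX := @pfil_polyX _ _ _ vinf (4 * g)%:Z.
have fP : pfil vinf (4 * g)%:Z (- (4 * g)%:Z) (tail P).
  apply: pfil_le (pfil_tail (n := 2 * g + 1) _); first lia.
  by rewrite size_hypP; lia.
have fQ := pfil_tail (size_hypQ X).
elim: n => [|n IH]; first exact: pfil0.
rewrite /taylor iterS -/(taylor n) /step; apply: pfilB; first apply: pfilB.
- have fPQ : pfil vinf (4 * g)%:Z (- (4 * g)%:Z) (tail P - tail Q * y%:P).
    by apply: pfilB => //; apply: pfil_le (pfilM fQ (pfilC _ (fil_infY X))); lia.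
  by apply: pfil_le (pfilM fX fPQ); lia.
- have fXW := pfilM fX (pfilC _ fil_infW).
  by apply: pfil_le (pfilM (pfilM fXW fQ) IH); lia.
by apply: pfil_le (pfilX 2 IH); lia.
Qed.

Definition ypoly (n : nat) : {poly R} := y%:P + w%:P * taylor n.

Lemma ypolyP n : exists r : {poly R},
  ypoly n ^+ 2 + (Q^s \Po xpoly) * ypoly n - (P^s \Po xpoly) = 'X^(n.+1) * r.
Proof.
have [r er] := iter_stepP 'X (tail P) (tail Q) y%:P w%:P n.
exists ((w ^+ 2)%:P * r); rewrite !comp_xpoly mulrCA -er /ypoly -/(taylor n).
have yy : y%:P ^+ 2 = (regC X P)%:P - (regC X Q)%:P * y%:P.
  by rewrite -polyC_exp regY2 polyCB polyCM.
have ww : w%:P = 2 * y%:P + (regC X Q)%:P by rewrite polyCD polyCM polyC_natr.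
rewrite polyC_exp /step; move: yy ww.
move: (taylor n) (tail P) (tail Q) y%:P w%:P (regC X P)%:P (regC X Q)%:P 'X.
move=> Z p q yy ww p0 q0 t e1 e2.
have -> : p0 = yy ^+ 2 + q0 * yy by rewrite e1 subrK.
by rewrite e2; ring.
Qed.

Section Specialization.
Variable xi : affine_point X.
Local Notation a := (val xi).1.
Local Notation b := (val xi).2.
Local Notation "p ^e" := (map_poly (evp xi) p) (at level 2, format "p ^e").

Lemma evp_map_scal (p : {poly k}) : (p^s)^e = p.
Proof.
by apply/polyP => i; rewrite !coef_map /= evp_scal. Qed.

Lemma evp_regW : evp xi w = 2 * b + Q.[a].
Proof. by rewrite rmorphD rmorphM rmorph_nat /= evpY evpC. Qed.

Lemma evp_xpoly : xpoly^e = a%:P + ((evp xi w) ^+ 2)%:P * 'X.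
Proof. by rewrite rmorphD rmorphM /= map_polyX !map_polyC /= evpX rmorphXn. Qed.

(** A truncated Taylor expansion of [f] at xi in the parameter t with x = a + w^2 t; it is
    multiplicative only modulo t^(n+1). *)
Definition expand n (f : R) : {poly k} :=
  (coefY0 f \Po xpoly^e) + (coefY1 f \Po xpoly^e) * (ypoly n)^e.

Lemma expandD n f h : expand n (f + h) = expand n f + expand n h.
Proof. by rewrite /expand !coefYD !comp_polyD; ring. Qed.

Lemma expandM n f h : exists r : {poly k},
  expand n (f * h) = expand n f * expand n h + 'X^(n.+1) * r.
Proof.
have EP (p : {poly k}) : (p^s \Po xpoly)^e = p \Po xpoly^e.
  by rewrite map_comp_poly evp_map_scal.
have [r er] := ypolyP n.
have e : (ypoly n)^e ^+ 2 + (Q \Po xpoly^e) * (ypoly n)^e - (P \Po xpoly^e) =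
    'X^(n.+1) * r^e.
  rewrite -!EP; move: (ypoly n) (P^s \Po _) (Q^s \Po _) er => Y p q er.
  by rewrite -(map_polyX (evp xi)) -!rmorphXn -!rmorphM -rmorphD -rmorphB er.
exists (- (coefY1 f \Po xpoly^e) * (coefY1 h \Po xpoly^e) * r^e).
rewrite /expand !coefYM !(comp_polyB, comp_polyD, comp_polyM).
rewrite [_ * r^e]mulrC mulrA -e.
move: (ypoly n)^e (P \Po _) (Q \Po _) => Y p q.
move: (coefY0 f \Po _) (coefY0 h \Po _) (coefY1 f \Po _) (coefY1 h \Po _) => c d c' d'.
ring.
Qed.

Lemma expand_regC n p : expand n (regC X p) = p \Po xpoly^e.
Proof. by rewrite /expand !coefY_regC comp_poly0 mul0r addr0. Qed.

Lemma expand_y n : expand n y = (ypoly n)^e.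
Proof.
have -> : y = regC X 0 + regC X 1 * y by rewrite rmorph0 rmorph1; ring.
by rewrite /expand !coefYK comp_poly0 add0r comp_polyC mul1r.
Qed.

(** Both generators x - a and y - b of the maximal ideal expand to multiples of t. *)
Lemma expand_dvd n m f : max_ideal_exp xi m f -> (m <= n.+1)%N ->
  exists r : {poly k}, expand n f = 'X^m * r.
Proof.
elim: m f => [|m IH] f; first by exists (expand n f); rewrite expr0 mul1r.
move=> /max_ideal_expS[f1 [f2 [/IH m1 /IH m2 ->]]] lt.
have step (u h : R) (s r : {poly k}) : expand n u = 'X * s -> expand n h = 'X^m * r ->
    exists r' : {poly k}, expand n (u * h) = 'X^(m.+1) * r'.
  move=> eu eh; have [t ->] := expandM n u h.
  exists (s * r + 'X^(n - m) * t).
  have -> : 'X^(n.+1) = 'X^(m.+1) * 'X^(n - m) :> {poly k}.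
    by rewrite -exprD addSn subnKC.
  by rewrite eu eh exprS; ring.
have [r1 e1] := m1 (ltnW lt); have [r2 e2] := m2 (ltnW lt).
have eu1 : expand n (x - scal X a) = 'X * ((evp xi w) ^+ 2)%:P.
  rewrite -regC_XsubC expand_regC comp_polyB comp_polyX comp_polyC evp_xpoly.
  by rewrite addrC addKr mulrC.
have [t et] := iter_step_dvd 'X (tail P) (tail Q) y%:P w%:P n.
have eu2 : expand n (y - scal X b) = 'X * ((evp xi w)%:P * t^e).
  have E : expand n (scal X b) = b%:P.
    by rewrite -[scal X b]/(regC X b%:P) expand_regC comp_polyC.
  have -> : expand n (y - scal X b) = expand n y - b%:P.
    by rewrite -E; apply/eqP; rewrite eq_sym subr_eq -expandD subrK.
  rewrite expand_y rmorphD rmorphM /= !map_polyC /= evpY /taylor et rmorphM /= map_polyX.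
  by rewrite addrC addKr; ring.
have [s1 E1] := step _ _ _ _ eu1 e1; have [s2 E2] := step _ _ _ _ eu2 e2.
by exists (s1 + s2); rewrite expandD E1 E2 mulrDr.
Qed.
End Specialization.
End Taylor.

(** * Relations over the fraction field *)

Section Fraction.
Variable D : idomainType.
Local Notation tf := (@FracField.tofrac D).

Lemma fraction_clear (z : {fraction D}) : exists d n : D, d != 0 /\ tf d * z = tf n.
Proof.
elim/quotW: z => r; exists \d_r, \n_r; split; first exact: denom_ratioP.
unlock FracField.tofrac; rewrite -[LHS]FracField.pi_mul.
apply/eqmodP; rewrite /= FracField.equivfE /FracField.mulf.
by rewrite !numden_Ratio ?(oner_eq0, mul1r, mulr1, mulf_neq0, denom_ratioP).
Qed.

End Fraction.

Lemma coefM_size (S : comNzRingType) (p q : {poly S}) c i :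
  (size p <= c)%N -> (c <= i.+1)%N ->
  (p * q)`_i = \sum_(j < c) p`_j * q`_(i - j).
Proof.
move=> sp ci; rewrite coefM (big_ord_widen i.+1 (fun j => p`_j * q`_(i - j)) ci).
rewrite [RHS]big_mkcond /=; apply: eq_bigr => j _; case: ifP => // /negbT; rewrite -leqNgt => h.
by rewrite nth_default ?mul0r // (leq_trans sp).
Qed.

Lemma sum_uniq_bounded (s : seq nat) m : uniq s -> (forall i, i \in s -> (i < m)%N) ->
  (\sum_(i <- s) i <= \sum_(i < size s) (m - i.+1))%N.
Proof.
elim: m s => [|m IH] s us hs.
  by case: s us hs => [|i s _ /(_ i)]; rewrite ?big_nil // mem_head => /(_ isT).
have [ms|ms] := boolP (m \in s); last first.
  apply: leq_trans (IH s us _) _ => [i si|].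
    by have := hs i si; rewrite ltnS leq_eqVlt => /orP[/eqP e|//]; rewrite -e si in ms.
  by apply: leq_sum => i _; rewrite leq_sub2r.
rewrite (perm_big _ (perm_to_rem ms)) big_cons /=.
have -> : size s = (size (rem m s)).+1.
  by rewrite size_rem //; case: s ms {us hs}.
rewrite big_ord_recl /= subn1 leq_add2l.
apply: leq_trans (IH _ (rem_uniq m us) _) _ => [i|].
  rewrite mem_rem_uniq // inE => /andP[im si].
  by have := hs i si; rewrite ltnS leq_eqVlt (negbTE im).
by apply: leq_sum => i _; rewrite /bump /=; lia.
Qed.

Section Family.
(* F is the fraction field of D; keeping it abstract spares unification the
   unfolding of the quotient that implements fractions. *)
Variables (D : idomainType) (F : fieldType) (tf : {rmorphism D -> F}).
Hypotheses (tf_inj : injective tf).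
Hypothesis clear : forall z : F, exists d n : D, d != 0 /\ tf d * z = tf n.
Variables (q p : {poly D}) (x u yb : D).
Local Notation m_ := (map_poly tf).

Local Notation xp := (x%:P + u%:P * 'X).

Lemma tf_eq0 a : (tf a == 0) = (a == 0).
Proof. by rewrite -(rmorph0 tf) (inj_eq tf_inj). Qed.

Lemma poly_clear (f : {poly F}) :
  exists (d : D) (h : {poly D}), d != 0 /\ (tf d)%:P * f = m_ h.
Proof.
elim/poly_ind: f => [|f c [d [h [d0 e]]]].
  by exists 1, 0; rewrite oner_neq0 mulr0 rmorph0.
have [d' [n [d'0 e']]] := clear c.
exists (d' * d), (d'%:P * h * 'X + (d * n)%:P); split; first by rewrite mulf_neq0.
rewrite rmorphD !rmorphM /= map_polyX !map_polyC /= -e -e' !polyCM; ring.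
Qed.

(* Moves a norm equation from the coordinate t, x + u t being the abscissa, to
   the abscissa itself, and clears denominators. *)
Lemma family_of_norm (A1 B1 : {poly F}) (c1 : F) (N : nat) : u != 0 -> c1 != 0 ->
  nform (m_ (q \Po xp)) (m_ (p \Po xp)) A1 B1 = c1%:P * 'X^N ->
  A1`_0 + B1`_0 * tf yb != 0 ->
  exists (A B : {poly D}) (c : D), [/\ c != 0, A.[x] + B.[x] * yb != 0 &
    nform q p A B = c%:P * ('X - x%:P) ^+ N].
Proof.
move=> u0 c10 nAB phi0.
have xE : m_ xp = (tf x)%:P + (tf u)%:P * 'X.
  by rewrite rmorphD rmorphM /= map_polyX !map_polyC.
have W0 : tf u != 0 by rewrite tf_eq0.
(* The inverse of the substitution: t = (X - x) / u. *)
pose T : {poly F} := ((tf u)^-1)%:P * ('X - (tf x)%:P).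
have WT : (tf u)%:P * T = 'X - (tf x)%:P by rewrite /T mulrA -polyCM mulfV // mul1r.
have xT : m_ xp \Po T = 'X.
  by rewrite xE comp_polyD comp_polyM comp_polyX !comp_polyC WT addrC subrK.
have compT (r : {poly D}) : m_ (r \Po xp) \Po T = m_ r.
  by rewrite map_comp_poly -comp_polyA xT comp_polyXr.
have Tx : T.[tf x] = 0 by rewrite /T !hornerE subrr mulr0.
have nT : nform (m_ q) (m_ p) (A1 \Po T) (B1 \Po T) =
    (c1 * (tf u)^-1 ^+ N)%:P * ('X - (tf x)%:P) ^+ N.
  have := congr1 (comp_poly T) nAB; rewrite rmorph_nform /= !compT => ->.
  by rewrite comp_polyM comp_polyC comp_Xn_poly /T exprMn -polyC_exp mulrA -polyCM.
have [dA [A [dA0 eA]]] := poly_clear (A1 \Po T).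
have [dB [B [dB0 eB]]] := poly_clear (B1 \Po T).
pose d := dA * dB; have d0 : tf d != 0 by rewrite tf_eq0 mulf_neq0.
have eA' : m_ (dB%:P * A) = (tf d)%:P * (A1 \Po T).
  by rewrite rmorphM /= map_polyC /= -eA /d rmorphM /= polyCM mulrCA mulrA.
have eB' : m_ (dA%:P * B) = (tf d)%:P * (B1 \Po T).
  by rewrite rmorphM /= map_polyC /= -eB /d rmorphM /= polyCM mulrA.
have nE : m_ (nform q p (dB%:P * A) (dA%:P * B)) =
    (tf d ^+ 2 * (c1 * (tf u)^-1 ^+ N))%:P * ('X - (tf x)%:P) ^+ N.
  by rewrite rmorph_nform /= eA' eB' nformZ nT -polyC_exp [LHS]mulrA -polyCM.
exists (dB%:P * A), (dA%:P * B), (nform q p (dB%:P * A) (dA%:P * B))`_N.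
have eN : tf (nform q p (dB%:P * A) (dA%:P * B))`_N = tf d ^+ 2 * (c1 * (tf u)^-1 ^+ N).
  rewrite -coef_map /= nE coefCM.
  have := monicP (monic_exp N (monicXsubC (tf x))).
  by rewrite lead_coefE size_exp_XsubC => ->; rewrite mulr1.
split.
- by rewrite -tf_eq0 eN !mulf_neq0 ?expf_neq0 ?invr_neq0.
- rewrite -tf_eq0 rmorphD rmorphM /=.
  rewrite -!horner_map /= eA' eB' !hornerE !horner_comp Tx !horner_coef0.
  by rewrite -mulrA -mulrDr mulf_neq0.
- apply: (map_inj_poly tf_inj (rmorph0 tf)).
  by rewrite nE -eN rmorphM rmorphXn rmorphB /= map_polyX !map_polyC.
Qed.

(* If Y solves the equation up to order N + 1, then a relation A + B Y of order N
   has for norm a constant times t^N. *)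
Lemma family_of_kernel (Y r : {poly D}) (e N n c : nat) (v : 'cV[F]_c) :
  u != 0 -> size p = (2 * e + 2)%N -> (size q <= e.+1)%N ->
  (c <= n)%N -> (2 * n <= N)%N -> (c + n + e <= N)%N -> (2 * c + 2 * e <= N.+1)%N ->
  (n < N)%N ->
  Y ^+ 2 + (q \Po xp) * Y - (p \Po xp) = 'X^(N.+1) * r ->
  - q.[x] - Y`_0 = yb -> v != 0 ->
  (forall i, (n < i < N)%N -> \sum_(j < c) v j 0 * tf Y`_(i - j) = 0) ->
  exists (A B : {poly D}) (c : D), [/\ c != 0, A.[x] + B.[x] * yb != 0 &
    nform q p A B = c%:P * ('X - x%:P) ^+ N].
Proof.
move=> u0 sp sq cn nN cneN ceN nltN eY eyb v0 hv.
pose B := rVpoly v^T; pose y1 := m_ Y.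
have coefBv (j : 'I_c) : B`_j = v j 0 by rewrite coef_rVpoly_ord mxE.
have sB : (size B <= c)%N by apply: size_poly.
have B0 : B != 0.
  apply: contraNneq v0 => B0; apply/eqP/colP => j.
  by rewrite -coefBv B0 coef0 mxE.
(* [A] cancels the coefficients of B Y up to degree [n], and the kernel condition those strictly
   between [n] and [N], so A + B Y is a multiple of t^N. *)
pose A := - take_poly n.+1 (B * y1); pose G := drop_poly N (B * y1).
have sA : (size A <= n.+1)%N by rewrite size_polyN size_take_poly.
have eG : A + B * y1 = G * 'X^N.
  apply/polyP => i; rewrite coefD coefN coef_take_poly coefMXn coef_drop_poly.
  have [iN|iN] := ltnP i N; last by rewrite subnK // ltnNge (leq_trans nltN iN) oppr0 add0r.
  have [ni|ni] := ltnP i n.+1; first by rewrite addNr.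
  rewrite oppr0 add0r (@coefM_size _ _ _ c) //; last by lia.
  by rewrite -[RHS](hv i) ?ni //; apply: eq_bigr => j _; rewrite coefBv coef_map.
have szmap (f : {poly D}) : size (m_ f) = size f.
  by rewrite size_map_inj_poly ?rmorph0.
have sxp : size xp = 2 by rewrite addrC size_MXaddC polyC_eq0 (negbTE u0) /= size_polyC u0.
have sp' : size (m_ (p \Po xp)) = (2 * e + 2)%N by rewrite szmap size_comp_poly2.
have sq' : (size (m_ (q \Po xp)) <= e.+1)%N by rewrite szmap size_comp_poly2.
set q1 := m_ (q \Po xp) in sq' *; set p1 := m_ (p \Po xp) in sp' *.
have eY1 : y1 ^+ 2 + q1 * y1 - p1 = 'X^(N.+1) * m_ r.
  rewrite /y1 /q1 /p1 -(map_polyX tf) -!rmorphXn -!rmorphM -rmorphD -rmorphB.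
  by rewrite eY.
have [_ sBn] := size_nform sp' sq' A B.
(* [C] is the conjugate factor. The norm is t^N E and has degree at most [N], so E is the nonzero
   constant G(0) C(0); and C(0) is the value of the family at the conjugate point. *)
pose C := A - B * q1 - B * y1; pose E := G * C + 'X * (B ^+ 2 * m_ r).
have nE : nform q1 p1 A B = E * 'X^N.
  by rewrite (nform_factor _ _ _ _ y1) eG eY1 -/C /E ['X^(N.+1)]exprS; ring.
have n0 : nform q1 p1 A B != 0.
  by rewrite -size_poly_gt0; apply: leq_trans (sBn B0);
  by move: B0; rewrite -size_poly_gt0; move: (size B) => s; lia.
have sn : (size (nform q1 p1 A B) <= N.+1)%N.
  have s1 : (size (A ^+ 2) <= N.+1)%N.
    by apply: leq_trans (size_poly_exp_leq _ _) _; move: (size A) sA => s; lia.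
  have s2 : (size (A * B * q1)%R <= N.+1)%N.
    apply: leq_trans (size_polyMleq _ _) _.
    have := size_polyMleq A B; move: (size A) (size B) (size q1) (size (A * B)) sA sB sq'.
    by move=> *; lia.
  have s3 : (size (B ^+ 2 * p1)%R <= N.+1)%N.
    apply: leq_trans (size_polyMleq _ _) _; rewrite sp'.
    have := size_poly_exp_leq B 2; move: B0 sB; rewrite -size_poly_gt0.
    by move: (size B) (size (B ^+ 2)) => *; lia.
  apply: leq_trans (size_polyD _ _) _; rewrite size_polyN geq_max s3 andbT.
  by apply: leq_trans (size_polyD _ _) _; rewrite size_polyN geq_max s1.
have E0 : E != 0 by apply: contraNneq n0 => E0; rewrite nE E0 mul0r.
have sE : (size E <= 1)%N by move: sn; rewrite nE size_mulXn //; move: (size E) => s; lia.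
have EC : E = (G`_0 * C`_0)%:P.
  rewrite {1}(size1_polyC sE); congr _%:P.
  by rewrite coefD coefM big_ord1 coefXM addr0.
have c10 : G`_0 * C`_0 != 0 by rewrite -polyC_eq0 -EC.
apply: (@family_of_norm A B (G`_0 * C`_0) N) => //; first by rewrite nE EC.
have C0 : C`_0 != 0 by move: c10; rewrite mulf_eq0 negb_or => /andP[].
move: C0; congr (_ != 0).
have q10 : q1`_0 = tf q.[x].
  by rewrite coef_map -horner_coef0 horner_comp !hornerE.
have y10 : y1`_0 = tf Y`_0 by rewrite coef_map.
rewrite /C !coefB !coefM !big_ord1 q10 y10 -eyb rmorphB rmorphN /=; ring.
Qed.
End Family.

(** * Minors of the Hankel matrix of the Taylor coefficients *)

Section Hankel.
Variables (k : closedFieldType) (g : nat) (X : hyperelliptic k g).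
Local Notation P := (hypP X).
Local Notation Q := (hypQ X).
Local Notation R := (coord_ring X).
Local Notation x := (regX X).
Local Notation y := (regY X).
Local Notation yb := (- regC X Q - y).
Local Notation w := (regW X).
Local Notation "p ^s" := (map_poly (scal X) p) (at level 2, format "p ^s").
Local Notation vinf := (infinity_filtration X).
Local Notation tf := (@FracField.tofrac R).
Variable N : nat.
Hypotheses (g0 : (0 < g)%N) (gN : (2 * g + 1 <= N)%N).

(** For a + b y of pole order at most N, the columns index the coefficients of b, and the rows the
    exponents strictly between N/2 and N, which a, of degree at most N/2, cannot reach. Coefficients
    of [taylor] replace those of y: in positive degree they differ by the factor w. *)
Definition hankel : 'M[R]_((uphalf N).-1, uphalf N - g) :=
  \matrix_(i, j) (taylor X N)`_(N./2.+1 + i - j).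

Lemma regW_neq0 : w != 0.
Proof.
have E : w = regC X Q + regC X 2 * y by rewrite /regW rmorph_nat addrC.
apply/eqP => w0; have := congr1 (@coefY0 _ _ X) w0; have := congr1 (@coefY1 _ _ X) w0.
rewrite E !coefYK -(rmorph0 (regC X)) !coefY_regC => k2 Q0.
have {}k2 : (2 : k) = 0 by apply: polyC_inj; rewrite polyC_natr k2.
have [|q q0 Qq] := Q_char2 g0 k2 (_ : (size Q <= 1)%N); first by rewrite Q0 size_poly0.
by move: q0; rewrite -polyC_eq0 -Qq Q0 eqxx.
Qed.

Lemma taylor_coef0 : (taylor X N)`_0 = 0.
Proof.
have [r er] := iter_step_dvd 'X (tail X P) (tail X Q) y%:P w%:P N.
by rewrite /taylor er coefXM.
Qed.

(** If the columns were dependent over the fraction field, a kernel vector would produce a family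
    with norm c (X - x)^N, which the hypothesis excludes. *)
Lemma exists_hankel_minor : (2 : k) != 0 \/ (1 < size Q)%N \/ odd N ->
  exists f : 'I_(uphalf N - g) -> 'I_(uphalf N).-1,
    injective f /\ \det (rowsub f hankel) != 0.
Proof.
move=> gen; pose HK := map_mx tf hankel.
have [full|] := boolP (row_full HK).
  exists (fullrankfun full); split; first exact: fullrankfun_inj.
  have := fullrowsub_unit full; rewrite unitmxE unitfE -map_mxsub det_map_mx /=.
  by rewrite tofrac_eq0.
rewrite -cokermx_eq0 => nz; exfalso.
have [j vj] : exists j, col j (cokermx HK) != 0.
  apply/existsP; apply: contraR nz; rewrite negb_exists => /forallP h.
  apply/eqP/matrixP => i j; have := h j; rewrite negbK => /eqP/colP/(_ i).
  by rewrite !mxE.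
set v := col j _ in vj.
have Hv : HK *m v = 0 by rewrite /v colE mulmxA mulmx_coker mul0mx.
have [r er] := ypolyP X N.
have sP : size P^s = (2 * g + 2)%N.
  by rewrite size_map_inj_poly ?size_hypP ?rmorph0 //; apply: scal_inj.
have sQ : (size Q^s <= g.+1)%N.
  by rewrite size_map_inj_poly ?size_hypQ ?rmorph0 //; apply: scal_inj.
have Y0 : (ypoly X N)`_0 = y by rewrite coefD coefC coefCM taylor_coef0 mulr0 addr0.
have YS i : (0 < i)%N -> (ypoly X N)`_i = w * (taylor X N)`_i.
  by move=> i0; rewrite coefD coefC coefCM eqn0Ngt i0 add0r.
have tfi : injective tf by move=> a b /eqP; rewrite tofrac_eq => /eqP.
have eyb : - Q^s.[x] - (ypoly X N)`_0 = yb by rewrite Y0 horner_scal.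
have hv i : (N./2 < i < N)%N ->
    \sum_(j < uphalf N - g) v j 0 * tf (ypoly X N)`_(i - j) = 0.
  move=> /andP[ni iN].
  have li : (i - N./2.+1 < (uphalf N).-1)%N by lia.
  have := congr1 (fun M : 'M_(_, _) => M (Ordinal li) 0) Hv; rewrite !mxE => e.
  transitivity (tf w * (\sum_j0 HK (Ordinal li) j0 * v j0 0)); last by rewrite e mulr0.
  rewrite mulr_sumr; apply: eq_bigr => j' _; have := ltn_ord j' => lj.
  rewrite YS; last by lia.
  rewrite [HK _ _]mxE [hankel _ _]mxE /= rmorphM /=.
  have -> : (N./2.+1 + (i - N./2.+1) - j' = i - j')%N by lia.
  by ring.
have w20 : w ^+ 2 != 0 by rewrite expf_neq0 // regW_neq0.
have [|||||A [B [c [c0 phi0 nAB]]]] :=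
  @family_of_kernel R _ tf tfi (@fraction_clear R) Q^s P^s x (w ^+ 2) yb
    (ypoly X N) r g N N./2 (uphalf N - g) v w20 sP sQ _ _ _ _ _ er eyb vj hv;
  try lia.
case: gen => [k2|[sQ1|oN]].
- by apply: (no_torsion_family nAB) => //; [lia|left].
- by apply: (no_torsion_family nAB) => //; [lia|right].
have [k2|k2] := eqVneq (2 : k) 0; last first.
  by apply: (no_torsion_family nAB) => //; [lia|left].
have [sQ1|sQ1] := ltnP 1 (size Q).
  by apply: (no_torsion_family nAB) => //; [lia|right].
exact: (no_odd_torsion_family g0 k2 sQ1 oN c0 nAB).
Qed.

(** The n-th Taylor coefficient has pole order at most 4 g n, so it suffices to bound the sum of the
    indices in each term of the Leibniz expansion. *)
Lemma pole_ord_hankel_minor (f : 'I_(uphalf N - g) -> 'I_(uphalf N).-1) :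
  injective f -> \det (rowsub f hankel) != 0 ->
  (pole_ord (\det (rowsub f hankel)) <=
     4 * g * ((uphalf N - g) * (N./2 + g)))%N.
Proof.
move=> fi d0; apply/(infinity_filP _ d0).
set c := (uphalf N - g)%N in f fi d0 *.
have fZ := pfil_taylor X N.
apply: fil_sum => s _.
have -> : (-1) ^+ s = scal X ((-1) ^+ s) by rewrite rmorphXn rmorphN1.
apply: fil_lin.
have S : (\sum_i (N./2.+1 + f i - s i) <= c * (N./2 + g))%N.
  have lt i : (s i <= N./2.+1 + f i)%N by have := ltn_ord (s i); lia.
  have E : (\sum_i (N./2.+1 + f i - s i) + \sum_i s i = \sum_i (N./2.+1 + f i))%N.
    by rewrite -big_split /=; apply: eq_bigr => i _; rewrite subnK.
  have Es : (\sum_i (s i : nat) = \sum_(i < c) i)%N.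
    by rewrite [RHS](reindex_inj (@perm_inj _ s)).
  have Ef : (\sum_(i < c) (f i : nat) <= \sum_(i < c) ((uphalf N).-1 - i.+1))%N.
    have := @sum_uniq_bounded [seq nat_of_ord (f i) | i <- enum 'I_c] (uphalf N).-1.
    rewrite size_map size_enum_ord big_map big_enum /=; apply.
      by rewrite map_inj_uniq ?enum_uniq // => i j /val_inj/fi.
    by move=> i /mapP[j _ ->].
  (* Counted upwards, the [c] largest rows are g - 1 + i. Their i cancel against the column indices,
     leaving N/2 + 1 + (g - 1) per factor. *)
  have Ec : (\sum_(i < c) ((uphalf N).-1 - i.+1) = \sum_(i < c) (g - 1 + i))%N.
    rewrite [LHS](reindex_inj rev_ord_inj) /=; apply: eq_bigr => i _.
    by have := ltn_ord i; rewrite /c; lia.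
  move: E Ef; rewrite Es Ec !big_split /= !sum_nat_const card_ord.
  move: (\sum_(i < c) i)%N => t; nia.
apply: (@fil_le _ _ _ _ _ (\sum_i (- ((4 * g)%:Z * (N./2.+1 + f i - s i)%N%:Z)))).
  by rewrite sumrN -mulr_sumr -(raddf_sum Posz) lerN2 -PoszM lez_nat leq_mul2l S orbT.
apply: (big_ind2 (fun d h => fil vinf d h)); first exact: fil1.
  by move=> d1 h1 d2 h2; apply: filM.
by move=> i _; have := fZ (N./2.+1 + f i - s i)%N; rewrite !mxE sub0r.
Qed.
End Hankel.

(** * Torsion points *)

Section Torsion.
Variables (k : closedFieldType) (g : nat) (X : hyperelliptic k g).
Local Notation P := (hypP X).
Local Notation Q := (hypQ X).
Local Notation R := (coord_ring X).
Local Notation x := (regX X).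
Local Notation y := (regY X).
Local Notation w := (regW X).
Local Notation "p ^s" := (map_poly (scal X) p) (at level 2, format "p ^s").

(** A function with divisor N xi - N infty, expressed by two inequalities: infinity is its only
    possible pole. *)
Definition tors (xi : affine_point X) (N : nat) :=
  exists f : R, [/\ f != 0, max_ideal_exp xi N f & (pole_ord f <= N)%N].

Lemma size_coefY (f : R) N : (pole_ord f <= N)%N ->
  (size (coefY0 f) <= N./2.+1)%N /\
  (coefY1 f != 0 -> (size (coefY1 f) + g <= uphalf N)%N).
Proof.
rewrite /pole_ord -/(coefY0 f) -/(coefY1 f) geq_max => /andP[].
move: (size (coefY0 f)) (size (coefY1 f)) => s t h0 h1.
by split=> [|nz]; move: h1; rewrite ?(negbTE nz); lia.
Qed.

Section Point.
Variable xi : affine_point X.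
Local Notation a := (val xi).1.
Local Notation b := (val xi).2.
Local Notation "p ^e" := (map_poly (evp xi) p) (at level 2, format "p ^e").
Hypothesis w0 : evp xi w != 0.

Lemma size_evp_xpoly : size (xpoly X)^e = 2%N.
Proof.
rewrite evp_xpoly addrC size_MXaddC polyC_eq0 sqrf_eq0 (negbTE w0) /=.
by rewrite size_polyC sqrf_eq0 w0.
Qed.

(** The expansion of a + b y at xi is a multiple of t^N, so the coefficients of b, rewritten in t,
    form a kernel vector of the specialized matrix. *)
Lemma evp_hankel_minor N (f : 'I_(uphalf N - g) -> 'I_(uphalf N).-1) :
  (0 < g)%N -> (2 * g + 1 <= N)%N -> tors xi N ->
  evp xi (\det (rowsub f (hankel X N))) = 0.
Proof.
move=> g0 gN [F [F0 mF pF]]; have [sA sB] := size_coefY pF.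
have [r er] := expand_dvd mF (leqnSn N).
have s2 := size_evp_xpoly.
pose A := coefY0 F \Po (xpoly X)^e; pose B := coefY1 F \Po (xpoly X)^e.
have sA' : (size A <= N./2.+1)%N by rewrite size_comp_poly2.
(* Without a y-term the expansion would be a nonzero polynomial in t of degree at most N/2 divisible
   by t^N. *)
have B0 : coefY1 F != 0.
  apply: contraNneq F0 => B0; apply/eqP/coord_eq0 => //.
  move: er; rewrite /expand B0 comp_poly0 mul0r addr0 -/A => er.
  have A0 : A = 0.
    have [//|A0] := eqVneq A 0; have r0 : r != 0.
      by apply: contraNneq A0 => r0; rewrite er r0 mulr0.
    by move: sA'; rewrite er mulrC size_mulXn //; move: r0; rewrite -size_poly_gt0; lia.
  by move/eqP: A0; rewrite /A comp_poly2_eq0 // => /eqP.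
have sB' : (size B <= uphalf N - g)%N.
  by rewrite size_comp_poly2 //; have := sB B0; move: (size (coefY1 F)) => s; lia.
have B0' : B != 0 by rewrite /B comp_poly2_eq0.
pose v : 'cV[k]_(uphalf N - g) := \col_j B`_j.
have v0 : v != 0.
  apply: contraNneq B0' => v0; apply/eqP/polyP => i; rewrite coef0.
  have [lt|le] := ltnP i (uphalf N - g); last by rewrite nth_default // (leq_trans sB').
  by have := congr1 (fun v : 'cV_ _ => v (Ordinal lt) 0) v0; rewrite !mxE.
have Hv : map_mx (evp xi) (hankel X N) *m v = 0.
  apply/colP => i; rewrite !mxE; have li := ltn_ord i.
  have := congr1 (fun p : {poly k} => p`_(N./2.+1 + i)) er.
  rewrite coefXnM ifT; last by lia.
  rewrite /expand -/A -/B coefD nth_default ?add0r; last by rewrite (leq_trans sA') // leq_addr.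
  rewrite rmorphD rmorphM /= !map_polyC /= mulrDr coefD mulrC coefCM nth_default ?mulr0 ?add0r; last first.
    by rewrite (leq_trans sB') //; lia.
  rewrite mulrCA coefCM (@coefM_size _ _ _ (uphalf N - g)) //; last by lia.
  move=> /eqP; rewrite mulf_eq0 (negbTE w0) /= => /eqP e; rewrite -[RHS]e.
  by apply: eq_bigr => j _; rewrite !mxE coef_map mulrC.
rewrite -det_map_mx map_mxsub; apply/eqP; rewrite -det_tr; apply/det0P.
exists v^T; first by rewrite trmx_eq0.
rewrite -trmx_mul mul_rowsub_mx Hv.
by apply/matrixP => i j; rewrite !mxE.
Qed.

End Point.

Local Open Scope classical_set_scope.
Local Open Scope card_scope.

Lemma card_tors_generic N : (0 < g)%N -> (2 * g + 1 <= N)%N ->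
  (2 : k) != 0 \/ (1 < size Q)%N \/ odd N ->
  [set xi | evp xi w != 0 /\ tors xi N] #<=
    `I_(4 * g * ((uphalf N - g) * (N./2 + g)))%N.
Proof.
move=> g0 gN gen; have [f [fi d0]] := exists_hankel_minor g0 gN gen.
apply: card_le_trans (_ : _ #<= `I_(pole_ord (\det (rowsub f (hankel X N))))) _.
  apply: card_le_trans (card_zeros d0); apply: subset_card_le => xi [w0 t].
  exact: evp_hankel_minor.
by rewrite card_le_II; apply: pole_ord_hankel_minor.
Qed.

(** The rational function f / h has no affine pole, so [h] divides [f] and the quotient is the
    required function. *)
Lemma embed_tors (xi : affine_point X) N : embed X (Some xi) *+ N = 0 -> tors xi N.
Proof.
move=> /embed_mulrn_eq0[f [h [f0 h0 E]]].
have aff zeta : (affine_ord zeta f = affine_ord zeta h + (zeta == xi) * N)%N.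
  have := E (Some zeta); rewrite /= subr0 => e.
  have -> : (zeta == xi) = (Some zeta == Some xi) by [].
  by move: e; case: (_ == _); rewrite ?mul0rn; lia.
have [zeta|r er] := dvd_affine_ord f0 h0; first by rewrite aff leq_addr.
have r0 : r != 0 by apply: contraNneq f0 => r0; rewrite er r0 mulr0.
exists r; split=> //.
  apply/affine_ord_ge => //; have := aff xi; rewrite er affine_ordM // eqxx mul1n.
  by move=> /addnI ->.
have := E (infty X); rewrite /= er pole_ordM // sub0r; lia.
Qed.

Lemma embed_infty : embed X (infty X) *+ 2 = 0.
Proof.
apply/embed_mulrn_eq0; exists 1, 1; split; rewrite ?oner_neq0 // => zeta.
by rewrite !subrr mul0rn.
Qed.

Lemma embed_weierstrass (xi : affine_point X) : evp xi w = 0 ->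
  embed X (Some xi) *+ 2 = 0.
Proof.
rewrite evp_regW => w0; apply/embed_mulrn_eq0.
exists (x - scal X (val xi).1), 1; split; rewrite ?oner_neq0 ?sub_scal_neq0 //.
have ord1 (zeta : affine_point X) : affine_ord zeta (1 : R) = 0%N.
  by apply/affine_ord_eq0; rewrite ?oner_neq0 // rmorph1; apply/eqP/oner_neq0.
have pole1 : pole_ord (1 : R) = 0%N.
  by rewrite -(rmorph1 (regC X)) pole_ord_regC size_poly1.
case=> [zeta|] /=; last first.
  by rewrite -regC_XsubC pole_ord_regC pole1 size_XsubC.
rewrite ord1 !subr0.
have -> : (Some zeta == Some xi) = (zeta == xi) by [].
have [->|ne] := eqVneq zeta xi; first by rewrite weierstrass_ord.
rewrite affine_ord_sub_scal_neq ?mul0rn //; apply: contraNneq ne => e.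
case: (point_over e) => [->//|->]; apply/eqP/val_inj => /=.
rewrite [RHS]surjective_pairing; congr pair; apply/eqP; rewrite -subr_eq0 -oppr_eq0 -w0.
by apply/eqP; ring.
Qed.

End Torsion.

(** * Halving torsion points in characteristic 2 *)

Section PolyCharTwo.
Variable k : closedFieldType.
Hypothesis k2 : (2 : k) = 0.

Lemma coef_sqr_even_char2 (p : {poly k}) i : (p ^+ 2)`_(2 * i) = p`_i ^+ 2.
Proof.
have pk2 : (2 : {poly k}) = 0 by rewrite -polyC_natr k2 polyC0.
elim/poly_ind: p i => [|p c IH] i; first by rewrite expr0n !coef0 expr0n.
have -> : (p * 'X + c%:P) ^+ 2 = p ^+ 2 * 'X * 'X + (c ^+ 2)%:P.
  rewrite sqrrD [_ *+ 2]mulr2n (addrr_two0 pk2) addr0 exprMn polyC_exp.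
  by rewrite ['X ^+ 2]expr2 mulrA.
case: i => [|i]; first by rewrite muln0 !coefD !coefMX !coefC /= !add0r.
by rewrite mulnS !coefD !coefMX !coefC /= !addr0 IH.
Qed.

(** The odd coefficients vanish, and the even ones have square roots in [k]; squaring is
    additive. *)
Lemma poly_sqrt_char2 (p : {poly k}) : p^`() = 0 -> exists r, p = r ^+ 2.
Proof.
move=> p'0.
have sqrtk (z : k) : exists s, s ^+ 2 = z.
  have [|s] := @closed_rootP k ('X^2 - z%:P) _; first by rewrite size_XnsubC.
  by rewrite /root !hornerE subr_eq0 => /eqP e; exists s.
have [s hs] := choice sqrtk.
exists (\poly_(i < size p) s p`_(2 * i)); apply/polyP => i.
rewrite -(odd_double_half i) -mul2n; case: (odd i) => /=; last first.
  rewrite add0n coef_sqr_even_char2 coef_poly; case: ltnP => [_|le]; first by rewrite hs.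
  by rewrite expr0n nth_default // (leq_trans le) // leq_pmull.
rewrite (coef_sqr_two0 k2); last by rewrite /= mul2n odd_double.
have := congr1 (fun q : {poly k} => q`_(2 * i./2)) p'0.
rewrite coef0 coef_deriv mulrn_odd_two0 //.
by rewrite /= mul2n odd_double.
Qed.
End PolyCharTwo.

Section Halving.
Variables (k : closedFieldType) (g : nat) (X : hyperelliptic k g).
Local Notation P := (hypP X).
Local Notation Q := (hypQ X).
Local Notation R := (coord_ring X).
Local Notation x := (regX X).
Local Notation y := (regY X).
Local Notation w := (regW X).

Section Point.
Variable xi : affine_point X.
Local Notation a := (val xi).1.
Local Notation "p ^e" := (map_poly (evp xi) p) (at level 2, format "p ^e").
Hypothesis w0 : evp xi w != 0.

(** Expand the norm as [f] times its conjugate in t, then return to the abscissa by t = (X - a) /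
    w^2. *)
Lemma reg_norm_dvd m f : max_ideal_exp xi m f ->
  exists s, reg_norm f = ('X - a%:P) ^+ m * s.
Proof.
move=> mf; have [r er] := expand_dvd mf (leqnSn m).
have [t et] := expandM xi m f (reg_conj f).
move: et; rewrite -reg_normE expand_regC er exprS => et.
pose u := evp xi w; pose T : {poly k} := ((u ^+ 2)^-1)%:P * ('X - a%:P).
have eT : (xpoly X)^e \Po T = 'X.
  rewrite evp_xpoly comp_polyD comp_polyM comp_polyX !comp_polyC /T mulrA -polyCM.
  by rewrite mulfV ?expf_neq0 // mul1r addrC subrK.
have := congr1 (comp_poly T) et; rewrite /= -comp_polyA eT comp_polyXr => ->.
exists (((u ^+ 2)^-1)%:P ^+ m * ((r * expand xi m (reg_conj f) + 'X * t) \Po T)).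
have -> : 'X^m * r * expand xi m (reg_conj f) + 'X * 'X^m * t =
   'X^m * (r * expand xi m (reg_conj f) + 'X * t) by ring.
by rewrite comp_polyM comp_Xn_poly /T exprMn; ring.
Qed.

Lemma tors_norm m f : f != 0 -> max_ideal_exp xi m f -> (pole_ord f <= m)%N ->
  pole_ord f = m /\ exists2 c, c != 0 & reg_norm f = c *: ('X - a%:P) ^+ m.
Proof.
move=> f0 mf pf; have [s es] := reg_norm_dvd mf.
have n0 := reg_norm_neq0 f0.
have s0 : s != 0 by apply: contraNneq n0 => s0; rewrite es s0 mulr0.
have := size_reg_norm f0; rewrite es size_mul ?expf_neq0 ?polyXsubC_eq0 //.
rewrite size_exp_XsubC addSn /= => e.
have sz : size s = 1%N by move: s0 e pf; rewrite -size_poly_gt0; move: (size s) => t; lia.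
split; first by move: e; rewrite sz; lia.
have /size_poly1P[c c0 ec] : size s == 1%N by rewrite sz.
by exists c => //; rewrite ec mulrC mul_polyC.
Qed.

Lemma affine_ord_sub_scal : (affine_ord xi (x - scal X a)%R <= 1)%N.
Proof.
rewrite leqNgt; apply/negP => /(affine_ord_ge xi 2 (sub_scal_neq0 X a)) m2.
have [r] := expand_dvd m2 (leqnSn 2).
rewrite -regC_XsubC expand_regC comp_polyB comp_polyX comp_polyC evp_xpoly addrC addKr.
move=> /(congr1 (fun p : {poly k} => p`_1)).
rewrite coefCM coefX mulr1 coefXnM /= => /eqP.
by rewrite sqrf_eq0 (negbTE w0).
Qed.

(** The pole order is exactly [n], and an odd pole order can only come from the y-term. *)
Lemma odd_tors_bound n : odd n -> tors xi n -> (2 * g + 1 <= n)%N.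
Proof.
move=> on [f [f0 mf pf]]; have [e _] := tors_norm f0 mf pf.
move: e; rewrite /pole_ord; move: (size _).-1 => s; case: eqP => _.
  by rewrite maxn0 => e; move: on; rewrite -e mul2n odd_double.
move: (size _).-1 => t e; have : (n = 2 * s \/ n = 2 * t + (2 * g + 1))%N by lia.
by case=> en; [move: on; rewrite en mul2n odd_double|lia].
Qed.

Hypotheses (g0 : (0 < g)%N) (k2 : (2 : k) = 0) (sQ : (size Q <= 1)%N).

(** A common root is a root of the norm, hence equals a. Dividing by x - a would then lower the pole
    order by 2 but the order at xi by at most 1, against [tors_norm]. *)
Lemma coprime_coefY m f : (0 < m)%N -> f != 0 -> max_ideal_exp xi m f ->
  (pole_ord f <= m)%N -> coprimep (coefY0 f) (coefY1 f).
Proof.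
move=> m0 f0 mf pf; have [pfm [c c0 nf]] := tors_norm f0 mf pf.
apply: Pdiv.ClosedField.root_coprimep => z rA; apply/negP => rB.
have za : z = a.
  have : (reg_norm f).[z] = 0.
    by rewrite /reg_norm !hornerE (rootP rA) (eqP rB) !(mul0r, expr0n, subr0, subrr).
  rewrite nf !hornerE => /eqP.
  by rewrite mulf_eq0 (negbTE c0) expf_eq0 m0 subr_eq0 => /eqP.
move: rA rB; rewrite za => /factor_theorem[p ep] /factor_theorem[q eq].
have ef : f = (x - scal X a) * (regC X p + regC X q * y).
  by rewrite {1}(regularE f) ep eq !rmorphM /= regC_XsubC; ring.
set f' := regC X p + _ in ef.
have f'0 : f' != 0 by apply: contraNneq f0 => f'0; rewrite ef f'0 mulr0.
have s0 := sub_scal_neq0 X a.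
have pf' : pole_ord f = (2 + pole_ord f')%N.
  by rewrite ef pole_ordM // -regC_XsubC pole_ord_regC size_XsubC.
have mf' : max_ideal_exp xi m.-1 f'.
  apply/affine_ord_ge => //; have /(affine_ord_ge xi m f0) := mf.
  by rewrite ef affine_ordM //; have := affine_ord_sub_scal; lia.
have [|pf'' _] := tors_norm f'0 mf' _; first by lia.
by move: pf''; lia.
Qed.

(* A function with divisor 2 M (xi - infty) is a square: its norm
   a^2 + q a b + b^2 P is a square, and differentiating shows that b, and then the
   remaining component, has derivative zero. *)
Lemma tors_half M : (0 < M)%N -> tors xi (2 * M) -> tors xi M.
Proof.
move=> M0 [f [f0 mf pf]].
have cop := coprime_coefY (_ : 0 < 2 * M)%N f0 mf pf.
have {}cop : coprimep (coefY0 f) (coefY1 f) by apply: cop; lia.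
have [_ [c c0 nf]] := tors_norm f0 mf pf.
have [q q0 Qq] := Q_char2 g0 k2 sQ.
have pk2 : (2 : {poly k}) = 0 by rewrite -polyC_natr k2 polyC0.
have add2 := addrr_two0 pk2; have opp2 := oppr_two0 pk2.
set A := coefY0 f in cop; set B := coefY1 f in cop.
have E : q%:P * (A^`() * B + A * B^`()) = B ^+ 2 * P^`().
  have : (reg_norm f)^`() = 0.
    by rewrite nf derivZ deriv_exp mulrnA mulr2n add2 mul0rn scaler0.
  rewrite /reg_norm -/A -/B Qq !expr2 !derivE => e.
  apply/eqP; rewrite -subr_eq0 opp2 -e; apply/eqP.
  rewrite !opp2 mulr0 addr0 [B * B^`()]mulrC [A * A^`()]mulrC !add2 mul0r !add0r.
  by rewrite mulrC [(_ + _) * _]mulrC.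
have B'0 : B^`() = 0.
  apply/eqP; apply: contraT => B'0.
  have B0 : B != 0 by apply: contraNneq B'0 => ->; rewrite deriv0.
  (* [B] is prime to [A], so it would divide its own derivative, which has smaller degree. *)
  have : B %| A * B^`().
    have -> : A * B^`() = B * ((q^-1)%:P * (B * P^`() - q%:P * A^`())).
      transitivity ((q^-1)%:P * (q%:P * (A^`() * B + A * B^`()) - q%:P * A^`() * B)).
        transitivity ((q^-1)%:P * q%:P * (A * B^`())); last by ring.
        by rewrite -polyCM mulVf // mul1r.
      by rewrite E; ring.
    exact: dvdp_mulIl.
  rewrite Gauss_dvdpr; last by rewrite coprimep_sym.
  move/(dvdp_leq B'0); have := lt_size_deriv B0.
  by move: (size B) (size B^`()) => s t; lia.
have E' : q%:P * A^`() = B * P^`().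
  have [B0|B0] := eqVneq B 0.
    move: cop; rewrite B0 coprimep0 -size_poly_eq1 => /size_poly1P[c' _ ->].
    by rewrite derivC mulr0 mul0r.
  apply: (mulIf B0); move: E; rewrite B'0 mulr0 addr0 expr2 => E.
  by rewrite -mulrA E; ring.
have [B1 eB] := poly_sqrt_char2 k2 B'0.
have [s es] : exists s : k, s ^+ 2 = q^-1.
  have [|s] := @closed_rootP k ('X^2 - (q^-1)%:P) _; first by rewrite size_XnsubC.
  by rewrite /root !hornerE subr_eq0 => /eqP e; exists s.
(* In characteristic 2 the square of a1 + b1 y is a1^2 + b1^2 P + q b1^2 y, which dictates b1^2 = B
   / q and a1^2 = A + b1^2 P. *)
pose b1 := s%:P * B1.
have b1E : b1 ^+ 2 = (q^-1)%:P * B by rewrite /b1 exprMn -polyC_exp es -eB.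
have [a1 ea] : exists a1, A + b1 ^+ 2 * P = a1 ^+ 2.
  apply: poly_sqrt_char2 => //.
  rewrite b1E !derivE B'0 mulr0 !mul0r !add0r -mulrA -E' mulrA -polyCM mulVf //.
  by rewrite mul1r add2.
pose h := regC X a1 + regC X b1 * y.
have fh : f = h * h.
  rewrite (regularE f) (regularE (h * h)) !coefYM /h !coefYK -/A -/B.
  congr (regC X _ + regC X _ * y).
    by rewrite -!expr2 -ea -addrA add2 addr0.
  rewrite [b1 * a1]mulrC add2 sub0r opp2 -expr2 b1E Qq mulrAC -polyCM mulVf //.
  by rewrite mul1r.
have h0 : h != 0 by apply: contraNneq f0 => h0; rewrite fh h0 mulr0.
exists h; split=> //.
  apply/affine_ord_ge => //; have /(affine_ord_ge xi _ f0) := mf.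
  by rewrite fh affine_ordM //; lia.
by move: pf; rewrite fh pole_ordM //; lia.
Qed.

End Point.

Lemma tors_odd_part : (0 < g)%N -> (2 : k) = 0 -> (size Q <= 1)%N ->
  forall N, (0 < N)%N -> exists n, [/\ odd n, n = N \/ (2 * n <= N)%N &
  forall xi : affine_point X, evp xi w != 0 -> tors xi N -> tors xi n].
Proof.
move=> g0 k2 sQ N; have [m] := ubnP N; elim: m N => // m IH N Nm N0.
have [oN|eN] := boolP (odd N); first by exists N; split=> //; left.
have eN2 : N = (2 * N./2)%N by lia.
have [||n [on nN h]] := IH N./2; try lia.
exists n; split=> //; first by right; lia.
by move=> xi w0 t; apply: h => //; apply: tors_half => //; [lia|rewrite -eN2].
Qed.

End Halving.

(** * Counting the torsion points *)

Local Open Scope classical_set_scope.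
Local Open Scope card_scope.

Lemma torsion_boundE g N : (0 < g)%N -> (2 * g + 1 <= N)%N ->
  (4 * g * ((uphalf N - g) * (N./2 + g)) =
   if ~~ odd N then g * (N ^ 2 - (2 * g) ^ 2) else g * (N ^ 2 - (2 * g - 1) ^ 2))%N.
Proof.
move=> g0 gN; rewrite !subn_sqr.
have [d eN] : exists d, (N = 2 * (g + d) + odd N)%N by exists (N./2 - g)%N; lia.
case: ifP => oN.
  have -> : (uphalf N - g = d)%N by lia.
  have -> : (N./2 + g = 2 * g + d)%N by lia.
  have -> : (N - 2 * g = 2 * d)%N by lia.
  have -> : (N + 2 * g = 2 * (2 * g + d))%N by lia.
  by move: (2 * g + d)%N => t; nia.
have -> : (uphalf N - g = d.+1)%N by lia.
have -> : (N./2 + g = 2 * g + d)%N by lia.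
have -> : (N - (2 * g - 1) = 2 * d.+1)%N by lia.
have -> : (N + (2 * g - 1) = 2 * (2 * g + d))%N by lia.
by move: (2 * g + d)%N => t; nia.
Qed.

(** In the exceptional case N is replaced by an odd n <= N with no loss of points. If n < 2g+1 there
    are none, and otherwise the bound for n is at most the bound for N. *)
Lemma card_tors (k : closedFieldType) (g N : nat) (X : hyperelliptic k g) :
  (0 < g)%N -> (2 * g + 1 <= N)%N ->
  [set xi | evp xi (regW X) != 0 /\ tors xi N] #<=
    `I_(4 * g * ((uphalf N - g) * (N./2 + g)))%N.
Proof.
move=> g0 gN.
have [k2|k2] := eqVneq (2 : k) 0; last by apply: card_tors_generic => //; left.
have [sQ|sQ] := ltnP 1 (size (hypQ X)).
  by apply: card_tors_generic => //; right; left.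
have [|n [on nN h]] := tors_odd_part g0 k2 sQ (N := N) _; first by lia.
have sub : [set xi | evp xi (regW X) != 0 /\ tors xi N] `<=`
    [set xi : affine_point X | evp xi (regW X) != 0 /\ tors xi n].
  by move=> xi [w0 t]; split=> //; apply: h.
apply: card_le_trans (subset_card_le sub) _.
have [gn|gn] := leqP (2 * g + 1) n; last first.
  rewrite (_ : [set xi | _] = set0) ?card_ge0 //.
  apply/seteqP; split=> // xi [w0 t].
  by have := odd_tors_bound w0 on t; lia.
apply: card_le_trans (card_tors_generic (X := X) g0 gn _) _; first by right; right.
rewrite card_le_II !leq_mul //; lia.
Qed.

Theorem proposition3p10 (k : closedFieldType) (g N : nat)
    (hg : (1 <= g)%N) (hN : (2 * g + 1 <= N)%N) (X : hyperelliptic k g) :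
  range (embed X) `&` (torsion (jacobian X) N `\` torsion (jacobian X) 2)
  #<= `I_(if ~~ odd N then g * (N ^ 2 - (2 * g) ^ 2)
          else g * (N ^ 2 - (2 * g - 1) ^ 2))%N.
Proof.
rewrite -torsion_boundE //; apply: card_le_trans (card_tors X hg hN).
apply: card_le_trans (card_image_le (fun xi => embed X (Some xi)) _).
(* Infinity and the points where [regW] vanishes are 2-torsion, so removing the 2-torsion leaves
   only points where the Taylor expansion is usable. *)
apply: subset_card_le => z [[[xi|] _ <-] [tN t2]]; last first.
  by case: t2; exact: embed_infty.
exists xi => //; split; last exact: embed_tors.
by apply/eqP => w0; apply: t2; exact: embed_weierstrass.
Qed.
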